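(* Let $q$ be a prime power, $m\ge 2$, and let $D^{(m)}=(t)_0^{T_m}$ be the zero divisor in $T_m$ of $t=(x_1^{q^2}-x_1)/(x_1^q+x_1)$. For $\alpha\in\Omega^*$ and $1\le k\le\lfloor (m-2)/2\rfloor$, let $v_\alpha,w_{k,\alpha},v_0,v_\infty\in\mathbb{Z}$ and consider the divisor $$G^{(m)}=\sum_{\alpha\in\Omega^*}v_\alpha P_\alpha^{(m)}+\sum_{k=1}^{\lfloor (m-2)/2\rfloor}\sum_{\alpha\in\Omega^*}w_{k,\alpha}A_{k,\alpha}^{(m)}+v_0(x_1)_0^{T_m}+v_\infty P_\infty^{(m)}$$ of $T_m$. If (i) $0\le v_\alpha\le (q^m-2)/2$ for all $\alpha\in\Omega^*$; (ii) $0\le w_{k,\alpha}\le q^{m-2k-1}-1$ for all $\alpha\in\Omega^*$ and $1\le k\le\lfloor (m-2)/2\rfloor$; (iii) $0\le v_0\le (q-2)/2$; and (iv) $0\le v_\infty\le (q^m-2)/2$, then $\mathcal{C}_{\mathcal{L}}(D^{(m)},G^{(m)})$ is a self-orthogonal code over $\mathbb{F}_{q^2}$.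
   Context: The Garcia–Stichtenoth tower over $\mathbb{F}_{q^2}$: $T_1=\mathbb{F}_{q^2}(x_1)$ is the rational function field and, for $m\ge 2$, $T_m=T_{m-1}(x_m)$ where $x_{i+1}^q+x_{i+1}=\dfrac{x_i^q}{x_i^{q-1}+1}$ for $i=1,\dots,m-1$. The full constant field of $T_m$ is $\mathbb{F}_{q^2}$ and $[T_m:T_1]=q^{m-1}$. $\Omega=\{\alpha\in\mathbb{F}_{q^2}:\alpha^q+\alpha=0\}$ and $\Omega^*=\Omega\setminus\{0\}$. The pole of $x_1$ in $T_1$, and the zero of $x_1-\alpha$ in $T_1$ for each $\alpha\in\Omega^*$, are totally ramified in $T_m/T_1$; $P_\infty^{(m)}$, respectively $P_\alpha^{(m)}$, denotes the unique place of $T_m$ above it. For $\alpha\in\Omega^*$ and $0\le k\le m-1$, $A_{k,\alpha}^{(m)}$ is the sum (each with coefficient 1) of all places $Q$ of $T_m$ that are zeros of $x_{k+1}-\alpha$. Empty sums are $0$. For $z\in T_m$, $(z)_0^{T_m}$ denotes the zero divisor of $z$ in $T_m$. The divisor $D^{(m)}$ is a sum of $q^{m+1}-q^m$ distinct rational places (the places of $T_m$ above the zeros of $x_1-a$, $a\in\mathbb{F}_{q^2}\setminus\Omega$). For $D=P_1+\dots+P_n$ a sum of distinct rational places and a divisor $G$ with support disjoint from that of $D$, $\mathcal{C}_{\mathcal{L}}(D,G)=\{(z(P_1),\dots,z(P_n)):z\in\mathcal{L}(G)\}$, where $\mathcal{L}(G)$ is the Riemann–Roch space. A code $\mathcal{C}$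 is self-orthogonal if $\mathcal{C}\subseteq\mathcal{C}^\perp$, where $\mathcal{C}^\perp$ is the Euclidean dual. *)

(* Defs.v *)
From HB Require Import structures.
From mathcomp Require Import all_boot all_order all_algebra all_field.
From mathcomp Require Import mathcomp_extra boolp classical_sets functions cardinality fsbigop.
From mathcomp Require Import freeg.

Set Implicit Arguments.
Unset Strict Implicit.
Unset Printing Implicit Defensive.

Import Order.TTheory GRing.Theory Num.Theory.

Local Open Scope classical_set_scope.
Local Open Scope ring_scope.

(* A place of a field F over a field of constants K, embedded in F by [iota], *)
(* is the maximal ideal of a valuation ring K < O < F.  Since the ideal and   *)
(* the ring determine each other, a place is recorded by its ring [vring];    *)
(* the ideal itself is [maxid] below.                                         *)
Record place (K F : fieldType) (iota : K -> F) := Place {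
  vring : set F;
  vring1 : vring 1;
  vringB : forall y z, vring y -> vring z -> vring (y - z);
  vringM : forall y z, vring y -> vring z -> vring (y * z);
  vring_const : range iota `<` vring;
  vring_proper : vring `<` setT;
  vringV : forall z, vring z \/ vring z^-1
}.

HB.instance Definition _ (K F : fieldType) (iota : K -> F) :=
  gen_eqMixin (place iota).
HB.instance Definition _ (K F : fieldType) (iota : K -> F) :=
  gen_choiceMixin (place iota).

Section Places.
Variables (K F : fieldType) (iota : K -> F).
Implicit Types (P Q : place iota) (z : F).

Definition vunit P : set F := [set z | [/\ z != 0, vring P z & vring P z^-1]].

Definition maxid P : set F := vring P `\` vunit P.

Definition prime_element P z := maxid P = [set z * y | y in vring P].

(* The normalized discrete valuation: v_P(z) = n iff z = t^n u with t a prime *)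
(* element and u a unit.  v_P(0) = oo is not represented: [val P 0] is the    *)
(* junk value 0, so that z = 0 has to be treated apart.                       *)
Definition val P z : int :=
  xget 0 [set n : int | exists t u,
    [/\ prime_element P t, vunit P u & z = t ^ n * u]].

Definition is_zero P z := z != 0 /\ 0 < val P z.
Definition is_pole P z := z != 0 /\ val P z < 0.

(* The residue class z(P), meaningful for P rational (O_P / P = K) and z in   *)
(* O_P.                                                                       *)
Definition eval_at P z : K := xget 0 [set c | maxid P (z - iota c)].

Notation divisor := {freeg (place iota)}.

(* These sums over sets of places have finite support: an element of a        *)
(* function field has finitely many zeros (is_zero excludes z = 0).           *)
Definition zero_divisor z : divisor :=
  \sum_(P \in [set P | is_zero P z]) << val P z *g P >>.

Definition sum_of_zeros z : divisor :=
  \sum_(P \in [set P | is_zero P z]) << (1 : int) *g P >>.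

Definition RR_space (G : divisor) : set F :=
  [set z | z = 0 \/ forall P, - coeff P G <= val P z].

(* C_L(D, G) for D a sum of distinct rational places, whose summands are      *)
(* enumerated by the support of D.                                            *)
Definition AG_code (D G : divisor) : set 'rV[K]_(size (dom D)) :=
  [set \row_i eval_at (tnth (in_tuple (dom D)) i) z | z in RR_space G].

End Places.

Arguments AG_code {K F iota} D G.

Section Codes.
Variables (K : fieldType) (n : nat).

Definition dual_code (C : set 'rV[K]_n) : set 'rV[K]_n :=
  [set v | forall u, C u -> \sum_i u 0 i * v 0 i = 0].

Definition self_orthogonal (C : set 'rV[K]_n) := C `<=` dual_code C.

End Codes.

Definition prime_power (q : nat) :=
  exists p e : nat, [/\ prime p, (0 < e)%N & q = (p ^ e)%N].

Section Tower.
Variable K : finFieldType.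

Definition rat_funs : fieldType := {fraction {poly K}}.

Definition const1 (c : K) : rat_funs := tofrac c%:P.

Definition X1 : rat_funs := tofrac 'X.

Variables (q m : nat) (T : fieldExtType rat_funs).

Definition constT (c : K) : T := (const1 c)%:A.

(* T is T_m = T_1(x_2, ..., x_m); the sequence x is indexed from 1, its other *)
(* values are irrelevant.                                                     *)
Definition GS_tower (x : nat -> T) :=
  [/\ x 1%N = X1%:A,
      forall i, (1 <= i < m)%N ->
        x i.+1 ^+ q + x i.+1 = x i ^+ q / (x i ^+ q.-1 + 1)
    & <<1 & [seq x i | i <- iota 2 m.-1]>>%VS = fullv].

Definition lies_above (P' : place constT) (P : place const1) :=
  forall z, maxid P z -> maxid P' z%:A.

Definition Omega_star : pred K := [pred a | (a ^+ q + a == 0) && (a != 0)].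

Definition A_div (x : nat -> T) (k : nat) (a : K) : {freeg (place constT)} :=
  sum_of_zeros constT (x k.+1 - constT a).

End Tower.

(* Main.v *)
Require Import Defs.
From mathcomp Require Import all_boot all_order all_algebra all_field.
From mathcomp Require Import boolp classical_sets functions cardinality fsbigop freeg.
From mathcomp Require Import finmap.
From mathcomp Require Import ring zify.
From HB Require Import structures.

Set Implicit Arguments.
Unset Strict Implicit.
Unset Printing Implicit Defensive.

Import Order.TTheory GRing.Theory Num.Theory.

Local Open Scope classical_set_scope.
Local Open Scope ring_scope.

(** The inner product of the words of f1 and f2 is the sum of the values of f1 f2 at
    the zeros of t. These lie above the a in K with a ^ q + a <> 0, and all the
    places above such an a are rational and unramified over x_1 = a. The sum is
    therefore the sum over a of the values h(a), where h in K(x_1) is the trace of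
    f1 f2.

    The bounds on G say that h (x_1 ^ q + x_1) ^ (q - 2) has no finite pole
    ([finite_integral]) and that h x_1 ^ (2 - q) has no pole at infinity
    ([infinite_integral]). So h (x_1 ^ q + x_1) ^ (q - 2) is a polynomial N of degree
    at most (q + 1) (q - 2) ([trace_polynomial]). As a ^ q + a is a nonzero element of
    the field of q elements, h(a) = N(a) (a ^ q + a). The sum over a is the sum of all
    the values on K of a polynomial of degree at most q ^ 2 - 2, hence zero
    ([sum_horner0]).

    Places are handled through homomorphisms into an algebraically closed field L
    with a place, which contains C(t) for an algebraic closure C of K and its t-adic
    closure ([local_model]). The variable x_1 is sent to c + t or to 1 / t, and the
    homomorphism is extended along the tower one equation
    y ^ q + y = beta (x_n) at a time. Summing over the q roots y computes the trace of
    one step ([sum_ext]), so that the integrality of a trace follows from that of the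
    function at all the extensions ([descend_unram]).

    The extensions stay in the t-adic closure as long as the pole of beta (x_n) can be
    removed by a substitution. If x_(k+1) is the first generator that does not vanish
    at a place above the zero of x_1, say with residue a, then x_(k+1+j) behaves like
    - a ^ 2 / x_(k+1-j), so the tower is unramified up to x_(2k+1)
    ([integral_pivot], [integral_zero]). There beta has a simple pole, and from then on
    every step is totally ramified. In this part traces are estimated through the pole
    orders of the digits of f in the powers of y, which are distinct modulo q
    ([digits], [ramified_extend]); this replaces the computation of the different, of
    exponent 2 (Q - 1) for ramification index Q ([ramified_integral]). The
    coefficients of G are such that the poles of f1 f2 remain within that exponent
    ([pivot_bound], [infinite_bound]).

    The places above a good a correspond to words over Omega, which record the choice
    of the roots ([word_hom], [place_is_word]). *)

(** * Valuation rings, orders and congruences *)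

(** The right hand side of the recursion of the tower. *)
Definition beta (F : fieldType) (q : nat) (y : F) := y ^+ q / (y ^+ q.-1 + 1).

Lemma size_AS_poly (F : fieldType) (q : nat) (b : F) : (1 < q)%N ->
  size ('X^q + 'X - b%:P) = q.+1.
Proof.
move=> q1; rewrite -addrA size_polyDl size_polyXn // ltnS.
rewrite (leq_trans (size_polyD _ _)) // geq_max size_polyX q1 size_polyN.
by rewrite (leq_trans (size_polyC_leq1 _)) // ltnW.
Qed.

Lemma monic_AS_poly (F : fieldType) (q : nat) (b : F) : (1 < q)%N ->
  'X^q + 'X - b%:P \is monic.
Proof.
move=> q1; rewrite monicE -addrA lead_coefDl ?lead_coefXn // size_polyXn ltnS.
rewrite (leq_trans (size_polyD _ _)) // geq_max size_polyX q1 size_polyN.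
by rewrite (leq_trans (size_polyC_leq1 _)) // ltnW.
Qed.

Section PlaceTheory.
Variables (K F : fieldType) (iota : K -> F) (P : place iota).
Implicit Types (a b u y z : F).

Lemma vring0 : vring P 0.
Proof. by rewrite -(subrr 1); apply: vringB; apply: vring1. Qed.

Lemma vringN z : vring P z -> vring P (- z).
Proof. by move=> Pz; rewrite -sub0r; apply: vringB => //; apply: vring0. Qed.

Lemma vringD y z : vring P y -> vring P z -> vring P (y + z).
Proof. by move=> Py Pz; rewrite -[z]opprK; apply/vringB/vringN. Qed.

Lemma vringX n z : vring P z -> vring P (z ^+ n).
Proof.
move=> Pz; elim: n => [|n IH]; first exact: vring1.
by rewrite exprS; apply: vringM.
Qed.

Lemma vring_sum (I : Type) (r : seq I) (C : pred I) (f : I -> F) :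
  (forall i, C i -> vring P (f i)) -> vring P (\sum_(i <- r | C i) f i).
Proof. by move=> Pf; apply: big_ind => //; [apply: vring0|apply: vringD]. Qed.

Lemma vring_prod (I : Type) (r : seq I) (C : pred I) (f : I -> F) :
  (forall i, C i -> vring P (f i)) -> vring P (\prod_(i <- r | C i) f i).
Proof. by move=> Pf; apply: big_ind => //; [apply: vring1|apply: vringM]. Qed.

Lemma vring_const1 c : vring P (iota c).
Proof. by case: (vring_const P) => + _; apply; exists c. Qed.

Lemma vring_horner (p : {poly F}) y :
  (forall i, vring P p`_i) -> vring P y -> vring P p.[y].
Proof.
move=> Pp Py; rewrite horner_coef; apply: vring_sum => i _.
by apply: vringM => //; apply: vringX.
Qed.

Lemma maxidP z : maxid P z <-> z = 0 \/ ~ vring P z^-1.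
Proof.
split=> [[Pz nu]|[->|nP]].
- have [->|z0] := eqVneq z 0; [by left | right=> Pz'; by apply: nu].
- by split; [apply: vring0 | case; rewrite eqxx].
- by split=> [|[]//]; case: (vringV P z) => // /nP.
Qed.

Lemma maxid_vring z : maxid P z -> vring P z. Proof. by case. Qed.

Lemma vunit_vring z : vunit P z -> vring P z. Proof. by case. Qed.

Lemma vunit_neq0 z : vunit P z -> z != 0. Proof. by case. Qed.

Lemma vunitE z : vunit P z <-> vring P z /\ ~ maxid P z.
Proof.
split=> [uz|[Pz nm]]; first by split; [case: uz | case].
by apply: contrapT => nu; apply: nm.
Qed.

Lemma maxid0 : maxid P 0. Proof. by apply/maxidP; left. Qed.

Lemma vunit1 : vunit P 1.
Proof. by split; rewrite ?invr1 ?oner_eq0 //; apply: vring1. Qed.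

Lemma vunitM y z : vunit P y -> vunit P z -> vunit P (y * z).
Proof.
move=> [y0 Py Pyi] [z0 Pz Pzi]; split; first by rewrite mulf_neq0.
  exact: vringM.
by rewrite invfM; apply: vringM.
Qed.

Lemma vunitV z : vunit P z -> vunit P z^-1.
Proof. by case=> z0 Pz Pzi; split; rewrite ?invr_eq0 ?invrK. Qed.

Lemma vunit_div y z : vunit P y -> vunit P z -> vunit P (y / z).
Proof. by move=> uy uz; apply/vunitM/vunitV. Qed.

Lemma vunitX n z : vunit P z -> vunit P (z ^+ n).
Proof.
move=> uz; elim: n => [|n IH]; first exact: vunit1.
by rewrite exprS; apply: vunitM.
Qed.

Lemma vunitXz (n : int) z : vunit P z -> vunit P (z ^ n).
Proof. by move=> uz; case: n => n; [|apply: vunitV]; apply: vunitX. Qed.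

Lemma vunitN z : vunit P z -> vunit P (- z).
Proof.
by case=> z0 Pz Pzi; split; rewrite ?oppr_eq0 ?invrN //; apply: vringN.
Qed.

Lemma vunit_prod (I : Type) (r : seq I) (C : pred I) (f : I -> F) :
  (forall i, C i -> vunit P (f i)) -> vunit P (\prod_(i <- r | C i) f i).
Proof. by move=> Pf; apply: big_ind => //; [apply: vunit1|apply: vunitM]. Qed.

Lemma maxidMl a z : vring P a -> maxid P z -> maxid P (a * z).
Proof.
move=> Pa /maxidP mz; apply/maxidP; case: mz => [->|nz]; first by left; rewrite mulr0.
have [->|a0] := eqVneq a 0; first by left; rewrite mul0r.
right=> Paz; apply: nz.
have -> : z^-1 = a * (a * z)^-1 by rewrite invfM mulVKf.
exact: vringM.
Qed.

Lemma maxidMr a z : vring P a -> maxid P z -> maxid P (z * a).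
Proof. by rewrite mulrC; apply: maxidMl. Qed.

Lemma maxid1 : ~ maxid P 1.
Proof. by case=> _; apply; apply: vunit1. Qed.

Lemma maxid_vunit z : maxid P z -> ~ vunit P z. Proof. by case. Qed.

Lemma maxidN z : maxid P z -> maxid P (- z).
Proof. by move=> mz; rewrite -mulN1r; apply/maxidMl/mz/vringN/vring1. Qed.

Lemma maxidD y z : maxid P y -> maxid P z -> maxid P (y + z).
Proof.
have [->|y0] := eqVneq y 0; first by rewrite add0r.
have [->|z0] := eqVneq z 0; first by rewrite addr0.
wlog: y z y0 z0 / vring P (y / z) => [hw|Pyz] my mz.
  case: (vringV P (y / z)) => Pyz; first exact: hw.
  by rewrite addrC; apply: hw => //; rewrite invfM invrK mulrC in Pyz.
have -> : y + z = (y / z + 1) * z by rewrite mulrDl mul1r divfK.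
by apply: maxidMl => //; apply/vringD/vring1.
Qed.

Lemma maxidB y z : maxid P y -> maxid P z -> maxid P (y - z).
Proof. by move=> my mz; apply/maxidD/maxidN. Qed.

Lemma maxidX n z : (0 < n)%N -> maxid P z -> maxid P (z ^+ n).
Proof.
by case: n => // n _ mz; rewrite exprS mulrC; apply/maxidMl/mz/vringX/maxid_vring.
Qed.

Lemma maxid_sum (I : Type) (r : seq I) (C : pred I) (f : I -> F) :
  (forall i, C i -> maxid P (f i)) -> maxid P (\sum_(i <- r | C i) f i).
Proof. by move=> Pf; apply: big_ind => //; [apply: maxid0|apply: maxidD]. Qed.

Lemma maxid_prime y z :
  vring P y -> vring P z -> maxid P (y * z) -> maxid P y \/ maxid P z.
Proof.
move=> Py Pz myz; apply: contrapT => /not_orP[ny nz].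
by case: (myz) => _; apply; apply: vunitM; apply/vunitE.
Qed.

Lemma maxid_prod (I : eqType) (r : seq I) (f : I -> F) :
  (forall i, i \in r -> vring P (f i)) -> maxid P (\prod_(i <- r) f i) ->
  exists2 i, i \in r & maxid P (f i).
Proof.
elim: r => [|i r IH] Pf; first by rewrite big_nil => /maxid1.
rewrite big_cons => /maxid_prime[||mi|mr].
- by apply: Pf; rewrite mem_head.
- rewrite big_seq; apply: vring_prod => j jr.
  by apply: Pf; rewrite inE jr orbT.
- by exists i; rewrite // mem_head.
- have [|j jr mj] := IH _ mr.
    by move=> j jr; apply: Pf; rewrite inE jr orbT.
  by exists j; rewrite // inE jr orbT.
Qed.

Lemma vunitDm u z : vunit P u -> maxid P z -> vunit P (u + z).
Proof.
move=> uu mz; apply/vunitE; split.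
  by apply: vringD; [case: uu | apply: maxid_vring].
move=> muz; case/vunitE: uu => _; apply.
by rewrite -[u](addrK z); apply: maxidB.
Qed.

Lemma cong_vring u u0 : vring P u0 -> maxid P (u - u0) -> vring P u.
Proof. by move=> Pu /maxid_vring Pd; rewrite -[u](subrK u0); apply: vringD. Qed.

Lemma congM u u0 z z0 : vring P u0 -> vring P z0 ->
  maxid P (u - u0) -> maxid P (z - z0) -> maxid P (u * z - u0 * z0).
Proof.
move=> Pu Pz mu mz; have -> : u * z - u0 * z0 = (u - u0) * z + u0 * (z - z0) by ring.
by apply: maxidD; [apply: maxidMr => //; apply: cong_vring mz | apply: maxidMl].
Qed.

Lemma congX n u u0 : vring P u0 -> maxid P (u - u0) -> maxid P (u ^+ n - u0 ^+ n).
Proof.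
move=> Pu mu; elim: n => [|n IH]; first by rewrite subrr; apply: maxid0.
by rewrite !exprS; apply: congM => //; apply: vringX.
Qed.

Lemma cong_unit u u0 : vunit P u0 -> maxid P (u - u0) -> vunit P u.
Proof. by move=> uu mu; rewrite -[u](subrK u0) addrC; apply: vunitDm. Qed.

Lemma congV u u0 : vunit P u0 -> maxid P (u - u0) -> maxid P (u^-1 - u0^-1).
Proof.
move=> uu0 mu; have uu := cong_unit uu0 mu.
have u00 := vunit_neq0 uu0; have u0' := vunit_neq0 uu.
have -> : u^-1 - u0^-1 = - (u - u0) * (u^-1 / u0) by field; rewrite u00 u0'.
apply: maxidMr; last exact: maxidN.
by apply: vringM; [case/vunitV: uu | case/vunitV: uu0].
Qed.

Lemma pole_inv z : ~ vring P z -> maxid P z^-1 /\ z != 0.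
Proof.
move=> nz; split; first by apply/maxidP; right; rewrite invrK.
by apply: contra_notN nz => /eqP ->; apply: vring0.
Qed.

Lemma inv_pole z : z != 0 -> maxid P z -> ~ vring P z^-1.
Proof. by move=> z0 /maxidP[z00|//]; rewrite z00 eqxx in z0. Qed.

Lemma vring_root n z : (0 < n)%N -> vring P (z ^+ n) -> vring P z.
Proof.
case: n => // n _ Pz; apply: contrapT => /pole_inv[mz z0].
apply: (@inv_pole _ _ (maxidX (ltn0Sn n) mz)).
  by rewrite expf_eq0 invr_eq0 (negbTE z0).
by rewrite -exprVn invrK.
Qed.

(** [vunit P (z / t ^ n)] is the form in which the statement that z has
    valuation n with respect to t is handled below. *)
Lemma ord_vring t z (n : int) : t != 0 -> maxid P t -> vunit P (z / t ^ n) ->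
  vring P z <-> 0 <= n.
Proof.
move=> t0 mt uz.
have zE : z = z / t ^ n * t ^ n by rewrite divfK ?expfz_neq0.
split=> [Pz|n0]; last first.
  rewrite zE; apply: vringM; first by case: uz.
  by case: n n0 {uz zE} => // n _; apply/vringX/maxid_vring.
case: n uz zE => // n uz zE; exfalso.
apply: (@inv_pole _ _ (maxidX (ltn0Sn n) mt)); first by rewrite expf_neq0.
have -> : (t ^+ n.+1)^-1 = z * (z / t ^ Negz n)^-1.
  rewrite NegzE -exprnN invfM invrK mulVKf //.
  by apply: contraTneq (vunit_neq0 uz) => ->; rewrite mul0r eqxx.
by apply: vringM => //; case: uz.
Qed.

Lemma ord_maxid t z (n : int) : t != 0 -> maxid P t -> vunit P (z / t ^ n) ->
  maxid P z <-> 0 < n.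
Proof.
move=> t0 mt uz.
have z0 : z != 0 by apply: contraTneq (vunit_neq0 uz) => ->; rewrite mul0r eqxx.
have uz' : vunit P (z^-1 / t ^ (- n)).
  by rewrite -invr_expz -invfM; apply: vunitV.
have := ord_vring t0 mt uz'; rewrite oppr_ge0 => H.
split=> [/(inv_pole z0) nP|n0]; first by rewrite ltNge; apply/negP => /H.
by apply/maxidP; right=> /H; rewrite leNgt n0.
Qed.

Lemma ord_uniq t z (n k : int) : t != 0 -> maxid P t ->
  vunit P (z / t ^ n) -> vunit P (z / t ^ k) -> n = k.
Proof.
move=> t0 mt un uk; have := vunit_div un uk.
have z0 : z != 0 by apply: contraTneq (vunit_neq0 un) => ->; rewrite mul0r eqxx.
have -> : z / t ^ n / (z / t ^ k) = 1 / t ^ (n - k).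
  by rewrite expfzDr // -invr_expz; field; rewrite z0 !expfz_neq0.
move=> u; have := ord_vring t0 mt u; have := ord_maxid t0 mt u.
move=> [_ h1] [h2 _]; have h3 := h2 (vring1 P).
apply/eqP; rewrite -subr_eq0 eq_le h3 leNgt andbT; apply/negP => /h1.
exact: maxid1.
Qed.

Lemma ord_shift t z (n k : int) : t != 0 ->
  vunit P (z / t ^ n) -> vunit P (z * t ^ k / t ^ (n + k)).
Proof. by move=> t0; rewrite expfzDr // invfM mulrACA divff ?mulr1 // expfz_neq0. Qed.

Lemma ord_divr t z (n : int) : t != 0 -> maxid P t -> vunit P (z / t ^ n) ->
  maxid P z -> vring P (z / t).
Proof.
move=> t0 mt un mz; have := proj1 (ord_maxid t0 mt un) mz.
by have := ord_shift (-1) t0 un; rewrite exprN1 => u1 n0; apply/(ord_vring t0 mt u1); lia.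
Qed.

(** At a pole of y the term y ^ q dominates, so y ^ q + y has a pole as well. *)
Lemma AS_vring (q : nat) y : (1 < q)%N -> vring P (y ^+ q + y) -> vring P y.
Proof.
case: q => // q q1 Pb; apply: contrapT => nP; have [my y0] := pole_inv nP.
have u1 : vunit P (1 + y^-1 ^+ q) by apply/vunitDm/maxidX/my; [apply: vunit1|].
apply: nP; apply: (@vring_root q.+1) => //.
have -> : y ^+ q.+1 = (y ^+ q.+1 + y) / (1 + y^-1 ^+ q).
  apply: (canRL (mulfK (vunit_neq0 u1))).
  by rewrite mulrDr mulr1 exprVn exprSr mulrAC divff ?mul1r ?expf_neq0.
by apply: vringM => //; case: u1.
Qed.

Lemma AS_pole (q : nat) y : (1 < q)%N -> ~ vring P (y ^+ q + y) ->
  ~ vring P y /\ vunit P ((y ^+ q + y) / y ^+ q).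
Proof.
case: q => // q q1 nPb.
have nP : ~ vring P y by move=> Py; apply: nPb; apply: vringD => //; apply: vringX.
split=> //; have [my y0] := pole_inv nP.
have -> : (y ^+ q.+1 + y) / y ^+ q.+1 = 1 + y^-1 ^+ q.
  by rewrite exprVn exprS; field; rewrite ?y0 ?expf_neq0.
by apply/vunitDm/maxidX/my; [apply: vunit1|].
Qed.

(** The quotient is 1 / (1 + y ^ -(q - 1)). *)
Lemma beta_pole (q : nat) y : (1 < q)%N -> ~ vring P y ->
  vunit P (beta q y / y).
Proof.
rewrite /beta; case: q => // q q1 /pole_inv[my y0].
have u1 : vunit P (1 + y^-1 ^+ q) by apply/vunitDm/maxidX/my; [apply: vunit1|].
have -> : y ^+ q.+1 / (y ^+ q.+1.-1 + 1) / y = (1 + y^-1 ^+ q)^-1.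
  have -> : 1 + y^-1 ^+ q = (y ^+ q + 1) / y ^+ q.
    by rewrite mulrDl divff ?expf_neq0 // mul1r exprVn.
  have y1 : y ^+ q + 1 != 0.
    apply: contraTneq (vunit_neq0 u1) => E.
    by rewrite exprVn -[1](mulfV (expf_neq0 q y0)) -{2}[_^-1]mul1r -mulrDl E mul0r eqxx.
  by rewrite invfM invrK exprS /=; field; rewrite y0 y1.
exact: vunitV.
Qed.

End PlaceTheory.

Lemma place_eq (K F : fieldType) (iota : K -> F) (P Q : place iota) :
  (forall z, vring P z <-> vring Q z) -> P = Q.
Proof.
case: P => [p ? ? ? ? ? ?]; case: Q => [r ? ? ? ? ? ?] /= H.
have E : p = r by apply/funext => z; apply/propext.
by subst r; congr Place; apply: Prop_irrelevance.
Qed.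

(** * Extension of valuations *)

Section CountableFraction.
Variable R : countIdomainType.
HB.instance Definition _ := [Countable of ratio R by <:].
HB.instance Definition _ := Countable.copy (FracField.type R)
  (can_type (@generic_quotient.reprK _ (FracField.type R))).
(** The construction of an algebraic closure enumerates the polynomials. *)
Definition count_fraction : countFieldType := FracField.type R.
End CountableFraction.

Section ValuationExtension.
Variables (L : fieldType) (t : L).

Definition subring_of (A : set L) :=
  [/\ A 1, forall y z, A y -> A z -> A (y - z) & forall y z, A y -> A z -> A (y * z)].

(** Chevalley's theorem. A maximal ring B among those that contain A and not 1 / t
    is a valuation ring. If neither z nor 1 / z were in B, adjoining either would give
    1 / t = p(z) and 1 / t = r(1 / z) with p and r over B. Then 1 / t is an eigenvalue,
    with the powers of z as eigenvector, of a matrix over B, hence integral over B, and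
    thus in B because t is. *)
Lemma valuation_extension (A : set L) :
  subring_of A -> A t -> ~ A t^-1 ->
  exists W, [/\ subring_of W, subset A W, ~ W t^-1 &
                forall z, W z \/ W z^-1].
Proof.
move=> sA At nAt.
pose good B := [/\ subring_of B, subset A B & ~ B t^-1].
(* the empty set is admitted as an upper bound of the empty chain *)
have [|B [GB maxB]] := @Zorn_bigcup L (fun B => B = set0 \/ good B).
  move=> C CP Ctot.
  have [[X0 CX0 gX0]|nex] := pselect (exists2 X, C X & good X); last first.
    left; apply/seteqP; split=> // z [X CX Xz].
    by case: (CP X CX) => [E|gX]; [rewrite E in Xz | case: nex; exists X].
  have two y z : (\bigcup_(X in C) X) y -> (\bigcup_(X in C) X) z ->
      exists X, [/\ C X, good X, X y & X z].
    move=> [X CX Xy] [Y CY Yz].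
    have gX : good X by case: (CP X CX) => // E; rewrite E in Xy.
    have gY : good Y by case: (CP Y CY) => // E; rewrite E in Yz.
    by case: (Ctot X Y CX CY) => s; [exists Y | exists X]; split=> //; apply: s.
  right; split.
  - split; first by case: gX0 => -[X1 _ _] _ _; exists X0.
    + move=> y z Cy Cz; have [X [CX [[_ XB _] _ _] Xy Xz]] := two y z Cy Cz.
      by exists X => //; apply: XB.
    + move=> y z Cy Cz; have [X [CX [[_ _ XM] _ _] Xy Xz]] := two y z Cy Cz.
      by exists X => //; apply: XM.
  - by move=> z Az; exists X0 => //; case: gX0 => _ + _; apply.
  - by move=> [X CX Xt]; case: (CP X CX) => [E|[_ _]//]; rewrite E in Xt.
have {}GB : good B.
  case: GB => // E; exfalso; apply: (maxB A); last by right; split.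
  by rewrite E; split=> // /(_ 1); case: sA => A1 _ _; move/(_ A1).
case: (GB) => -[B1 BB BM] AB nBt.
have B0 : B 0 by rewrite -(subrr 1); apply: BB.
have BN z : B z -> B (- z) by move=> Bz; rewrite -sub0r; apply: BB.
have BD y z : B y -> B z -> B (y + z).
  by move=> By Bz; rewrite -[z]opprK; apply/BB/BN.
have BX n z : B z -> B (z ^+ n).
  by move=> Bz; elim: n => [|n IH] //; rewrite exprS; apply: BM.
have Bsum n (f : nat -> L) : (forall i, (i < n)%N -> B (f i)) -> B (\sum_(i < n) f i).
  by move=> Bf; apply: (big_ind B) => // i _; apply: Bf.
have Bt : B t by apply: AB.
have t0 : t != 0 by apply: contra_notN nBt => /eqP ->; rewrite invr0.
(* maximality: adjoining z to B makes t invertible *)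
have adj z : ~ B z -> exists2 p : {poly L}, (forall i, B p`_i) & t * p.[z] = 1.
  move=> nBz; pose Bz := [set y | exists2 p : {poly L}, (forall i, B p`_i) & y = p.[z]].
  have sBBz : subset B Bz.
    move=> b Bb; exists b%:P; last by rewrite hornerC.
    by move=> i; rewrite coefC; case: ifP.
  have ltB : proper B Bz.
    split=> // /(_ z) H; apply: nBz; apply: H; exists 'X; last by rewrite hornerX.
    by move=> i; rewrite coefX; case: eqP.
  have := maxB _ ltB; move/not_orP => [_] /not_and3P[nsub|[]|/contrapT[p Bp pz]].
  - exfalso; apply: nsub; split; first exact: sBBz.
    + move=> _ _ [p Bp ->] [r Br ->]; exists (p - r); last by rewrite !hornerE.
      by move=> i; rewrite coefB; apply: BB.
    + move=> _ _ [p Bp ->] [r Br ->]; exists (p * r); last by rewrite hornerM.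
      by move=> i; rewrite coefM; apply: (Bsum _ (fun j => p`_j * r`_(i - j))) => j _; apply: BM.
  - by apply: subset_trans sBBz.
  - by exists p => //; rewrite -pz divff.
exists B; split=> // z; apply: contrapT => /not_orP[nz nzi].
have z0 : z != 0 by apply: contra_notN nz => /eqP ->.
have [p Bp pz] := adj _ nz; have [r Br rz] := adj _ nzi.
have {}pz : p.[z] = t^-1 by rewrite -[LHS](mulKf t0) pz mulr1.
have {}rz : r.[z^-1] = t^-1 by rewrite -[LHS](mulKf t0) rz mulr1.
(* R i takes the value z ^ i / t at z, and has degree less than N *)
set N := (size r + size p)%N.
pose R i : {poly L} := if (i < size r)%N then 'X^i * p else \poly_(k < i.+1) r`_(i - k).
have BR i k : B (R i)`_k.
  by rewrite /R; case: ifP => _; rewrite ?coefXnM ?coef_poly; case: ifP.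
have sR (i : 'I_N) : (size (R i) <= N)%N.
  rewrite /R; case: ifP => ir; last exact: leq_trans (size_poly _ _) (ltn_ord i).
  by rewrite (leq_trans (size_polyMleq _ _)) // size_polyXn /= leq_add2r ltnW.
have Rz i : (R i).[z] = t^-1 * z ^+ i.
  rewrite /R; case: ifP => [_|/negbT]; first by rewrite hornerM hornerXn pz mulrC.
  rewrite -leqNgt => ri; rewrite horner_poly (reindex_inj rev_ord_inj) /=.
  rewrite -rz (horner_coef_wide _ (leqW ri)) mulr_suml; apply: eq_bigr => k _.
  have ki : (k <= i)%N by rewrite -ltnS.
  rewrite subSS subKn // -mulrA; congr (_ * _).
  by rewrite exprVn expfB_cond ?(negbTE z0) // mulrC.
have N0 : (0 < N)%N.
  rewrite addn_gt0 orbC lt0n size_poly_eq0; apply/orP; left.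
  by apply: contra_eq_neq pz => ->; rewrite horner0 eq_sym invr_eq0.
pose Q := \matrix_(k < N, i < N) (R i)`_k.
have : eigenvalue Q t^-1.
  apply/eigenvalueP; exists (\row_k z ^+ k).
    apply/rowP => i; rewrite !mxE -Rz (horner_coef_wide _ (sR i)).
    by apply: eq_bigr => k _; rewrite !mxE mulrC.
  by apply/eqP => /rowP/(_ (Ordinal N0)); rewrite !mxE => /eqP; rewrite oner_eq0.
rewrite eigenvalue_root_char => /rootP rt; apply: nBt.
pose BP (f : {poly L}) := forall i, B f`_i.
have BP1 : BP 1 by move=> i; rewrite coef1; case: eqP.
have BPM f g : BP f -> BP g -> BP (f * g).
  move=> Bf Bg i; rewrite coefM.
  by apply: (Bsum _ (fun j => f`_j * g`_(i - j))) => j _; apply: BM.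
have BPN1 : BP (-1) by move=> i; rewrite coefN; apply: BN.
have Bchar : BP (char_poly Q).
  apply: (big_ind BP) => [i|f g Bf Bg i|s _]; rewrite ?coef0 ?coefD //; first exact: BD.
  apply: (BPM); first by elim: (nat_of_bool _) => [|n IH]; rewrite ?exprS; [exact: BP1 | apply: (BPM)].
  apply: (big_ind BP) => // i _ k; rewrite !mxE coefB coefMn coefX coefC.
  by apply: BB; [case: eqP; case: eqP => // *; rewrite mul0rn | case: ifP].
have := char_poly_monic Q; rewrite monicE lead_coefE size_char_poly /=.
move: rt; rewrite horner_coef size_char_poly; move: (char_poly Q) Bchar => c Bc.
have [n ->] : exists n, N = n.+1 by exists N.-1; rewrite prednK.
rewrite big_ord_recr /= => + /eqP lc; rewrite lc mul1r addrC => /eqP.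
rewrite addr_eq0 => /eqP tE.
have -> : t^-1 = - \sum_(i < n.+1) c`_i * t ^+ (n - i).
  have -> : t^-1 = t ^+ n * t^-1 ^+ n.+1 by rewrite exprVn exprSr invfM mulVKf ?expf_neq0.
  rewrite tE mulrN mulr_sumr; congr (- _); apply: eq_bigr => i _.
  have iN : (i <= n)%N by rewrite -ltnS.
  by rewrite expfB_cond ?(negbTE t0) // exprVn mulrCA.
apply: BN; apply: (Bsum _ (fun i => c`_i * t ^+ (n - i))) => i _.
by apply: BM => //; apply: BX.
Qed.

End ValuationExtension.

(** * An algebraically closed field with a place and its unramified part *)

(** The places of the tower are studied through homomorphisms into one
    algebraically closed field, in which the uniformizer [unif] is transcendental
    over C. The subfield [unram] plays the part of the Laurent series field C((t)):
    its elements have an integral order with respect to t, their residues are in C,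
    and Artin-Schreier equations with a small right hand side can be solved in it.
    It is a subfield of [big_field], and not a field of its own, because the ramified
    homomorphisms that extend the unramified ones need values outside it. *)
Record local_model (C : fieldType) (q : nat) := LocalModel {
  big_field : closedFieldType;
  cemb : {rmorphism C -> big_field};
  big_place : place cemb;
  unif : big_field;
  unram : set big_field;
  unif_tr : forall p : {poly C}, p != 0 -> (map_poly cemb p).[unif] != 0;
  unif_max : maxid big_place unif;
  unram_sub : subring_of unram;
  unramV : forall u, unram u -> unram u^-1;
  unram_unif : unram unif;
  unram_cst : forall c, unram (cemb c);
  unram_ord : forall u, unram u -> u != 0 ->
    exists n : int, vunit big_place (u / unif ^ n);
  unram_res : forall u, unram u -> vring big_place u ->
    exists c, maxid big_place (u - cemb c);
  unram_AS : forall b, unram b -> maxid big_place b ->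
    exists y, [/\ unram y, maxid big_place y & y ^+ q + y = b]
}.

Lemma fraction_reprE (R : idomainType) (x : {fraction R}) :
  let r := frac (generic_quotient.repr x) in
  x = tofrac r.1 / tofrac r.2.
Proof.
have key (r : ratio R) : (\pi_({fraction R}) r)%qT
    * tofrac (frac r).2 = tofrac (frac r).1.
  unlock tofrac; rewrite -[LHS]FracField.pi_mul.
  apply/generic_quotient.eqmodP; rewrite /= FracField.equivfE /FracField.mulf.
  by rewrite !numden_Ratio ?mulf_neq0 ?oner_neq0 ?denom_ratioP // !mulr1 mulrC.
apply: (canRL (mulfK _)); first by rewrite tofrac_eq0 denom_ratioP.
by rewrite -key generic_quotient.reprK.
Qed.

Lemma fractionP (R : idomainType) (x : {fraction R}) :
  exists a b : R, b != 0 /\ x = tofrac a / tofrac b.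
Proof. by eexists _, _; split; [|apply: fraction_reprE]; apply: denom_ratioP. Qed.

Section ModelConstruction.
Variables (C : countClosedFieldType) (q : nat).
Hypothesis q1 : (1 < q)%N.
Hypothesis frobC : forall (L : fieldType) (s : {rmorphism C -> L}) (x y : L),
  (x - y) ^+ q = x ^+ q - y ^+ q.

Let Fr := count_fraction {poly C}.

Variables (L : closedFieldType) (j : {rmorphism Fr -> L}).
Hypothesis jint : integralRange j.

Definition model_cst : {rmorphism C -> L} :=
  (j \o (@FracField.tofrac {poly C} : {poly C} -> Fr) \o polyC)%FUN.
Definition model_unif : L := j (tofrac 'X : Fr).
Local Notation k := model_cst.
Local Notation t := model_unif.
Definition model_ev : {rmorphism {poly C} -> L} := (horner_eval t \o map_poly k)%FUN.
Local Notation ev := model_ev.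

Lemma evE p : ev p = j (tofrac p : Fr).
Proof.
rewrite /ev /= /horner_eval /model_cst (map_poly_comp _ polyC) /= /model_unif.
rewrite (map_poly_comp j) horner_map; congr (j _).
rewrite horner_map -/(comp_poly 'X p) comp_polyXr //.
Qed.

Lemma ev_eq0 p : (ev p == 0) = (p == 0).
Proof. by rewrite evE fmorph_eq0 tofrac_eq0. Qed.

Lemma evX : ev 'X = t. Proof. by rewrite evE. Qed.
Lemma evC c : ev c%:P = k c. Proof. by rewrite evE. Qed.

Lemma model_place : exists W : place k, maxid W t.
Proof.
have t0 : t != 0 by rewrite -evX ev_eq0 polyX_eq0.
have sR : subring_of (range ev).
  split; first by exists 1; rewrite ?rmorph1.
    by move=> _ _ [a _ <-] [b _ <-]; exists (a - b); rewrite ?rmorphB.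
  by move=> _ _ [a _ <-] [b _ <-]; exists (a * b); rewrite ?rmorphM.
have [||W [[W1 WB WM] AW nW dW]] := @valuation_extension L t _ sR.
- by exists 'X => //; apply: evX.
- move=> [a _ /eqP]; rewrite -(inj_eq (mulIf t0)) mulVf // -evX -rmorphM.
  rewrite -subr_eq0 -(rmorph1 ev) -rmorphB ev_eq0 subr_eq0 => /eqP E.
  have := congr1 (fun p => p.[0]) E; rewrite /= hornerMX mulr0 hornerC.
  by move/eqP; rewrite eq_sym oner_eq0.
have Wt : W t by apply: AW; exists 'X => //; apply: evX.
have h1 : range k `<` W.
  split; first by move=> _ [c _ <-]; apply: AW; exists c%:P => //; apply: evC.
  move=> /(_ _ Wt)[c _ /eqP]; rewrite -evX -evC -subr_eq0 -rmorphB ev_eq0.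
  by rewrite -opprB oppr_eq0 polyXsubC_eq0.
have h2 : W `<` setT by split=> // /(_ t^-1 I).
exists (Place W1 WB WM h1 h2 dW); apply/maxidP; by right.
Qed.

Variable W : place k.
Hypothesis Wt : maxid W t.

Lemma model_unif_neq0 : t != 0.
Proof. by rewrite -evX ev_eq0 polyX_eq0. Qed.
Let t0 := model_unif_neq0.
Let Wtv : vring W t := maxid_vring Wt.

Lemma vring_ev p : vring W (ev p).
Proof.
rewrite /ev /=; apply: vring_horner => // i.
by rewrite coef_map; apply: vring_const1.
Qed.

Lemma vunit_cst c : c != 0 -> vunit W (k c).
Proof.
move=> c0; split; first by rewrite fmorph_eq0.
  exact: vring_const1.
by rewrite -fmorphV; apply: vring_const1.
Qed.

Lemma ev_res p : maxid W (ev p - k p.[0]).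
Proof.
have /factor_theorem[a pE] : root (p - p.[0]%:P) 0 by rewrite /root !hornerE subrr.
rewrite -evC -rmorphB pE rmorphM polyC0 subr0 evX.
by apply/maxidMl/Wt/vring_ev.
Qed.

(** The image of C(t). *)
Definition rat_set := [set r | exists a b, b != 0 /\ r = ev a / ev b].

Lemma rat_subring : subring_of rat_set.
Proof.
split; first by exists 1, 1; rewrite oner_neq0 rmorph1 divr1.
- move=> _ _ [a [b [b0 ->]]] [c [d [d0 ->]]].
  exists (a * d - c * b), (b * d); split; first by rewrite mulf_neq0.
  rewrite rmorphB !rmorphM; have := b0; have := d0; rewrite -!ev_eq0 => ? ?.
  by field; apply/andP.
- move=> _ _ [a [b [b0 ->]]] [c [d [d0 ->]]].
  exists (a * c), (b * d); split; first by rewrite mulf_neq0.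
  by rewrite !rmorphM invfM mulrACA.
Qed.

Lemma ratV r : rat_set r -> rat_set r^-1.
Proof.
move=> [a [b [b0 ->]]]; have [->|a0] := eqVneq a 0.
  by exists 0, 1; rewrite oner_neq0 !rmorph0 !mul0r invr0.
by exists b, a; rewrite a0 invfM invrK mulrC.
Qed.

Lemma rat_ev p : rat_set (ev p).
Proof. by exists p, 1; rewrite oner_neq0 rmorph1 divr1. Qed.

Lemma rat_j x : rat_set (j x).
Proof.
have [a [b [b0 ->]]] := @fractionP {poly C} x.
by exists a, b; rewrite fmorph_div -!evE.
Qed.

Lemma ev_ord p : p != 0 -> exists (n : nat) c, c != 0 /\ maxid W (ev p / t ^+ n - k c).
Proof.
move=> p0; have [n [a + pE]] := multiplicity_XsubC p 0.
rewrite p0 implyTb => na; exists n, a.[0]; split; first by [].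
rewrite pE rmorphM rmorphXn polyC0 subr0 evX mulfK ?expf_neq0 //.
exact: ev_res.
Qed.

Lemma rat_ord r : rat_set r -> r != 0 ->
  exists (n : int) c, c != 0 /\ maxid W (r / t ^ n - k c).
Proof.
move=> [a [b [b0 ->]]]; rewrite mulf_eq0 negb_or invr_eq0 !ev_eq0 => /andP[a0 _].
have [n [c [c0 nc]]] := ev_ord a0; have [l [d [d0 ld]]] := ev_ord b0.
exists (n%:Z - l%:Z), (c / d); split; first by rewrite mulf_neq0 ?invr_eq0.
set A := _ / _ in nc; set B := _ / _ in ld.
have -> : ev a / ev b / t ^ (n%:Z - l%:Z) = A / B.
  rewrite /A /B expfzDr // -exprnN -exprnP; have : ev b != 0 by rewrite ev_eq0.
  by move=> evb0; field; rewrite evb0 ?expf_neq0.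
have ud := vunit_cst d0; rewrite fmorph_div.
by apply: congM; [exact: vring_const1 | case/vunitV: ud | | apply: congV].
Qed.

Lemma rat_ord_unit r : rat_set r -> r != 0 -> exists n : int, vunit W (r / t ^ n).
Proof.
move=> Rr r0; by have [n [c [c0 nc]]] := rat_ord Rr r0; exists n; apply: cong_unit (vunit_cst c0) nc.
Qed.

Lemma rat_res r : rat_set r -> vring W r -> exists c, maxid W (r - k c).
Proof.
move=> Rr Wr; have [->|r0] := eqVneq r 0.
  by exists 0; rewrite rmorph0 subrr; apply: maxid0.
have [n [c [c0 nc]]] := rat_ord Rr r0.
have un := cong_unit (vunit_cst c0) nc; have n0 := proj1 (ord_vring t0 Wt un) Wr.
case: n n0 nc un => // -[|n] _ nc un; first by exists c; rewrite expr0z divr1 in nc.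
by exists 0; rewrite rmorph0 subr0; apply/(ord_maxid t0 Wt un).
Qed.

Lemma ord_bounded (h : L) (n : int) : vunit W (h / t ^ n) ->
  exists N : nat, vring W (t ^+ N * h).
Proof.
move=> un; exists `|n|%N.
have un2 := ord_shift `|n|%N t0 un.
by rewrite mulrC exprnP; apply/(ord_vring t0 Wt un2); lia.
Qed.

Lemma rat_bounded r : rat_set r -> exists N : nat, vring W (t ^+ N * r).
Proof.
move=> Rr; have [->|r0] := eqVneq r 0.
  by exists 0%N; rewrite mulr0; apply: vring0.
by have [n] := rat_ord_unit Rr r0; apply: ord_bounded.
Qed.

Lemma vring_tX (n l : nat) z : (n <= l)%N -> vring W (t ^+ n * z) -> vring W (t ^+ l * z).
Proof.
by move=> nl Wz; rewrite -(subnK nl) exprD -mulrA; apply/vringM/Wz/vringX.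
Qed.

Lemma poly_bounded (p : {poly Fr}) :
  exists N : nat, forall i, vring W (t ^+ N * j p`_i).
Proof.
suff [N HN] : exists N : nat, forall i, (i < size p)%N -> vring W (t ^+ N * j p`_i).
  exists N => i; case: (ltnP i (size p)) => [/HN//|/leq_sizeP/(_ i (leqnn i))->].
  by rewrite rmorph0 mulr0; apply: vring0.
elim: (size p) => [|n [N HN]]; first by exists 0%N.
have [N' HN'] := rat_bounded (rat_j p`_n); exists (maxn N N') => i.
rewrite ltnS leq_eqVlt => /predU1P[->|/HN].
  exact: vring_tX (leq_maxr _ _) HN'.
exact: vring_tX (leq_maxl _ _).
Qed.

(** The valuation remains archimedean on an algebraic extension: the constant
    coefficient of an equation for h is a multiple of h. *)
Lemma big_arch h : h != 0 -> exists n : nat, vring W (t ^+ n / h).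
Proof.
move=> h0; case: (vringV W h) => Wh; last by exists 0%N; rewrite mul1r.
have [p mp rp] := jint h.
have [i [a + pE]] := multiplicity_XsubC p 0.
rewrite monic_neq0 //= => a0.
have ra : (map_poly j a).[h] = 0.
  move: rp; rewrite pE rmorphM rmorphXn /= map_polyXsubC rmorph0 subr0 /root hornerM.
  by rewrite hornerXn mulf_eq0 expf_eq0 (negbTE h0) andbF orbF => /eqP.
have [N HN] := poly_bounded a.
have a00 : j a`_0 != 0 by rewrite fmorph_eq0 -horner_coef0.
have [n un] := rat_ord_unit (rat_j a`_0) a00.
pose w := \sum_(i < (size a).-1) t ^+ N * j a`_i.+1 * h ^+ i.
have Ww : vring W w by apply: vring_sum => l _; apply: vringM; [apply: HN|apply: vringX].
have E : t ^+ N * j a`_0 = - (h * w).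
  apply/eqP; rewrite -subr_eq0 opprK -[X in _ == X](mulr0 (t ^+ N)) -ra; apply/eqP.
  rewrite horner_coef size_map_poly.
  have -> : size a = (size a).-1.+1.
    by rewrite prednK // lt0n size_poly_eq0; apply: contraNneq a0 => ->; rewrite root0.
  rewrite big_ord_recl expr0 mulr1 coef_map mulrDr; congr (_ + _).
  rewrite /w !mulr_sumr; apply: eq_bigr => l _; rewrite lift0 exprS coef_map.
  by rewrite /=; ring.
have tE : t ^ (N%:Z + n) / h = - w / (j a`_0 / t ^ n).
  rewrite expfzDr // -exprnP; have : t ^ n != 0 by rewrite expfz_neq0.
  move=> tn; have -> : t ^+ N = - (h * w) / j a`_0 by rewrite -E mulfK.
  by field; rewrite h0 a00 tn.
set l := N%:Z + n in tE *; exists (absz l).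
have -> : t ^+ absz l = t ^+ absz ((absz l)%:Z - l) * t ^ l.
  by rewrite !exprnP -expfzDr //; congr (t ^ _); lia.
rewrite -mulrA; apply: vringM; first exact: vringX.
rewrite tE; apply: vringM; first exact: vringN.
by case/vunitV: un.
Qed.

(** The t-adic closure of C(t) in L. *)
Definition unram_set := [set h | forall n, exists2 r, rat_set r & vring W ((h - r) / t ^+ n)].

Lemma rat_unram r : rat_set r -> unram_set r.
Proof. by move=> Rr n; exists r => //; rewrite subrr mul0r; apply: vring0. Qed.

Lemma unram_bounded h : unram_set h -> exists N : nat, vring W (t ^+ N * h).
Proof.
move=> /(_ 0%N)[r Rr]; rewrite expr0 divr1 => hr.
have [N HN] := rat_bounded Rr; exists N.
rewrite -[h](subrK r) mulrDr; apply: vringD => //.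
by apply: vringM => //; apply: vringX.
Qed.

Lemma unram_set_subring : subring_of unram_set.
Proof.
case: rat_subring => R1 RB RM; split; first exact: rat_unram.
- move=> h g Uh Ug n; have [r Rr hr] := Uh n; have [s Rs gs] := Ug n.
  exists (r - s); first exact: RB.
  have -> : (h - g - (r - s)) / t ^+ n = (h - r) / t ^+ n - (g - s) / t ^+ n by ring.
  exact: vringB.
- move=> h g Uh Ug n; have [N hN] := unram_bounded Uh; have [N' gN] := unram_bounded Ug.
  have [r Rr hr] := Uh (n + N')%N; have [s Rs gs] := Ug (n + N)%N.
  exists (r * s); first exact: RM.
  have [s0 gs0] : exists2 w, vring W w & g - s = t ^+ n * t ^+ N * w.
    by exists ((g - s) / t ^+ (n + N)) => //; rewrite -exprD mulrC divfK ?expf_neq0.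
  have [r0 hr0] : exists2 w, vring W w & h - r = t ^+ n * t ^+ N' * w.
    by exists ((h - r) / t ^+ (n + N')) => //; rewrite -exprD mulrC divfK ?expf_neq0.
  move=> hrE gsE.
  have -> : (h * g - r * s) / t ^+ n =
    (t ^+ N * h) * s0 + r0 * (t ^+ N' * g) - r0 * s0 * t ^+ (n + N + N').
    have -> : r * s = (h - (h - r)) * (g - (g - s)) by ring.
    rewrite gsE hrE !exprD; field; exact: expf_neq0.
  by apply: vringB; [apply: vringD; apply: vringM | apply/vringM/vringX/Wtv/vringM].
Qed.

(** By the archimedean property a sufficiently close rational approximation of h
    has the same order as h, and its inverse approximates 1 / h. *)
Lemma unram_near h n : unram_set h -> h != 0 -> exists r v,
  [/\ rat_set r, vunit W v, r = h * v & vring W ((h^-1 - r^-1) / t ^+ n)].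
Proof.
move=> Uh h0; have [i hi] := big_arch h0.
have [r Rr hr] := Uh (n + i + i).+1.
pose w := (h - r) / t ^+ (n + i + i).+1.
have rE : r = h - t ^+ n * t ^+ i * t ^+ i * t * w.
  by rewrite /w -!exprD -exprSr mulrC divfK ?expf_neq0 // opprB addrC subrK.
pose v := 1 - t ^+ n * t * t ^+ i * w * (t ^+ i / h).
have uv : vunit W v.
  apply: vunitDm; first exact: vunit1.
  apply: maxidN; apply: maxidMr => //; apply: maxidMr => //; apply: maxidMr; first exact: vringX.
  by apply: maxidMl => //; apply: vringX.
have rv : r = h * v by rewrite rE /v; field.
exists r, v; split=> //.
have v0 := vunit_neq0 uv.
have -> : (h^-1 - r^-1) / t ^+ n = - (w * t * (t ^+ i / h) ^+ 2 * v^-1).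
  have -> : h^-1 - r^-1 = (r - h) / (h * r) by field; rewrite h0 rv mulf_neq0.
  have -> : r - h = - (t ^+ n * t ^+ i * t ^+ i * t * w) by rewrite rE; ring.
  by rewrite rv; field; rewrite h0 v0 expf_neq0.
apply: vringN; apply: vringM; last by case: uv.
by apply: vringM; [apply: vringM | apply: vringX].
Qed.

Lemma unram_setV h : unram_set h -> unram_set h^-1.
Proof.
move=> Uh n; have [->|h0] := eqVneq h 0.
  exists 0; last by rewrite invr0 subrr mul0r; apply: vring0.
  by exists 0, 1; rewrite oner_neq0 rmorph0 mul0r.
by have [r [v [Rr _ _ ?]]] := unram_near n Uh h0; exists r^-1 => //; apply: ratV.
Qed.

Lemma unram_set_ord h : unram_set h -> h != 0 -> exists n : int, vunit W (h / t ^ n).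
Proof.
move=> Uh h0; have [r [v [Rr uv rE _]]] := unram_near 0 Uh h0.
have v0 := vunit_neq0 uv.
have [|n un] := rat_ord_unit Rr; first by rewrite rE mulf_neq0.
exists n; have -> : h / t ^ n = r / t ^ n / v.
  by rewrite rE mulrAC mulfK // .
exact: vunit_div.
Qed.

Lemma unram_set_res h : unram_set h -> vring W h -> exists c, maxid W (h - k c).
Proof.
move=> /(_ 1%N)[r Rr]; rewrite expr1 => hr Wh.
have mhr : maxid W (h - r).
  by rewrite -[h - r](divfK t0); apply: maxidMl.
have Wr : vring W r by rewrite -[r](subKr h); apply/vringB/maxid_vring/mhr.
have [c mc] := rat_res Rr Wr; exists c.
by rewrite -[h](subrK r) -addrA; apply: maxidD.
Qed.

(** Hensel's lemma for y ^ q + y = b: the product of the roots is small, so one of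
    them is; it is the limit of the iteration of r |-> b - r ^ q, which contracts
    because a q-th power of a difference is the difference of the q-th powers. *)
Lemma unram_set_AS b : unram_set b -> maxid W b ->
  exists y, [/\ unram_set y, maxid W y & y ^+ q + y = b].
Proof.
move=> Ub mb.
have q0 : (0 < q)%N by apply: ltnW.
have [rs pE] := closed_field_poly_normal ('X^q + 'X - b%:P).
rewrite (monicP (monic_AS_poly b q1)) scale1r in pE.
have rsP z : z \in rs -> z ^+ q + z = b.
  rewrite -root_prod_XsubC -pE => /rootP; rewrite !hornerE => /eqP.
  by rewrite subr_eq0 => /eqP.
have [] := @maxid_prod _ _ _ W _ rs (fun z => 0 - z).
- move=> z /rsP zb; rewrite sub0r; apply: vringN; apply: (@AS_vring _ _ _ _ q) => //.
  by rewrite zb; apply: maxid_vring.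
- have <- : ('X^q + 'X - b%:P).[0] = \prod_(z <- rs) (0 - z).
    by rewrite pE horner_prod; apply: eq_bigr => z _; rewrite hornerXsubC.
  by rewrite !hornerE expr0n gtn_eqF // !add0r; apply: maxidN.
move=> y /rsP yb; rewrite sub0r => /maxidN; rewrite opprK => my.
exists y; split=> //.
have uv : vunit W (1 + y ^+ q.-1).
  by apply: vunitDm; [exact: vunit1 | apply: maxidX => //; lia].
have Wyt : vring W (y / t).
  have -> : y = b / (1 + y ^+ q.-1).
    apply: (canRL (mulfK (vunit_neq0 uv))).
    by rewrite mulrDr mulr1 -exprS prednK // addrC.
  rewrite mulrAC; apply: vringM; last by case/vunitV: uv.
  have [->|b0] := eqVneq b 0; first by rewrite mul0r; apply: vring0.
  by have [n un] := unram_set_ord Ub b0; apply: ord_divr un mb.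
case: rat_subring => R1 RB RM.
have RX i r : rat_set r -> rat_set (r ^+ i).
  by move=> Rr; elim: i => [|i IH] //; rewrite exprS; apply: RM.
case=> [|n].
  exists 0; last by rewrite subr0 divr1; apply: maxid_vring.
  by exists 0, 1; rewrite oner_neq0 rmorph0 mul0r.
elim: n => [|n [r Rr yr]].
  by exists 0; rewrite ?subr0 //; exists 0, 1; rewrite oner_neq0 rmorph0 mul0r.
have [s Rs bs] := Ub n.+2.
exists (s - r ^+ q); first exact/RB/RX.
have -> : y - (s - r ^+ q) = (b - s) - (y - r) ^+ q.
  by rewrite (frobC k) -yb; ring.
rewrite mulrBl; apply: vringB => //.
have -> : (y - r) ^+ q / t ^+ n.+2 = ((y - r) / t ^+ n.+1) ^+ q * t ^+ (n.+1 * q - n.+2).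
  rewrite expr_div_n -exprM -mulrA; congr (_ * _).
  have -> : t ^+ (n.+1 * q) = t ^+ (n.+1 * q - n.+2) * t ^+ n.+2.
    by rewrite -exprD subnK //; nia.
  by rewrite [X in _ = X * _]invfM mulrAC mulVf ?mul1r ?expf_neq0.
by apply: vringM; apply: vringX.
Qed.

End ModelConstruction.

Lemma local_model_exists (C : countClosedFieldType) (q : nat) : (1 < q)%N ->
  (forall (L : fieldType) (s : {rmorphism C -> L}) (x y : L),
     (x - y) ^+ q = x ^+ q - y ^+ q) ->
  inhabited (local_model C q).
Proof.
move=> q1 frobC.
have [L [j jint]] := countable_algebraic_closure (count_fraction {poly C}).
have [W Wt] := model_place j; constructor.
apply: (@LocalModel C q L (model_cst j) W (model_unif j) (unram_set W)).
- by move=> p p0; have := ev_eq0 j p; rewrite (negbTE p0) => /negbT.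
- exact: Wt.
- exact: unram_set_subring.
- exact: unram_setV.
- by apply: rat_unram; rewrite -(evX j); apply: rat_ev.
- by move=> c; apply: rat_unram; rewrite -(evC j c); apply: rat_ev.
- exact: unram_set_ord.
- exact: unram_set_res.
- exact: unram_set_AS.
Qed.

(** * Homomorphisms on subfields and their extensions *)

Section FractionLift.
Variables (R : idomainType) (F : fieldType) (phi : {rmorphism R -> F}).
Hypothesis phi_inj : injective phi.

Lemma fraction_lift : exists psi : {rmorphism {fraction R} -> F},
  forall r, psi (tofrac r) = phi r.
Proof.
have [num [den [den0 xE]]] : exists num den : {fraction R} -> R,
    (forall x, den x != 0) /\
    forall x, x = tofrac (num x) / tofrac (den x).
  exists (fun x => (frac (generic_quotient.repr x)).1).
  exists (fun x => (frac (generic_quotient.repr x)).2).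
  by split=> x; [apply: denom_ratioP | apply: fraction_reprE].
pose f (x : {fraction R}) := phi (num x) / phi (den x).
have phi0 a : (phi a == 0) = (a == 0) by rewrite -(inj_eq phi_inj) rmorph0.
have fE a b : b != 0 -> f (tofrac a / tofrac b) = phi a / phi b.
  move=> b0; pose x := tofrac a / tofrac b; rewrite -/x /f.
  have : num x * b = a * den x.
    apply/eqP; rewrite -tofrac_eq !tofracM; apply/eqP.
    have := xE x; rewrite {1}/x => /eqP; rewrite eqr_div ?tofrac_eq0 //.
    by move/eqP => ->.
  by move/(congr1 phi); rewrite !rmorphM => /eqP; rewrite -eqr_div ?phi0 // => /eqP.
have fB : zmod_morphism f.
  move=> x y; rewrite [in LHS](xE x) [in LHS](xE y) -mulNr addf_div ?tofrac_eq0 //.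
  rewrite -!rmorphN -!rmorphM -rmorphD fE ?mulf_neq0 //.
  by rewrite rmorphD !rmorphM rmorphN /f -mulNr addf_div ?phi0.
have fM : monoid_morphism f.
  split; first by rewrite -[1](divr1 1) -tofrac1 fE ?oner_neq0 // rmorph1 divr1.
  move=> x y; rewrite [in LHS](xE x) [in LHS](xE y) mulf_div -!rmorphM fE ?mulf_neq0 //.
  by rewrite !rmorphM /f mulf_div.
pose fz := GRing.isZmodMorphism.Build _ _ f fB.
pose fm := GRing.isMonoidMorphism.Build _ _ f fM.
pose psi : {rmorphism {fraction R} -> F} := HB.pack f fz fm.
exists psi => r; change (f (tofrac r) = phi r).
by rewrite -[X in f X]divr1 -tofrac1 fE ?oner_neq0 // rmorph1 divr1.
Qed.

End FractionLift.

Section HomOn.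
Variables (F0 : fieldType) (T : fieldExtType F0) (L : fieldType).

(** A homomorphism on a subfield is a function on all of T, so that it has the same
    type as its extensions. *)
Definition hom_on (E : {vspace T}) (s : T -> L) :=
  [/\ s 1 = 1, {in E &, {morph s : u v / u - v}} & {in E &, {morph s : u v / u * v}}].

Section OneField.
Variables (E : {subfield T}) (s : T -> L).
Hypothesis hs : hom_on E s.

Lemma hom_subvs : exists s' : {rmorphism subvs_of E -> L}, forall u, s' u = s (vsval u).
Proof.
case: hs => s1 sB sM; pose f (u : subvs_of E) := s (vsval u).
have fB : zmod_morphism f by move=> u v; rewrite /f /= sB ?subvsP.
have fM : monoid_morphism f.
  by split; [rewrite /f /= algid1 | move=> u v; rewrite /f /= sM ?subvsP].
pose fz := GRing.isZmodMorphism.Build _ _ f fB.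
pose fm := GRing.isMonoidMorphism.Build _ _ f fM.
by exists (HB.pack f fz fm : {rmorphism _ -> _}).
Qed.

Lemma hom0 : s 0 = 0.
Proof. by have [s' s'E] := hom_subvs; rewrite -(rmorph0 s') s'E. Qed.

Lemma hom1 : s 1 = 1. Proof. by case: hs. Qed.

Lemma homB u v : u \in E -> v \in E -> s (u - v) = s u - s v.
Proof. by case: hs => _ + _; apply. Qed.

Lemma homM u v : u \in E -> v \in E -> s (u * v) = s u * s v.
Proof. by case: hs => _ _; apply. Qed.

Lemma homD u v : u \in E -> v \in E -> s (u + v) = s u + s v.
Proof.
have [s' s'E] := hom_subvs => /vsprojK uE /vsprojK vE; rewrite -uE -vE.
rewrite -rmorphD -!s'E. by rewrite rmorphD.
Qed.

Lemma homX n u : u \in E -> s (u ^+ n) = s u ^+ n.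
Proof.
move=> Eu; elim: n => [|n IH]; first by rewrite !expr0 hom1.
by rewrite !exprS homM ?rpredX // IH.
Qed.

Lemma homV u : u \in E -> s u^-1 = (s u)^-1.
Proof.
move=> Eu; have [->|u0] := eqVneq u 0; first by rewrite invr0 hom0 invr0.
have E1 : s u * s u^-1 = 1 by rewrite -homM ?rpredV // mulfV // hom1.
have su0 : s u != 0 by apply: contra_eq_neq E1 => ->; rewrite mul0r eq_sym oner_neq0.
by apply: (mulfI su0); rewrite E1 mulfV.
Qed.

Lemma hom_eq0 u : u \in E -> (s u == 0) = (u == 0).
Proof.
move=> Eu; have [->|u0] := eqVneq u 0; first by rewrite hom0 eqxx.
apply/eqP => su0; have := homM Eu (rpredVr Eu); rewrite mulfV // hom1 su0 mul0r.
by move/eqP; rewrite oner_eq0.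
Qed.

Lemma coef_hom (p : {poly T}) i : (map_poly s p)`_i = s p`_i.
Proof. by rewrite coef_map_id0 // hom0. Qed.

Lemma size_hom (p : {poly T}) : p \is a polyOver E -> size (map_poly s p) = size p.
Proof.
move=> Ep; have [->|p0] := eqVneq p 0; first by rewrite map_poly0 !size_poly0.
by rewrite size_map_poly_id0 // hom_eq0 ?lead_coef_eq0 // lead_coefE (polyOverP Ep).
Qed.

Lemma hom_polyM (p r : {poly T}) : p \is a polyOver E -> r \is a polyOver E ->
  map_poly s (p * r) = map_poly s p * map_poly s r.
Proof.
have [s' s'E] := hom_subvs.
have mp (a : {poly subvs_of E}) : map_poly s (map_poly vsval a) = map_poly s' a.
  by apply/polyP => i; rewrite coef_hom !coef_map /= s'E.
move=> /polyOver_subvs[a ->] /polyOver_subvs[b ->].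
by rewrite -rmorphM !mp rmorphM.
Qed.

(** The homomorphism on E(x) that extends s and sends x to y. *)
Definition ext (x : T) (y : L) (f : T) := (map_poly s (Fadjoin_poly E x f)).[y].

Lemma extE x y f :
  ext x y f = \sum_(i < adjoin_degree E x) s (Fadjoin_poly E x f)`_i * y ^+ i.
Proof.
have sz : (size (map_poly s (Fadjoin_poly E x f)) <= adjoin_degree E x)%N.
  exact: leq_trans (size_poly _ _) (size_Fadjoin_poly _ _ _).
rewrite /ext (horner_coef_wide _ sz).
by apply: eq_bigr => i _; rewrite coef_hom.
Qed.

Lemma ext_hom x y : root (map_poly s (minPoly E x)) y ->
  [/\ hom_on <<E; x>> (ext x y), {in E, ext x y =1 s} & ext x y x = y].
Proof.
have [s' s'E] := hom_subvs => /rootP ry.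
have mp (a : {poly subvs_of E}) : map_poly s (map_poly vsval a) = map_poly s' a.
  by apply/polyP => i; rewrite coef_hom !coef_map /= s'E.
have /polyOver_subvs[m mE] := minPolyOver E x.
have rm : (map_poly s' m).[y] = 0 by rewrite -mp -mE.
have key (a : {poly subvs_of E}) : ext x y (map_poly vsval a).[x] = (map_poly s' a).[y].
  rewrite /ext Fadjoin_poly_mod; last by apply/polyOver_subvs; exists a.
  rewrite mE -map_modp mp [in RHS](divp_eq a m) rmorphD rmorphM hornerD hornerM.
  by rewrite rm mulr0 add0r.
have rep f : f \in <<E; x>>%VS -> exists a : {poly subvs_of E}, f = (map_poly vsval a).[x].
  by move/Fadjoin_polyP => [_ /polyOver_subvs[a ->] ->]; exists a.
split.
- split; first by have := key 1; rewrite !rmorph1 !hornerC.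
  + move=> f g /rep[a ->] /rep[b ->].
    by rewrite -hornerN -hornerD -rmorphB !key rmorphB !hornerE.
  + move=> f g /rep[a ->] /rep[b ->].
    by rewrite -hornerM -rmorphM !key rmorphM !hornerE.
- move=> f Ef; have := key (vsproj E f)%:P; rewrite !map_polyC !hornerC.
  by rewrite /= s'E vsprojK.
- by have := key 'X; rewrite !map_polyX !hornerX.
Qed.

End OneField.
End HomOn.

(** * Sums of terms with distinct pole orders *)

Section Digits.
Variables (C L : fieldType) (k : C -> L) (W : place k) (q : nat).
Hypothesis q1 : (1 < q)%N.

(** The terms of sum c_i y^i have pole orders that are pairwise distinct, being
    congruent to i modulo q; so the largest one prevails and dominates. *)
Lemma digits (S : set L) (b y : L) (c : nat -> L) n :
  ~ vring W b -> vunit W (y ^+ q / b) ->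
  (forall u, S u -> u != 0 -> exists e : int, vunit W (u / b ^ e)) ->
  (n <= q)%N -> (forall i, (i < n)%N -> S (c i)) ->
  let z := \sum_(i < n) c i * y ^+ i in
  (forall i, (i < n)%N -> c i = 0) \/
  (exists (e : int) (i : nat), [/\ (i < n)%N, vunit W (z / y ^ (q%:Z * e + i%:Z))
     & forall i, (i < n)%N -> vring W (c i * y ^+ i / z)]).
Proof.
move=> nWb uyb Sord; have [mb b0] := pole_inv nWb.
have y0 : y != 0.
  by apply: contraTneq (vunit_neq0 uyb) => ->; rewrite expr0n gtn_eqF ?mul0r ?eqxx // ltnW.
have nWy : ~ vring W y.
  move=> Wy; apply: nWb; have -> : b = y ^+ q * (y ^+ q / b)^-1.
    by field; rewrite b0 ?expf_neq0.
  by apply: vringM; [apply: vringX | case/vunitV: uyb].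
have [my _] := pole_inv nWy; have y10 : y^-1 != 0 by rewrite invr_eq0.
move=> nq Sc z; pose T i := c i * y ^+ i.
have T0 i : (T i == 0) = (c i == 0) by rewrite mulf_eq0 expf_eq0 (negbTE y0) andbF orbF.
have ordT i : (i < n)%N -> c i != 0 -> exists e : int, vunit W (T i / y ^ (q%:Z * e + i%:Z)).
  move=> lt c0; have [e ue] := Sord _ (Sc i lt) c0; exists e.
  rewrite /T expfzDr // -exprnP invfM mulrACA divff ?expf_neq0 // mulr1.
  have -> : c i / y ^ (q%:Z * e) = c i / b ^ e * ((y ^+ q / b) ^ e)^-1.
    rewrite -exprz_exp -exprnP expfzMl exprz_inv -invr_expz; field.
    by rewrite !expfz_neq0 ?expf_neq0.
  by apply: vunitM => //; apply/vunitV/vunitXz.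
have cmp i j : (i < n)%N -> (j < n)%N -> c i != 0 -> c j != 0 -> i != j ->
    maxid W (T i / T j) \/ maxid W (T j / T i).
  move=> ni nj ci cj ij; have [e ui] := ordT i ni ci; have [e' uj] := ordT j nj cj.
  have nu : ~ vunit W (T i / T j).
    move=> uij; have := vunitM uij uj; rewrite mulrA divfK ?T0 // => uij'.
    have inv d : y ^ d = y^-1 ^ (- d) by rewrite exprz_inv opprK.
    rewrite !inv in ui uij'; have /oppr_inj E := ord_uniq y10 my ui uij'.
    have : ((q%:Z * e + i%:Z) %% q = (q%:Z * e' + j%:Z) %% q)%Z by rewrite E.
    rewrite ![q%:Z * _]mulrC !modzMDl !modz_nat !modn_small ?(leq_trans _ nq) //.
    by case=> E2; rewrite E2 eqxx in ij.
  case: (vringV W (T i / T j)) => Wij; [left; split=> // | right].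
  by rewrite invf_div in Wij; split=> // /vunitV; rewrite invf_div.
have dom l : (l <= n)%N -> (forall i, (i < l)%N -> c i = 0) \/
    exists i, [/\ (i < l)%N, c i != 0 &
      forall j, (j < l)%N -> j != i -> maxid W (T j / T i)].
  elim: l => [|l IH] ln; first by left.
  have {IH} IH := IH (ltnW ln); have [cl0|cl0] := eqVneq (c l) 0.
    case: IH => [all0|[i [il ci all]]]; [left | right; exists i; split=> //; first exact: leqW].
      by move=> i; rewrite ltnS leq_eqVlt => /predU1P[->|/all0].
    move=> j; rewrite ltnS leq_eqVlt => /predU1P[->|/all//] _.
    by rewrite /T cl0 !mul0r; apply: maxid0.
  right; case: IH => [all0|[i [il ci all]]].
    exists l; split=> // j; rewrite ltnS leq_eqVlt => /predU1P[->|/all0 c0 _]; rewrite ?eqxx //.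
    by rewrite /T c0 !mul0r; apply: maxid0.
  case: (cmp i l) => // [||mil|mli]; [exact: ltn_trans ln | by rewrite ltn_eqF | |].
    exists l; split=> // j; rewrite ltnS leq_eqVlt => /predU1P[->|jl _]; rewrite ?eqxx //.
    have [->|ji] := eqVneq j i; first exact: mil.
    have -> : T j / T l = T j / T i * (T i / T l) by rewrite mulrA divfK ?T0.
    exact: maxidMr (maxid_vring mil) (all j jl ji).
  exists i; split=> //; first exact: leqW.
  by move=> j; rewrite ltnS leq_eqVlt => /predU1P[->|/all]; [|apply].
case: (dom n) => // [|[i [ni ci all]]]; [by left | right].
have Ti0 : T i != 0 by rewrite T0.
have uz : vunit W (z / T i).
  rewrite /z mulr_suml (bigD1 (Ordinal ni)) //= divff //; apply: vunitDm; first exact: vunit1.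
  by apply: maxid_sum => j ji; apply: all.
have [e ue] := ordT i ni ci; exists e, i; split=> //.
  by have := vunitM uz ue; rewrite mulrA divfK.
move=> j nj; have -> : c j * y ^+ j / z = T j / T i / (z / T i).
  by rewrite [in RHS]invf_div mulrA divfK.
apply: vringM; last by case/vunitV: uz.
have [->|ji] := eqVneq j i; first by rewrite divff //; apply: vring1.
exact: maxid_vring (all j nj ji).
Qed.

End Digits.

(** * Traces as sums over the roots *)

Section Lagrange.
Variables (K : finFieldType) (L : fieldType) (kappa : {rmorphism K -> L}) (S : {set K}).
Hypothesis SB : forall a b, a \in S -> b \in S -> a - b \in S.

Definition node_prod := \prod_(d in S | d != 0) kappa d.

Definition node_poly (y : L) (w : K) := \prod_(d in S | d != w) ('X - (y + kappa d)%:P).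

Lemma size_node_poly y w : w \in S -> size (node_poly y w) = #|S|.
Proof.
move=> Sw; rewrite /node_poly -big_filter size_prod_XsubC -sum1_size.
rewrite (cardD1 w) Sw -sum1_card big_filter; congr (_.+1).
by apply: eq_bigl => d; rewrite !inE andbC.
Qed.

Lemma lead_node_poly y w : w \in S -> (node_poly y w)`_#|S|.-1 = 1.
Proof.
move=> Sw; rewrite -(size_node_poly y Sw) -lead_coefE.
by apply/eqP; rewrite -monicE /node_poly monic_prod_XsubC.
Qed.

(** Interpolation at the points of a coset of an additive group: all the
    denominators coincide. *)
Lemma lagrange (P : {poly L}) (y : L) : (size P <= #|S|)%N ->
  node_prod *: P = \sum_(w in S) P.[y + kappa w] *: node_poly y w.
Proof.
move=> sP; apply/eqP; rewrite -subr_eq0; apply/eqP.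
apply: (@roots_geq_poly_eq0 _ _ [seq y + kappa w | w <- enum S]).
- apply/allP => z /mapP[w]; rewrite mem_enum => Sw -> {z}.
  rewrite /root hornerD hornerN hornerZ horner_sum (bigD1 w) //= big1 => [|d /andP[Sd dw]].
    rewrite addr0 hornerZ mulrC -mulrBr mulf_eq0; apply/orP; right.
    rewrite subr_eq0 /node_poly horner_prod /node_prod.
    rewrite (reindex_onto (fun d => w - d) (fun d => w - d)) => [|d _]; last by rewrite subKr.
    apply/eqP; apply: eq_big => d.
      rewrite subKr eqxx andbT subr_eq0 [w == d]eq_sym; congr (_ && _).
      by apply/idP/idP => [H|H]; [rewrite -(subKr w d)|]; apply: SB.
    by move=> _; rewrite hornerXsubC rmorphB; ring.
  rewrite hornerZ /node_poly horner_prod (bigD1 w) /=; last by rewrite Sw eq_sym.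
  by rewrite hornerXsubC subrr mul0r mulr0.
- rewrite map_inj_uniq ?enum_uniq // => a b /addrI; exact: fmorph_inj.
- rewrite size_map -cardE (leq_trans (size_polyD _ _)) // geq_max size_polyN.
  rewrite (leq_trans (size_scale_leq _ _)) //=.
  apply: (leq_trans (size_sum _ _ _)); apply/bigmax_leqP => w Sw.
  by rewrite (leq_trans (size_scale_leq _ _)) // size_node_poly.
Qed.

Lemma lagrange_top (P : {poly L}) (y : L) : (size P <= #|S|)%N ->
  node_prod * P`_#|S|.-1 = \sum_(w in S) P.[y + kappa w].
Proof.
move=> sP; rewrite -coefZ (lagrange y sP) coef_sum; apply: eq_bigr => w Sw.
by rewrite coefZ lead_node_poly ?mulr1.
Qed.

End Lagrange.

Section LagrangeIntegral.
Variables (K : finFieldType) (C L : fieldType) (k : C -> L) (W : place k).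
Variables (kappa : {rmorphism K -> L}) (S : {set K}).
Hypothesis Wkappa : forall c, vring W (kappa c).

Lemma vunit_kappa c : c != 0 -> vunit W (kappa c).
Proof. by move=> c0; split; rewrite ?fmorph_eq0 // -fmorphV. Qed.

Lemma vunit_node_prod : vunit W (node_prod kappa S).
Proof. by apply: vunit_prod => d /andP[_]; apply: vunit_kappa. Qed.

Lemma vring_coef_prod (I : Type) (r : seq I) (A : pred I) (p : I -> {poly L}) :
  (forall i, A i -> forall j, vring W (p i)`_j) ->
  forall j, vring W (\prod_(i <- r | A i) p i)`_j.
Proof.
move=> Wp; apply: (big_ind (fun p : {poly L} => forall j, vring W p`_j)) => //.
- by move=> j; rewrite coef1; case: eqP => _; [apply: vring1 | apply: vring0].
- move=> a b Wa Wb j; rewrite coefM; apply: vring_sum => i _; exact: vringM.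
Qed.

(** The common denominator of the interpolation formula is a unit. *)
Lemma lagrange_integral (P : {poly L}) (y : L) :
  (forall a b, a \in S -> b \in S -> a - b \in S) ->
  (size P <= #|S|)%N -> vring W y ->
  (forall w, w \in S -> vring W P.[y + kappa w]) -> forall i, vring W P`_i.
Proof.
move=> SB sP Wy WP i.
have [u0 _ Wu] := vunit_node_prod.
have -> : P`_i = (node_prod kappa S)^-1 * (node_prod kappa S *: P)`_i by rewrite coefZ mulKf.
apply: vringM => //; rewrite (lagrange kappa SB y sP) coef_sum.
apply: vring_sum => w Sw; rewrite coefZ; apply: vringM; first exact: WP.
apply: vring_coef_prod => d _ j; rewrite coefB coefX coefC; apply: vringB.
  by case: eqP => _; [apply: vring1 | apply: vring0].
by case: ifP => _; [apply: vringD | apply: vring0].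
Qed.

End LagrangeIntegral.

(** * Estimates for the recursion *)

Section BetaEstimates.
Variables (C F : fieldType) (k : C -> F) (W : place k) (q : nat).
Hypothesis q1 : (1 < q)%N.
Hypothesis frob : forall x y : F, (x + y) ^+ q = x ^+ q + y ^+ q.

Lemma beta_neq0 x : maxid W x -> x != 0 -> beta q x != 0.
Proof.
move=> mx x0; rewrite /beta mulf_neq0 ?expf_neq0 ?invr_eq0 //.
rewrite addrC; apply: vunit_neq0 (vunitDm (vunit1 W) (maxidX _ mx)).
by case: q q1 => [|[]].
Qed.

Lemma beta_maxid x : maxid W x -> maxid W (beta q x).
Proof.
move=> mx; apply: maxidMr; last by apply: maxidX => //; apply: ltnW.
have : vunit W (1 + x ^+ q.-1).
  by apply: vunitDm (vunit1 W) (maxidX _ mx); case: q q1 => [|[]].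
by rewrite addrC => /vunitV[].
Qed.

Lemma beta_inv x : maxid W x -> x != 0 -> x^-1 + x^-1 ^+ q = (beta q x)^-1.
Proof.
move=> mx x0; have := beta_neq0 mx x0; rewrite /beta; case: q q1 => // Q _ /=.
rewrite mulf_eq0 invr_eq0 negb_or => /andP[_ x1].
by rewrite exprVn exprS; field; rewrite x0 x1 expf_neq0.
Qed.

Lemma beta_AS (y : F) : y != 0 -> beta q y = y ^+ q.+1 / (y ^+ q + y).
Proof.
move=> y0; rewrite /beta; case: q q1 => // Q _ /=.
have -> : y ^+ Q.+1 + y = y * (y ^+ Q + 1) by rewrite exprS mulrDr mulr1.
by rewrite [y ^+ Q.+2]exprS invfM mulrACA divff ?mul1r.
Qed.

(** If y = a + e with a ^ q = - a, then y ^ q + y = e ^ q + e, and y ^ (q + 1) is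
    congruent to - a ^ 2 modulo e; so beta y has the pole of - a ^ 2 / beta x. *)
Lemma beta_first a x y : a ^+ q = - a -> vunit W a -> maxid W (y - a) ->
  maxid W x -> x != 0 -> y ^+ q + y = beta q x ->
  vring W (beta q y + a ^+ 2 * (x^-1 + x^-1 ^+ q)).
Proof.
move=> aq ua; set e := y - a => me mx x0 yx.
have yE : y = a + e by rewrite /e addrC subrK.
have uy : vunit W y by rewrite yE; apply: vunitDm.
rewrite beta_inv // beta_AS ?(vunit_neq0 uy) //.
have bx0 := beta_neq0 mx x0.
have eE : beta q x = e ^+ q + e by rewrite -yx yE frob aq; ring.
have e0 : e != 0.
  apply: contraNneq bx0 => e0; rewrite eE e0 expr0n gtn_eqF ?addr0 //; exact: ltnW.
have -> : y ^+ q.+1 = (e ^+ q - a) * (a + e) by rewrite exprSr {1}yE frob aq -yE; ring.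
rewrite yx -mulrDl eE; case: q q1 => // Q Q0.
have ue : vunit W (1 + e ^+ Q) by apply: vunitDm (vunit1 W) (maxidX _ me).
have ue0 : e ^+ Q + 1 != 0 by rewrite addrC (vunit_neq0 ue).
have -> : ((e ^+ Q.+1 - a) * (a + e) + a ^+ 2) / (e ^+ Q.+1 + e) =
  (a * e ^+ Q - a + e ^+ Q * e) / (1 + e ^+ Q).
  have E : e * e ^+ Q + e = e * (1 + e ^+ Q) by ring.
  by rewrite exprS; field; rewrite E mulf_neq0 ?(vunit_neq0 ue).
apply: vringM; last by case/vunitV: ue.
have We : vring W (e ^+ Q) by apply/vringX/maxid_vring.
apply: vringD; last exact/vringM/maxid_vring.
by apply: vringB; [apply: vringM; first apply: vunit_vring | apply: vunit_vring].
Qed.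

(** The function beta is close to the identity at a pole, so beta (a / x + z) has
    the pole of a / x; and 1 / x is close to 1 / (x ^ q + x) = 1 / beta x'. *)
Lemma beta_next a x x' z : a ^+ q = a -> vunit W a -> vring W z ->
  maxid W x -> x != 0 -> maxid W x' -> x' != 0 -> x ^+ q + x = beta q x' ->
  vring W (beta q (a / x + z) - a * (x'^-1 + x'^-1 ^+ q)).
Proof.
move=> aq ua Wz mx x0 mx' x'0 xx'; rewrite beta_inv // -xx'.
set w := a + z * x.
have uw : vunit W w by apply: vunitDm => //; apply: maxidMl.
have wq : w ^+ q = a + z ^+ q * x ^+ q by rewrite /w frob aq exprMn.
have -> : a / x + z = w / x by rewrite /w; field.
rewrite /beta; case: q q1 wq => // Q Q0 wq /=.
have uwx : vunit W (w ^+ Q + x ^+ Q).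
  by apply: vunitDm (maxidX _ mx) => //; apply: vunitX.
have ux : vunit W (1 + x ^+ Q) by apply: vunitDm (vunit1 W) (maxidX _ mx).
have wx0 := vunit_neq0 uwx; have xQ0 := vunit_neq0 ux.
have -> : (w / x) ^+ Q.+1 / ((w / x) ^+ Q + 1) - a / (x ^+ Q.+1 + x) =
   (w ^+ Q * z + x ^+ Q * (z ^+ Q.+1 * x ^+ Q)) / ((w ^+ Q + x ^+ Q) * (1 + x ^+ Q)).
  have -> : (w / x) ^+ Q.+1 / ((w / x) ^+ Q + 1) = w ^+ Q.+1 / (x * (w ^+ Q + x ^+ Q)).
    rewrite !expr_div_n [x ^+ Q.+1]exprS.
    have xQ : x ^+ Q != 0 by rewrite expf_neq0.
    have -> : w ^+ Q / x ^+ Q + 1 = (w ^+ Q + x ^+ Q) / x ^+ Q by field.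
    by move: (w ^+ Q.+1) => v; field; rewrite wx0 xQ x0.
  have -> : w ^+ Q * z = (w ^+ Q.+1 - a * w ^+ Q) / x by rewrite exprSr /w; field.
  rewrite wq ![_ ^+ Q.+1]exprS; have -> : x * x ^+ Q + x = x * (1 + x ^+ Q) by ring.
  move: (w ^+ Q) wx0 => v wx0; field.
  by rewrite x0 xQ0 wx0.
have WxQ : vring W (x ^+ Q) by apply/vringX/maxid_vring.
apply: vringM; last by case/vunitV: (vunitM uwx ux).
by apply: vringD; apply: vringM => //; [apply/vunit_vring/vunitX
  | apply: vringM => //; apply: vringX].
Qed.

Lemma beta_unit y : vring W y -> vunit W (y ^+ q + y) -> vunit W y /\ vunit W (beta q y).
Proof.
move=> Wy; case: q q1 => // Q Q0 u1; rewrite /beta /=.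
have E : y ^+ Q.+1 + y = y * (y ^+ Q + 1) by rewrite exprS mulrDr mulr1.
have W2 : vring W (y ^+ Q + 1) by apply: vringD; [apply: vringX | apply: vring1].
have uy : vunit W y.
  by apply/vunitE; split=> // my; apply: (maxid_vunit _ u1); rewrite E; apply: maxidMr.
split=> //; apply: vunit_div; first exact: vunitX.
have -> : y ^+ Q + 1 = (y ^+ Q.+1 + y) / y by rewrite E mulrC mulKf ?(vunit_neq0 uy).
exact: vunit_div.
Qed.

End BetaEstimates.

(** * Towers of Artin-Schreier equations and total ramification *)

Section Tower.
Variables (C : closedFieldType) (q : nat) (LM : local_model C q).
Hypothesis q1 : (1 < q)%N.
Let L := big_field LM.
Let W := big_place LM.
Let t : L := unif LM.

Variables (F0 : fieldType) (T : fieldExtType F0) (M : nat) (X : nat -> T) (x0 : F0).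
Hypothesis X0 : X 0%N = x0%:A.
Hypothesis XS : forall n, (n < M)%N -> X n.+1 ^+ q + X n.+1 = beta q (X n).

Fixpoint tower n : {subfield T} :=
  if n is n'.+1 then <<tower n'; X n>>%AS else 1%AS.

Lemma tower_subS n : (tower n <= tower n.+1)%VS.
Proof. exact: subv_adjoin. Qed.

Lemma tower_sub n k : (n <= k)%N -> (tower n <= tower k)%VS.
Proof.
move=> /subnK<-; elim: (k - n)%N => [|i IH] //.
exact/(subv_trans IH)/tower_subS.
Qed.

Lemma tower_gen n : X n \in tower n.
Proof. by case: n => [|n]; [rewrite X0 rpredZ ?rpred1 | apply: memv_adjoin]. Qed.

Lemma gen_tower j n : (j <= n)%N -> X j \in tower n.
Proof. by move=> jn; apply: (subvP (tower_sub jn)); apply: tower_gen. Qed.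

Lemma tower_beta n : beta q (X n) \in tower n.
Proof. by rewrite rpred_div ?rpredD ?rpredX ?rpred1 ?tower_gen. Qed.

Variable iota : {rmorphism F0 -> L}.

Definition lhom n (s : T -> L) := hom_on (tower n) s /\ forall c, s c%:A = iota c.

Lemma lhom_hom n s : lhom n s -> hom_on (tower n) s. Proof. by case. Qed.

Lemma lhom_sub n k s : (n <= k)%N -> lhom k s -> lhom n s.
Proof.
move=> nk [[s1 sB sM] sc]; have sub := subvP (tower_sub nk).
by split=> //; split=> // u v /sub ? /sub ?; [apply: sB | apply: sM].
Qed.

Lemma lhom0_exists : exists s, lhom 0 s.
Proof.
pose s (f : T) := iota (xget 0 [set c : F0 | f = c%:A]).
have sE c : s c%:A = iota c.
  rewrite /s; congr (iota _); apply: xget_unique => // d /eqP.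
  by rewrite -subr_eq0 -scalerBl scaler_eq0 oner_eq0 orbF subr_eq0 => /eqP.
exists s; split=> //; split.
- by rewrite -[X in s X]scale1r sE rmorph1.
- by move=> u v /vlineP[c ->] /vlineP[d ->]; rewrite -scalerBl !sE rmorphB.
- move=> u v /vlineP[c ->] /vlineP[d ->].
  by rewrite -scalerAl mul1r scalerA !sE rmorphM.
Qed.

Lemma hom_beta n s u : lhom n s -> u \in tower n -> s (beta q u) = beta q (s u).
Proof.
move=> /lhom_hom hs Eu.
rewrite /beta (homM hs) ?rpredV ?rpredD ?rpredX ?rpred1 // (homV hs) ?rpredD ?rpredX ?rpred1 //.
by rewrite (homD hs) ?rpredX ?rpred1 // !(homX hs) // (hom1 hs).
Qed.

Lemma lhom_AS n s : (n < M)%N -> lhom n.+1 s ->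
  s (X n.+1) ^+ q + s (X n.+1) = beta q (s (X n)).
Proof.
move=> nM hs; have hs' := lhom_hom hs.
rewrite -(hom_beta hs) ?(subvP (tower_subS n)) ?tower_gen // -XS //.
by rewrite (homD hs') ?rpredX ?tower_gen // (homX hs') ?tower_gen.
Qed.

(** ** Adjoining one generator *)

Lemma AS_poly_over n : 'X^q + 'X - (beta q (X n))%:P \is a polyOver (tower n).
Proof. by rewrite !(rpredB, rpredD, rpredX, polyOverX, polyOverC) ?tower_beta. Qed.

Lemma root_AS_poly n : (n < M)%N -> root ('X^q + 'X - (beta q (X n))%:P) (X n.+1).
Proof. by move=> nM; rewrite /root !hornerE XS // subrr. Qed.

Lemma minPoly_dvd_AS n : (n < M)%N ->
  minPoly (tower n) (X n.+1) %| 'X^q + 'X - (beta q (X n))%:P.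
Proof. by move=> nM; apply: minPoly_dvdp (AS_poly_over n) (root_AS_poly nM). Qed.

Lemma tower_minPoly n : (n < M)%N -> adjoin_degree (tower n) (X n.+1) = q ->
  minPoly (tower n) (X n.+1) = 'X^q + 'X - (beta q (X n))%:P.
Proof.
move=> nM dq; apply/eqP; rewrite -eqp_monic ?monic_minPoly ?monic_AS_poly //.
by rewrite -dvdp_size_eqp ?minPoly_dvd_AS // size_minPoly size_AS_poly // dq.
Qed.

Lemma map_AS_poly n s : lhom n s ->
  map_poly s ('X^q + 'X - (beta q (X n))%:P) = 'X^q + 'X - (beta q (s (X n)))%:P.
Proof.
move=> hs; have hs' := lhom_hom hs; apply/polyP => i.
rewrite (coef_hom hs') !coefB !coefD !coefXn !coefX !coefC.
have E1 (b : bool) : s b%:R = b%:R by case: b; rewrite ?(hom1 hs') ?(hom0 hs').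
rewrite (homB hs'); last first.
- by case: ifP; rewrite ?rpred0 // tower_beta.
- by rewrite rpredD // rpred_nat.
rewrite (homD hs') ?rpred_nat // !E1; congr (_ - _).
by case: ifP; rewrite ?(hom0 hs') // (hom_beta hs) ?tower_gen.
Qed.

Lemma tower_ext n s y : (n < M)%N -> adjoin_degree (tower n) (X n.+1) = q ->
  lhom n s -> y ^+ q + y = beta q (s (X n)) ->
  let s' := ext (tower n) s (X n.+1) y in
  [/\ lhom n.+1 s', {in tower n, s' =1 s} & s' (X n.+1) = y].
Proof.
move=> nM dq hs yb s'.
have [|h1 h2 h3] := @ext_hom _ _ _ _ _ (lhom_hom hs) (X n.+1) y.
  by rewrite tower_minPoly // map_AS_poly // /root !hornerE yb subrr.
by split=> //; split=> // c; rewrite /s' h2 ?rpredZ ?rpred1 //; case: hs.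
Qed.

(** This does not presuppose that the step has degree q: the roots of the minimal
    polynomial are roots of the Artin-Schreier polynomial in any case. *)
Lemma root_of_min n s : (n < M)%N -> lhom n s ->
  exists y, root (map_poly s (minPoly (tower n) (X n.+1))) y
            /\ y ^+ q + y = beta q (s (X n)).
Proof.
move=> nM hs; have hs' := lhom_hom hs.
have [y ry] : exists y, root (map_poly s (minPoly (tower n) (X n.+1))) y.
  apply/closed_rootP; rewrite (size_hom hs') ?minPolyOver // size_minPoly.
  by rewrite eqSS -lt0n /adjoin_degree.
exists y; split=> //; have /dvdpP[a aE] := minPoly_dvd_AS nM.
have Ea : a \is a polyOver (tower n).
  have := divp_polyOver (AS_poly_over n) (minPolyOver (tower n) (X n.+1)).
  by rewrite aE mulpK // monic_neq0 ?monic_minPoly.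
have : (map_poly s ('X^q + 'X - (beta q (X n))%:P)).[y] = 0.
  rewrite aE (hom_polyM hs') ?minPolyOver // hornerM.
  by move/rootP: ry => ->; rewrite mulr0.
by rewrite map_AS_poly // !hornerE => /eqP; rewrite subr_eq0 => /eqP.
Qed.

(** ** Total ramification *)

(** The pole of [beta] generates the values of the subfield; its order is then prime
    to q, and the next step is totally ramified. *)
Definition ramified n (s : T -> L) := [/\ lhom n s, ~ vring W (beta q (s (X n))) &
  forall u, u \in tower n -> s u != 0 ->
    exists e : int, vunit W (s u / beta q (s (X n)) ^ e)].

(** The trace of f: by Euler's formula the top coefficient of f in the powers of a
    root of P is the trace of f / P', and P' = 1 for P = X ^ q + X - b. *)
Definition lam n (f : T) := (Fadjoin_poly (tower n) (X n.+1) f)`_q.-1.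

Lemma lam_tower n f : lam n f \in tower n.
Proof. exact/polyOverP/Fadjoin_polyOver. Qed.

Lemma ramified_AS n s y : ramified n s -> y ^+ q + y = beta q (s (X n)) ->
  [/\ ~ vring W y, vunit W (y ^+ q / beta q (s (X n))) & vunit W (beta q y / y)].
Proof.
move=> [_ nb _] yb; rewrite -yb in nb *.
have [nWy uy] := AS_pole q1 nb; split=> //; last exact: beta_pole.
by rewrite -[_ / _]invrK invfM invrK mulrC; apply: vunitV.
Qed.

(** A minimal polynomial of degree less than q would yield a vanishing sum of
    terms with distinct pole orders. *)
Lemma ramified_degree n s : (n < M)%N -> ramified n s ->
  adjoin_degree (tower n) (X n.+1) = q.
Proof.
move=> nM rs; case: (rs) => hs nb ord; have hs' := lhom_hom hs.
have [y [ry yb]] := root_of_min nM hs.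
have [nWy uyb _] := ramified_AS rs yb.
have le : (adjoin_degree (tower n) (X n.+1) <= q)%N.
  rewrite -ltnS -size_minPoly -(size_AS_poly (beta q (X n)) q1).
  by rewrite dvdp_leq ?minPoly_dvd_AS // monic_neq0 ?monic_AS_poly.
apply/eqP; rewrite eqn_leq le /= leqNgt; apply/negP => lt.
set d := adjoin_degree _ _ in le lt; set m := minPoly _ _ in ry.
have Em i : m`_i \in tower n by apply/polyOverP/minPolyOver.
have := @digits _ _ _ W q q1 [set s u | u in [set u | u \in tower n]] (beta q (s (X n))) y
   (fun i => s m`_i) d.+1 nb uyb.
case.
- by move=> _ [u Eu <-]; apply: ord.
- exact: lt.
- by move=> i _; exists m`_i => //; apply: Em.
- move=> /(_ d (ltnSn d)); have -> : m`_d = 1.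
    by have := monic_minPoly (tower n) (X n.+1); rewrite monicE lead_coefE size_minPoly => /eqP.
  by rewrite (hom1 hs') => /eqP; rewrite oner_eq0.
- move=> [e [i [_ u0 _]]]; move: u0; have -> : \sum_(i < d.+1) s m`_i * y ^+ i = 0.
    move/rootP: ry; rewrite (horner_coef_wide (n := d.+1)); last first.
      by rewrite (size_hom hs') ?minPolyOver // size_minPoly.
    by move=> E; rewrite -[RHS]E; apply: eq_bigr => j _; rewrite (coef_hom hs').
  by rewrite mul0r => /vunit_neq0; rewrite eqxx.
Qed.

(** Ramification persists, with the pole of the new generator in the place of that
    of [beta]. The last clause holds because f dominates each of its digits. *)
Lemma ramified_step n s y : (n < M)%N -> ramified n s ->
    y ^+ q + y = beta q (s (X n)) ->
  let s' := ext (tower n) s (X n.+1) y in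
  [/\ ramified n.+1 s', {in tower n, s' =1 s}, s' (X n.+1) = y &
     forall f, f \in tower n.+1 -> vring W (s (lam n f) * y ^+ q.-1 / s' f)].
Proof.
move=> nM rs yb s'; case: (rs) => hs nb ord; have hs' := lhom_hom hs.
have dq := ramified_degree nM rs.
have [nWy uyb ubeta] := ramified_AS rs yb.
have [hs1 s1E s1y] : [/\ lhom n.+1 s', {in tower n, s' =1 s} & s' (X n.+1) = y].
  exact: tower_ext.
have [my y0] := pole_inv nWy.
have b0 : beta q y != 0.
  by apply: contraTneq (vunit_neq0 ubeta) => ->; rewrite mul0r eqxx.
have dig f := @digits _ _ _ W q q1 [set s u | u in [set u | u \in tower n]]
   (beta q (s (X n))) y
   (fun i => s (Fadjoin_poly (tower n) (X n.+1) f)`_i) q nb uyb.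
have {}dig f : f \in tower n.+1 -> s' f != 0 ->
   (exists e : int, vunit W (s' f / y ^ e)) /\ vring W (s (lam n f) * y ^+ q.-1 / s' f).
  move=> Ef f0; have s'f := extE (lhom_hom hs) (X n.+1) y f; rewrite dq in s'f.
  case: (dig f) => //.
  - by move=> _ [u Eu <-]; apply: ord.
  - move=> i _; exists (Fadjoin_poly (tower n) (X n.+1) f)`_i => //.
    exact/polyOverP/Fadjoin_polyOver.
  - move=> all0; case/eqP: f0; rewrite /s' s'f big1 // => i _.
    by rewrite all0 ?mul0r.
  - rewrite -s'f => -[e [i [_ u all]]]; split; first by eexists; apply: u.
    by apply: all; rewrite prednK // ltnW.
split=> //.
- split=> //.
    rewrite s1y => Wb; apply: nWy.
    have -> : y = beta q y * (beta q y / y)^-1 by rewrite invfM invrK mulVKf.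
    by apply: vringM => //; case/vunitV: ubeta.
  move=> u Eu u0; have [[e ue] _] := dig u Eu u0; exists e; rewrite s1y.
  have -> : s' u / beta q y ^ e = s' u / y ^ e * ((beta q y / y) ^ e)^-1.
    rewrite expfzMl exprz_inv -invr_expz.
    by field; rewrite !expfz_neq0.
  by apply: vunitM => //; apply/vunitV/vunitXz.
- move=> f Ef; have [s'f0|f0] := eqVneq (s' f) 0; last by case: (dig f).
  by rewrite s'f0 invr0 mulr0; apply: vring0.
Qed.

Let U : set L := @unram _ _ LM.
Variables (K : finFieldType) (kap : {rmorphism K -> C}).
Definition kappa : {rmorphism K -> L} := (cemb LM \o kap)%FUN.

Hypothesis degX : forall n, (n < M)%N -> adjoin_degree (tower n) (X n.+1) = q.

Lemma vring_kappa c : vring W (kappa c).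
Proof. exact: vring_const1. Qed.

Lemma kappa_unit c : c != 0 -> vunit W (kappa c).
Proof. by apply: vunit_kappa; apply: vring_kappa. Qed.

Fixpoint itrace i (g : T) := if i is i'.+1 then lam (M - i) (itrace i' g) else g.

Lemma itrace_tower i g : g \in tower M -> itrace i g \in tower (M - i).
Proof. by case: i => [|i] Eg; [rewrite subn0 | apply: lam_tower]. Qed.

(** ** Unramified homomorphisms *)

Definition lhomU n (s : T -> L) := lhom n s /\ forall u, u \in tower n -> U (s u).

Lemma U1 : U 1. Proof. by case: (unram_sub LM). Qed.
Lemma UB x y : U x -> U y -> U (x - y).
Proof. by case: (unram_sub LM) => _ + _; apply. Qed.
Lemma UM x y : U x -> U y -> U (x * y).
Proof. by case: (unram_sub LM) => _ _; apply. Qed.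
Lemma U0 : U 0. Proof. by rewrite -(subrr 1); apply: UB; apply: U1. Qed.
Lemma UN x : U x -> U (- x).
Proof. by move=> Ux; rewrite -sub0r; apply: UB => //; apply: U0. Qed.
Lemma UD x y : U x -> U y -> U (x + y).
Proof. by move=> Ux Uy; rewrite -[y]opprK; apply/UB/UN. Qed.
Lemma UX n x : U x -> U (x ^+ n).
Proof.
by move=> Ux; elim: n => [|n IH]; [apply: U1 | rewrite exprS; apply: UM].
Qed.
Lemma UV x : U x -> U x^-1. Proof. exact: unramV. Qed.
Lemma Ukappa c : U (kappa c). Proof. exact: unram_cst. Qed.

Lemma Ubeta y : U y -> U (beta q y).
Proof.
move=> Uy; apply: UM; first exact: UX.
by apply/UV/UD; [apply: UX | apply: U1].
Qed.

Lemma lhomU_ext n s y : (n < M)%N -> lhomU n s -> U y -> y ^+ q + y = beta q (s (X n)) ->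
  let s' := ext (tower n) s (X n.+1) y in
  [/\ lhomU n.+1 s', {in tower n, s' =1 s} & s' (X n.+1) = y].
Proof.
move=> nM [hs Us] Uy yb s'.
have [h1 h2 h3] := tower_ext nM (degX nM) hs yb.
split=> //; split=> // u Eu; rewrite /s' (extE (lhom_hom hs)).
apply: (big_ind U) => [|a b|i _]; [exact: U0 | exact: UD | apply: UM; last exact: UX].
by apply: Us; apply/polyOverP/Fadjoin_polyOver.
Qed.

Lemma lhomU0 s : lhom 0 s -> (forall f, U (iota f)) -> lhomU 0 s.
Proof. by move=> hs Ui; split=> // _ /vlineP[c ->]; case: hs => _ ->. Qed.

(** ** The totally ramified part of the tower *)

Lemma t_neq0 : t != 0.
Proof. by have := @unif_tr _ _ LM 'X; rewrite polyX_eq0 map_polyX hornerX; apply. Qed.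

Lemma maxid_t : maxid W t. Proof. exact: unif_max. Qed.

Let t0 : t != 0 := t_neq0.
Let mt : maxid W t := maxid_t.

(** All orders at an unramified homomorphism are integral, so a simple pole of
    [beta] has an order that generates them all. *)
Lemma ramified_start n s : lhomU n s -> vunit W (beta q (s (X n)) * t) ->
  ramified n s.
Proof.
set b := beta q _ => -[hs Us] ub.
have b0 : b != 0 by apply: contraTneq (vunit_neq0 ub) => ->; rewrite mul0r eqxx.
split=> //.
  move=> Wb; apply: (maxid_vunit _ ub); exact/maxidMl/maxid_t.
move=> u Eu u0; have [e ue] := unram_ord (Us u Eu) u0; exists (- e).
rewrite -/b; have -> : s u / b ^ (- e) = s u / t ^ e * (b * t) ^ e.
  rewrite expfzMl -invr_expz invrK; have te := expfz_neq0 e t0.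
  by field.
by apply: vunitM => //; apply: vunitXz.
Qed.

Lemma lam0 n : lam n 0 = 0.
Proof. by rewrite /lam Fadjoin_polyC ?rpred0 // polyC0 coef0. Qed.

(** The bounds on the top digits in the single steps multiply up to a bound on the
    iterated trace. *)
Lemma ramified_extend i n s : n = (M - i)%N -> (i <= M)%N -> ramified n s ->
  exists r, [/\ ramified M r, {in tower n, r =1 s},
    (forall j, (n < j <= M)%N -> ~ vring W (r (X j))),
    vunit W (beta q (s (X n)) / beta q (r (X M)) ^+ (q ^ i)) &
    forall g, g \in tower M ->
      vring W (s (itrace i g) * beta q (r (X M)) ^+ (q ^ i).-1 / r g)].
Proof.
elim: i n s => [|i IH] n s nE iM rs.
  rewrite subn0 in nE; subst n; exists s; split=> //.
  - by move=> j; case: ltngtP.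
  - rewrite expn0 expr1 divff; first exact: vunit1.
    by case: rs => _ nb _; have [] := pole_inv nb.
  - move=> g Eg; rewrite expn0 expr0 mulr1 /=.
    have [->|g0] := eqVneq (s g) 0; first by rewrite mul0r; apply: vring0.
    by rewrite divff //; apply: vring1.
have nM : (n < M)%N by lia.
have n1 : n.+1 = (M - i)%N by lia.
have hs : lhom n s by case: rs.
have [y [_ yb]] := root_of_min nM hs.
have [rs' s'E s'y s'lam] := ramified_step nM rs yb.
have [nWy uyb ubeta] := ramified_AS rs yb.
set s' := ext _ _ _ _ in rs' s'E s'y s'lam.
have [r [rr rE rpole ru rlam]] := IH n.+1 s' n1 (ltnW iM) rs'.
rewrite s'y in ru.
set B := beta q (r (X M)) in ru rlam *.
have B0 : B != 0 by case: rr => _ nb _; have [] := pole_inv nb.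
have [_ y0] := pole_inv nWy.
have b0 : beta q (s (X n)) != 0.
  by apply: contraTneq (vunit_neq0 uyb) => ->; rewrite invr0 mulr0 eqxx.
have by0 : beta q y != 0.
  by apply: contraTneq (vunit_neq0 ubeta) => ->; rewrite mul0r eqxx.
have uyB : vunit W (y / B ^+ (q ^ i)).
  have -> : y / B ^+ (q ^ i) = beta q y / B ^+ (q ^ i) / (beta q y / y).
    by field; rewrite y0 by0 expf_neq0.
  exact: vunit_div.
exists r; split=> //.
- move=> u Eu; rewrite rE ?s'E //; exact: (subvP (tower_subS _)).
- move=> j /andP[nj jM]; have [<-|nj1] := eqVneq n.+1 j.
    by rewrite rE ?tower_gen // s'y.
  by apply: rpole; rewrite ltn_neqAle nj1 nj.
- rewrite -/B; clearbody B; move: b0 uyb; move: (beta q (s (X n))) => b b0 uyb.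
  have -> : b / B ^+ (q ^ i.+1) = (y / B ^+ (q ^ i)) ^+ q * (y ^+ q / b)^-1.
    by rewrite expnSr exprM expr_div_n; field; rewrite b0 ?y0 ?expf_neq0.
  by apply: vunitM; [apply: vunitX | apply: vunitV].
- move=> g Eg; rewrite [itrace _ _]/= -nE -/B; clearbody B.
  set f := itrace i g; have Ef : f \in tower n.+1 by rewrite n1; apply: itrace_tower.
  have [f0|f0] := eqVneq f 0.
    by rewrite f0 lam0 (hom0 (lhom_hom hs)) !mul0r; apply: vring0.
  have hs' : lhom n.+1 s' by case: rs'.
  have s'f0 : s' f != 0 by rewrite (hom_eq0 (lhom_hom hs')).
  have -> : s (lam n f) * B ^+ (q ^ i.+1).-1 / r g =
    (s (lam n f) * y ^+ q.-1 / s' f) * (s' f * B ^+ (q ^ i).-1 / r g)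
      * ((y / B ^+ (q ^ i)) ^+ q.-1)^-1.
    have -> : (q ^ i.+1).-1 = (q ^ i * q.-1 + (q ^ i).-1)%N.
      have e0 : (0 < q ^ i)%N by rewrite expn_gt0 ltnW.
      by rewrite expnSr; move: (q ^ i)%N e0 {+}q1 => e; clear; nia.
    rewrite exprD exprM expr_div_n.
    have Bi : (B ^+ (q ^ i)) ^+ q.-1 != 0 by rewrite !expf_neq0.
    have yi : y ^+ q.-1 != 0 by rewrite expf_neq0.
    have [->|g0] := eqVneq (r g) 0; first by rewrite invr0 !mulr0 mul0r.
    by field; rewrite g0 s'f0 yi Bi.
  apply: vringM; last by case/vunitV: (vunitX q.-1 uyB).
  by apply: vringM; [apply: s'lam | apply: rlam].
Qed.

(** The different of the ramified part has exponent 2 (q ^ i - 1), hence the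
    bound under which the trace is integral. *)
Lemma ramified_integral i n s g r : n = (M - i)%N -> g \in tower M ->
  ramified n s ->
  ~ vring W (beta q (r (X M))) ->
  vunit W (beta q (s (X n)) / beta q (r (X M)) ^+ (q ^ i)) ->
  vring W (s (itrace i g) * beta q (r (X M)) ^+ (q ^ i).-1 / r g) ->
  (r g = 0 -> g = 0) ->
  vring W (r g / beta q (r (X M)) ^+ ((q ^ i).-1).*2) ->
  vring W (s (itrace i g)).
Proof.
move=> nE Eg [hs nb ord]; set B := beta q (r (X M)) => nWB ub Wlam rg0 Wg.
have [mB B0] := pole_inv nWB; have [_ b0] := pole_inv nb.
have [u0|u0] := eqVneq (s (itrace i g)) 0; first by rewrite u0; apply: vring0.
have [e ue] : exists e : int, vunit W (s (itrace i g) / beta q (s (X n)) ^ e).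
  by apply: ord => //; rewrite nE; apply: itrace_tower.
have rg : r g != 0.
  apply: contra_neq u0 => /rg0 ->.
  have d0 j : itrace j 0 = 0 by elim: j => [|j IH] //=; rewrite IH lam0.
  by rewrite d0 (hom0 (lhom_hom hs)).
set Q := (q ^ i)%N in ub Wlam Wg *.
have Q0 : (0 < Q)%N by rewrite expn_gt0 ltnW.
have uB : vunit W (s (itrace i g) / B^-1 ^ (- (Q%:Z * e))).
  rewrite exprz_inv opprK.
  have -> : s (itrace i g) / B ^ (Q%:Z * e) = s (itrace i g) / beta q (s (X n)) ^ e
      * (beta q (s (X n)) / B ^+ Q) ^ e.
    rewrite expfzMl exprz_inv -invr_expz -exprz_exp -exprnP.
    by field; rewrite !expfz_neq0 ?expf_neq0.
  by apply: vunitM => //; apply: vunitXz.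
have B10 : B^-1 != 0 by rewrite invr_eq0.
apply/(ord_vring B10 mB uB).
have uB2 : vunit W (s (itrace i g) / B ^+ Q.-1 / B^-1 ^ (Q.-1%:Z - Q%:Z * e)).
  have := uB; congr (vunit W _).
  rewrite expfzDr // -exprnP exprVn invfM !mulrA invrK mulfVK ?expf_neq0 //.
have : vring W (s (itrace i g) / B ^+ Q.-1).
  have -> : s (itrace i g) / B ^+ Q.-1 =
     (s (itrace i g) * B ^+ Q.-1 / r g) * (r g / B ^+ Q.-1.*2).
    by rewrite -addnn exprD; field; rewrite rg expf_neq0.
  exact: vringM.
move/(ord_vring B10 mB uB2) => H; rewrite oppr_ge0.
have e0 : e <= 0.
  rewrite leNgt; apply/negP => e1.
  have : Q%:Z <= Q%:Z * e by apply: ler_peMr.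
  move: H Q0; lia.
by apply: mulr_ge0_le0.
Qed.

Variable S : {set K}.
Hypothesis SB : forall a b, a \in S -> b \in S -> a - b \in S.
Hypothesis cardS : #|S| = q.
Hypothesis S_AS : forall w, w \in S -> w ^+ q + w = 0.
Hypothesis frobL : forall x y : L, (x + y) ^+ q = x ^+ q + y ^+ q.

Lemma AS_shift y b w : w \in S -> y ^+ q + y = b ->
  (y + kappa w) ^+ q + (y + kappa w) = b.
Proof.
move=> Sw <-; rewrite frobL -rmorphXn addrACA -rmorphD S_AS // rmorph0 addr0 //.
Qed.

(** Interpolation at the q roots y + w reads off the top coefficient of f; the
    constant factor is the product of the nonzero elements of S. *)
Lemma sum_ext n s y f : (n < M)%N -> lhom n s ->
  node_prod kappa S * s (lam n f) =
    \sum_(w in S) ext (tower n) s (X n.+1) (y + kappa w) f.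
Proof.
move=> nM hs; have hs' := lhom_hom hs.
rewrite /ext -(lagrange_top kappa) ?cardS ?(coef_hom hs') //.
by rewrite (leq_trans (size_poly _ _)) // (leq_trans (size_Fadjoin_poly _ _ _)) ?degX.
Qed.

Lemma descend n s y g : (n < M)%N -> lhom n s ->
  (forall w, w \in S ->
     vring W (ext (tower n) s (X n.+1) (y + kappa w) (itrace (M - n.+1) g))) ->
  vring W (s (itrace (M - n) g)).
Proof.
move=> nM hs Wext.
have -> : itrace (M - n) g = lam n (itrace (M - n.+1) g).
  have -> : (M - n)%N = (M - n.+1).+1 by lia.
  by rewrite /= -/(itrace _); congr lam; lia.
have [u0 _ Wu] := vunit_node_prod S vring_kappa.
rewrite -[s _](mulKf u0); apply: vringM => //.
by rewrite (sum_ext y) //; apply: vring_sum.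
Qed.

(** * Integrality of the iterated trace *)

Let kp : {rmorphism K -> L} := kappa.
Hypothesis sqrN : forall w, w \in S -> (w ^+ 2) ^+ q = w ^+ 2.

(** Solve the equation of the residues in C, then correct by a small root. *)
Lemma AS_solve b : U b -> vring W b -> exists y, [/\ U y, vring W y & y ^+ q + y = b].
Proof.
move=> Ub Wb; have [r mr] := unram_res Ub Wb.
have [c rc] : exists c, root ('X^q + 'X - r%:P) c.
  by apply/closed_rootP; rewrite size_AS_poly // eqSS -lt0n ltnW.
have cr : c ^+ q + c = r.
  by move/rootP: rc; rewrite !hornerE => /eqP; rewrite subr_eq0 => /eqP.
have [|y [Uy my yb]] := unram_AS _ mr; first by apply: UB => //; apply: unram_cst.
exists (y + cemb LM c); split.
- by apply: UD => //; apply: unram_cst.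
- by apply: vringD; [apply: maxid_vring | apply: vring_const1].
- by rewrite frobL addrACA yb -rmorphXn -rmorphD cr subrK.
Qed.

(** ** The possible reductions of an unramified initial segment *)

Definition st_zero n (s : T -> L) := s (X 0%N) = t /\
  forall j, (j <= n)%N -> maxid W (s (X j)) /\ s (X j) != 0.

Definition st_good n (s : T -> L) := forall j, (j <= n)%N ->
  vring W (s (X j)) /\ vunit W (s (X j) ^+ q + s (X j)).

(** The generators X 0, ..., X (k-1) reduce to 0 and X k to a; after that the
    generators have the poles of the reflected ones, X (k+j) behaving like
    - a ^ 2 / X (k-j), and ramification starts at X (2 k + 1) only. *)
Definition st_pivot k (a : K) n (s : T -> L) :=
  [/\ (k <= n <= k.*2)%N, s (X 0%N) = (if k is 0 then kp a + t else t),
      forall j, (j < k)%N -> maxid W (s (X j)) /\ s (X j) != 0,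
      maxid W (s (X k) - kp a)
    & forall j, (0 < j <= n - k)%N -> vring W (s (X (k + j)%N) + kp a ^+ 2 / s (X (k - j)%N))].

Definition in_Sstar a := a \in S /\ a != 0.

Lemma kp_unit a : in_Sstar a -> vunit W (kp a).
Proof. by case=> _ a0; apply: kappa_unit. Qed.

Lemma kp_AS a : a \in S -> kp a ^+ q = - kp a.
Proof.
by move=> /S_AS E; apply/eqP; rewrite -subr_eq0 opprK -rmorphXn -rmorphD E rmorph0.
Qed.

(** The bound on g at a totally ramified extension r of s, with the exponent of
    [ramified_integral]; the ramification index is q ^ i. *)
Definition ramified_bound i n (s : T -> L) (g : T) := forall r,
  ramified M r -> {in tower n, r =1 s} ->
  (forall j, (n < j <= M)%N -> ~ vring W (r (X j))) ->
  vunit W (t^-1 / beta q (r (X M)) ^+ (q ^ i)) ->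
  vring W (r g / beta q (r (X M)) ^+ ((q ^ i).-1).*2).

Variable g : T.
Hypothesis g_tower : g \in tower M.

(** From the first simple pole of [beta] on, all steps are totally ramified. *)
Lemma integral_at_ramified i n s : n = (M - i)%N -> (i <= M)%N -> lhomU n s ->
  vunit W (beta q (s (X n)) * t) -> ramified_bound i n s g -> vring W (s (itrace i g)).
Proof.
move=> nE iM hs ub gb.
have rs := ramified_start hs ub.
have [r [rr rE rpole ru rlam]] := ramified_extend nE iM rs.
have ru' : vunit W (t^-1 / beta q (r (X M)) ^+ (q ^ i)).
  have -> : t^-1 / beta q (r (X M)) ^+ (q ^ i) =
     beta q (s (X n)) / beta q (r (X M)) ^+ (q ^ i) / (beta q (s (X n)) * t).
    have b0 : beta q (s (X n)) != 0.
      by apply: contraTneq (vunit_neq0 ub) => ->; rewrite mul0r eqxx.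
    rewrite [in RHS]mulrAC; congr (_ * _); rewrite invfM mulrA divff ?mul1r //.
  exact: vunit_div.
have [hr nWb _] := rr.
apply: (ramified_integral nE g_tower rs nWb ru) (rlam _ g_tower) _ _.
  by move/eqP; rewrite (hom_eq0 (lhom_hom hr)) // => /eqP.
exact: gb.
Qed.

(** One step down: the trace is a sum over the q roots, up to a unit. *)
Lemma descend_unram i n s y : n = (M - i.+1)%N -> (i < M)%N -> lhomU n s -> U y ->
  y ^+ q + y = beta q (s (X n)) ->
  (forall w s', w \in S -> lhomU n.+1 s' ->
     (forall j, (j <= n)%N -> s' (X j) = s (X j)) -> s' (X n.+1) = y + kp w ->
     s' (X n.+1) ^+ q + s' (X n.+1) = beta q (s (X n)) -> vring W (s' (itrace i g))) ->
  vring W (s (itrace i.+1 g)).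
Proof.
move=> nE iM hs Uy yb H; have nM : (n < M)%N by lia.
have := @descend n s y g nM.
have -> : (M - n = i.+1)%N by lia.
apply; first by case: hs.
move=> w Sw; have yb' := AS_shift Sw yb.
have Uyw : U (y + kp w) by apply: UD => //; apply: Ukappa.
have [hs' s'E s'y] := lhomU_ext nM hs Uyw yb'.
have -> : (M - n.+1 = i)%N by lia.
apply: (H w) => //; last by rewrite s'y.
by move=> j jn; apply/s'E/gen_tower.
Qed.

Lemma integral_good i n s : n = (M - i)%N -> (i <= M)%N -> lhomU n s -> st_good n s ->
  (forall r, lhomU M r -> st_good M r -> r (X 0%N) = s (X 0%N) -> vring W (r g)) ->
  vring W (s (itrace i g)).
Proof.
elim: i n s => [|i IH] n s nE iM hs ss gb.
  by rewrite subn0 in nE; subst n; apply: gb.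
have nM : (n < M)%N by lia.
have [Wn un] := ss n (leqnn n); have [uy ub] := beta_unit q1 Wn un.
have Uy : U (s (X n)) by case: hs => _; apply; apply: tower_gen.
have [y [Uy' Wy yb]] := AS_solve (Ubeta Uy) (vunit_vring ub).
apply: (descend_unram nE iM hs Uy' yb) => w s' Sw hs' s'E s'y s'b.
apply: (IH n.+1) => //; [lia | exact: ltnW | | by move=> r hr sr r0; apply: gb; rewrite ?r0 ?s'E].
move=> j; rewrite leq_eqVlt => /predU1P[->|jn]; last by rewrite s'E //; apply: ss.
by rewrite s'b s'y; split=> //; apply: vringD => //; apply: vring_kappa.
Qed.

(** At n = 2 k the last generator has the simple pole of - a ^ 2 / t, or, if k = 0,
    the trace of a + t vanishes to first order. *)
Lemma pivot_ramified k a n s : in_Sstar a -> st_pivot k a n s -> n = k.*2 ->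
  vunit W (beta q (s (X n)) * t).
Proof.
move=> Sa [_ s0 szero spiv spole] nE.
case: k => [|k] in s0 szero spiv spole nE *.
  rewrite nE /= s0.
  have uy : vunit W (kp a + t) by apply: vunitDm mt; apply: kp_unit.
  rewrite (beta_AS q1) ?(vunit_neq0 uy) // frobL kp_AS; last by case: Sa.
  have -> : - kp a + t ^+ q + (kp a + t) = t * (1 + t ^+ q.-1).
    by rewrite mulrDr mulr1 -exprS prednK ?(ltnW q1) //; ring.
  have u1 : vunit W (1 + t ^+ q.-1).
    by apply: vunitDm (vunit1 W) (maxidX _ mt); lia.
  rewrite invfM mulrA mulrAC -[_ / t * t]mulrA mulVf // mulr1.
  by apply: vunit_div => //; apply: vunitX.
have := spole k.+1; rewrite subnn s0.
have -> : (0 < k.+1 <= n - k.+1)%N by rewrite nE; lia.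
have -> : (k.+1 + k.+1)%N = n by rewrite nE addnn.
move=> /(_ isT) Wz; set z := s (X n) + _ in Wz.
have snE : s (X n) * t = - kp a ^+ 2 + z * t by rewrite /z mulrDl divfK //; ring.
have usn : vunit W (s (X n) * t).
  rewrite snE; apply: vunitDm; last exact: maxidMl.
  by apply: vunitN; apply: vunitX; apply: kp_unit.
have npole : ~ vring W (s (X n)).
  by move=> Ws; apply: (maxid_vunit _ usn); apply: maxidMl.
have [_ sn0] := pole_inv npole.
have := vunitM (beta_pole q1 npole) usn.
by rewrite -/(beta q _) mulrA divfK.
Qed.

(** The pole of [beta] is that of an element of the form - a ^ 2 (u + u ^ q), with u
    the inverse of the generator reflected at X k. *)
Lemma pivot_next k a n s : in_Sstar a -> lhomU n s -> st_pivot k a n s ->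
    (n < k.*2)%N -> (n < M)%N ->
  let u := (s (X (k.*2 - n.+1)%N))^-1 in
  U u /\ vring W (beta q (s (X n)) + kp a ^+ 2 * (u + u ^+ q)).
Proof.
move=> Sa hs [/andP[kn _] s0 szero spiv spole] n2k nM u.
have uka := kp_unit Sa.
have inE j : (j <= n)%N -> X j \in tower n.
  by move=> jn; exact: gen_tower.
have AS j : (j < n)%N -> s (X j.+1) ^+ q + s (X j.+1) = beta q (s (X j)).
  move=> jn; apply: (lhom_AS); first exact: ltn_trans nM.
  by apply: (lhom_sub jn); case: hs.
split; first by apply: UV; case: hs => _; apply; apply: inE; lia.
have [mu u0] := szero (k.*2 - n.+1)%N ltac:(lia).
move: kn; rewrite leq_eqVlt => /predU1P[kE|kn].
  subst n; have E : (k.*2 - k.+1 = k.-1)%N by lia.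
  rewrite /u E in mu u0 *.
  have := @beta_first _ _ _ W q q1 frobL (kp a) (s (X k.-1)) (s (X k)).
  apply=> //; first by apply: kp_AS; case: Sa.
  have k0 : (0 < k)%N by lia.
  by have := AS k.-1; rewrite prednK //; apply.
pose j := (n - k)%N.
have Wz : vring W (s (X n) + kp a ^+ 2 / s (X (k.*2 - n)%N)).
  have := spole (n - k)%N; rewrite subnKC ?(ltnW kn) //.
  have -> : (k - (n - k) = k.*2 - n)%N by lia.
  by apply; lia.
set z := s (X n) + _ in Wz.
have [mx x00] := szero (k.*2 - n)%N ltac:(lia).
have xx' : s (X (k.*2 - n)%N) ^+ q + s (X (k.*2 - n)%N) = beta q (s (X (k.*2 - n.+1)%N)).
  have -> : (k.*2 - n = (k.*2 - n.+1).+1)%N by lia.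
  by apply: AS; lia.
have := @beta_next _ _ _ W q q1 frobL (- kp a ^+ 2) (s (X (k.*2 - n)%N))
   (s (X (k.*2 - n.+1)%N)) z.
have -> : - kp a ^+ 2 / s (X (k.*2 - n)%N) + z = s (X n) by rewrite /z; ring.
rewrite mulNr opprK.
apply=> //; last by apply: vunitN; apply: vunitX.
have <- : kp (- (a ^+ 2)) = - kp a ^+ 2 by rewrite rmorphN rmorphXn.
rewrite -rmorphXn; congr (kp _).
have Sa2 := sqrN (proj1 Sa).
have h : kp (- a ^+ 2 + a ^+ 2) ^+ q = 0 by rewrite addNr rmorph0 expr0n gtn_eqF ?(ltnW q1).
apply: (fmorph_inj kp); move: h; rewrite rmorphD frobL -!rmorphXn Sa2 => /eqP.
by rewrite addr_eq0 -rmorphN => /eqP.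
Qed.

(** As long as n < 2 k, the substitution y = z - a ^ 2 u removes the pole from the
    Artin-Schreier equation and the step is unramified. The reflection runs out of
    generators at n = 2 k, where total ramification starts. *)
Lemma integral_pivot k a i n s : in_Sstar a -> n = (M - i)%N -> (i <= M)%N ->
  lhomU n s -> st_pivot k a n s ->
  ((M <= k.*2)%N -> forall r, lhomU M r -> st_pivot k a M r -> vring W (r g)) ->
  ((k.*2 < M)%N -> forall r, lhomU k.*2 r -> st_pivot k a k.*2 r ->
      ramified_bound (M - k.*2) k.*2 r g) ->
  vring W (s (itrace i g)).
Proof.
move=> Sa; elim: i n s => [|i IH] n s nE iM hs ss gb gr.
  rewrite subn0 in nE; subst n; apply: gb => //.
  by case: ss => /andP[].
have nM : (n < M)%N by lia.
have [n2k|n2k] := ltnP n k.*2; last first.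
  have nk : n = k.*2 by case: ss => /andP[_ le] *; apply/eqP; rewrite eqn_leq le.
  have iE : i.+1 = (M - k.*2)%N by lia.
  apply: (integral_at_ramified nE) => //; first exact: pivot_ramified ss nk.
  by rewrite nk iE; rewrite nk in hs ss nM; apply: gr.
have [Uu Wb] := pivot_next Sa hs ss n2k nM.
set u := (s _)^-1 in Uu Wb.
have Un : U (s (X n)) by case: hs => _; apply; apply: tower_gen.
have Ub : U (beta q (s (X n)) + kp a ^+ 2 * (u + u ^+ q)).
  apply: UD; first exact: Ubeta.
  by apply: UM; [apply: UX; apply: Ukappa | apply: UD => //; apply: UX].
have [z [Uz Wz zb]] := AS_solve Ub Wb.
pose y := z - kp a ^+ 2 * u.
have Uy : U y by apply: UB => //; apply: UM => //; apply: UX; apply: Ukappa.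
have a2 : (kp a ^+ 2) ^+ q = kp a ^+ 2 by rewrite -!rmorphXn sqrN //; case: Sa.
have frobB (v w : L) : (v - w) ^+ q = v ^+ q - w ^+ q.
  by apply/eqP; rewrite eq_sym subr_eq -frobL subrK.
have yb : y ^+ q + y = beta q (s (X n)).
  rewrite /y frobB exprMn a2; have -> : beta q (s (X n)) =
     z ^+ q + z - kp a ^+ 2 * (u + u ^+ q) by rewrite zb addrK.
  by ring.
apply: (descend_unram nE iM hs Uy yb) => w s' Sw hs' sE s'y _.
apply: (IH n.+1) => //; [by lia | by lia | ].
case: ss => /andP[kn _] s0 szero spiv spole; split.
- lia.
- by rewrite sE.
- by move=> j jk; rewrite sE; [apply: szero | lia].
- by rewrite sE.
- move=> j /andP[j0]; rewrite leq_eqVlt => /predU1P[jE|jlt].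
    have -> : (k + j = n.+1)%N by lia.
    rewrite s'y sE; last by lia.
    have -> : (k - j = k.*2 - n.+1)%N by lia.
    rewrite -/u /y -addrA [kp w + _]addrC addrA subrK.
    by apply: vringD => //; apply: vring_kappa.
  by rewrite !sE; [apply: spole; lia | lia | lia].
Qed.

(** While the generators vanish, the root of the next equation is congruent to an
    element w of S: if w = 0 the zero persists, otherwise X (n + 1) is a pivot. *)
Lemma integral_zero i n s : n = (M - i)%N -> (i <= M)%N -> lhomU n s -> st_zero n s ->
  (forall r, lhomU M r -> st_zero M r -> vring W (r g)) ->
  (forall k a, (0 < k)%N -> in_Sstar a -> (k <= M <= k.*2)%N ->
     forall r, lhomU M r -> st_pivot k a M r -> vring W (r g)) ->
  (forall k a, (0 < k)%N -> in_Sstar a -> (k.*2 < M)%N ->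
     forall r, lhomU k.*2 r -> st_pivot k a k.*2 r ->
      ramified_bound (M - k.*2) k.*2 r g) ->
  vring W (s (itrace i g)).
Proof.
move=> + + + + gz gp gr; elim: i n s => [|i IH] n s nE iM hs ss.
  by rewrite subn0 in nE; subst n; apply: gz.
have nM : (n < M)%N by lia.
have [mn n0] : maxid W (s (X n)) /\ s (X n) != 0 by case: ss => _; apply.
have Un : U (s (X n)) by case: hs => _; apply; apply: tower_gen.
have [y [Uy my yb]] := unram_AS (Ubeta Un) (beta_maxid q1 mn).
have y0 : y != 0.
  apply: contraNneq (beta_neq0 q1 mn n0) => y0.
  by rewrite -yb y0 addr0 expr0n gtn_eqF ?(ltnW q1).
apply: (descend_unram nE iM hs Uy yb) => w s' Sw hs' sE s'y _; case: ss => s0 ss.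
have [w0|w0] := eqVneq w 0.
  apply: (IH n.+1) => //; [lia | lia |].
  split; first by rewrite sE.
  move=> j; rewrite leq_eqVlt => /predU1P[->|jn].
    by rewrite s'y w0 rmorph0 addr0.
  by rewrite sE //; apply: ss.
apply: (@integral_pivot n.+1 w i n.+1) => //; [lia | lia | | | ].
- split; [lia | by rewrite sE | | | by lia].
    by move=> j jn; rewrite sE //; apply: ss.
  by rewrite s'y addrK.
- by move=> le r hr sr; apply: (gp n.+1 w) => //; lia.
- by move=> lt r hr sr; apply: (gr n.+1 w).
Qed.

End Tower.

(** * The field of constants *)

Section Constants.
Variables (q : nat) (K : finFieldType).
Hypotheses (hq : prime_power q) (hK : #|K| = (q ^ 2)%N).

Lemma q_gt1 : (1 < q)%N.
Proof. by case: hq => p [e [pp e0 ->]]; rewrite -(exp1n e) ltn_exp2r ?prime_gt1. Qed.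

Lemma frobenius (R : comNzRingType) (s : {rmorphism K -> R}) (x y : R) :
  (x + y) ^+ q = x ^+ q + y ^+ q.
Proof.
case: hq => p [e [pp e0 qE]].
have pK : p \in [pchar K] by apply: (@card_finPcharP _ p (e * 2)); rewrite // hK qE -expnM.
have pR := rmorph_pchar s pK.
by apply: exprDn_pchar; rewrite (eq_pnat _ (pcharf_eq pR)) qE pnatX pnat_id.
Qed.

Lemma frobeniusB (R : comNzRingType) (s : {rmorphism K -> R}) (x y : R) :
  (x - y) ^+ q = x ^+ q - y ^+ q.
Proof. by apply/eqP; rewrite eq_sym subr_eq -(frobenius s) subrK. Qed.

Lemma expq2 (a : K) : (a ^+ q) ^+ q = a.
Proof. by rewrite -exprM mulnn -hK expf_card. Qed.

(** Artin-Schreier polynomials with right hand side in the subfield of q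
    elements divide X ^ (q ^ 2) - X, hence split over K. *)
Lemma AS_split (b : K) : b ^+ q = b -> exists rs : seq K,
  [/\ uniq rs, size rs = q & 'X^q + 'X - b%:P = \prod_(r <- rs) ('X - r%:P)].
Proof.
move=> bq; set A := 'X^q + 'X - b%:P.
have mA : A \is monic by apply: monic_AS_poly q_gt1.
have AE : A ^+ q - A = 'X^#|K| - 'X.
  rewrite /A (frobeniusB polyC) (frobenius polyC) -exprM mulnn -hK -polyC_exp bq.
  by ring.
have Adv : A %| \prod_(a <- enum K) ('X - a%:P).
  rewrite big_enum /= -finField_genPoly -AE dvdp_subl // -(prednK (ltnW q_gt1)).
  by rewrite exprS dvdp_mulr.
have [m Am] := dvdp_prod_XsubC Adv; exists (mask m (enum K)).
have AE2 : A = \prod_(r <- mask m (enum K)) ('X - r%:P).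
  by apply/eqP; rewrite -eqp_monic ?monic_prod_XsubC.
split=> //; first by rewrite mask_uniq ?enum_uniq.
by apply: succn_inj; rewrite -(size_AS_poly b q_gt1) -/A AE2 size_prod_XsubC.
Qed.

Lemma AS_splitP (b : K) (rs : seq K) :
  'X^q + 'X - b%:P = \prod_(r <- rs) ('X - r%:P) -> forall r, (r \in rs) = (r ^+ q + r == b).
Proof. by move=> E r; rewrite -root_prod_XsubC -E /root !hornerE subr_eq0. Qed.

Definition Omega : {set K} := [set w | w ^+ q + w == 0].

Lemma Omega_AS w : w \in Omega -> w ^+ q + w = 0.
Proof. by rewrite inE => /eqP. Qed.

Lemma OmegaB a b : a \in Omega -> b \in Omega -> a - b \in Omega.
Proof.
rewrite !inE => /eqP ha /eqP hb; rewrite (frobeniusB idfun).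
have -> : a ^+ q - b ^+ q + (a - b) = (a ^+ q + a) - (b ^+ q + b) by ring.
by rewrite ha hb subrr.
Qed.

Lemma card_Omega : #|Omega| = q.
Proof.
have [|rs [urs szrs E]] := @AS_split 0; first by rewrite expr0n gtn_eqF ?(ltnW q_gt1).
have rsP := AS_splitP E; rewrite -szrs -(card_uniqP urs).
by apply: eq_card => w; rewrite inE rsP.
Qed.

Lemma Omega_sqr w : w \in Omega -> (w ^+ 2) ^+ q = w ^+ 2.
Proof.
move=> /Omega_AS /eqP; rewrite addr_eq0 => /eqP wq.
by rewrite -exprM mulnC exprM wq sqrrN.
Qed.

Lemma Omega_starE a : (a \in Omega_star q) = (a \in Omega) && (a != 0).
Proof. by rewrite !inE. Qed.

(** The polynomial X ^ q + X splits already over K. *)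
Lemma Omega_lift (C : closedFieldType) (kap : {rmorphism K -> C}) c :
  c ^+ q + c = 0 -> exists2 w, w \in Omega & c = kap w.
Proof.
move=> cq; have [|rs [urs szrs E]] := @AS_split 0; first by rewrite expr0n gtn_eqF ?(ltnW q_gt1).
have := congr1 (map_poly kap) E; rewrite rmorph_prod /= => E2.
have : root (\prod_(r <- map kap rs) ('X - r%:P)) c.
  rewrite big_map; under eq_bigr do rewrite -map_polyXsubC.
  rewrite -E2 /root polyC0 subr0 rmorphD /= map_polyXn map_polyX !hornerE.
  by rewrite cq eqxx.
rewrite root_prod_XsubC => /mapP[r rrs cr].
by exists r; rewrite // inE -(AS_splitP E).
Qed.

End Constants.

(** * Residues in the field of constants *)

Section RationalResidues.
Variables (q : nat) (K : finFieldType).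
Hypotheses (hq : prime_power q) (hK : #|K| = (q ^ 2)%N).
Variables (C F : fieldType) (k : C -> F) (P : place k) (kp : {rmorphism K -> F}).
Hypothesis Pkp : forall c, vring P (kp c).
Let q1 := q_gt1 hq.

Lemma cong_kp_eq u a b : maxid P (u - kp a) -> maxid P (u - kp b) -> a = b.
Proof.
move=> ma mb; apply/eqP; rewrite -subr_eq0; apply: contraT => ab.
case: (maxid_vunit _ (vunit_kappa Pkp ab)).
have <- : u - kp b - (u - kp a) = kp (a - b) by rewrite rmorphB; ring.
exact: maxidB.
Qed.

(** Over a point of K with nonzero trace, the next generator is again rational
    with nonzero trace: its trace is the norm divided by the trace. *)
Lemma residue_next y y' b : maxid P (y - kp b) -> b ^+ q + b != 0 ->
  y' ^+ q + y' = beta q y ->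
  exists b', [/\ maxid P (y' - kp b'), b' ^+ q + b' = beta q b & b' ^+ q + b' != 0].
Proof.
move=> my b0 yb.
have bn0 : b != 0.
  by apply: contraNneq b0 => ->; rewrite expr0n gtn_eqF ?addr0 // ltnW.
have b1 : b ^+ q.-1 + 1 != 0.
  apply: contraNneq b0; rewrite -{2}(prednK (ltnW q1)) exprS => E.
  by rewrite -[X in _ + X]mulr1 -mulrDr E mulr0.
have betab : beta q b = b ^+ q.+1 / (b ^+ q + b) by apply: beta_AS.
have bq : beta q b ^+ q = beta q b.
  have nq : (b ^+ q.+1) ^+ q = b ^+ q.+1 by rewrite exprS exprMn (expq2 hK) mulrC.
  have tq : (b ^+ q + b) ^+ q = b ^+ q + b.
    by rewrite (frobenius hq hK idfun) (expq2 hK) addrC.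
  by rewrite betab expr_div_n nq tq.
have mb : maxid P (y' ^+ q + y' - kp (beta q b)).
  rewrite yb /beta fmorph_div rmorphD !rmorphXn rmorph1.
  have m1 : maxid P (y ^+ q.-1 + 1 - (kp b ^+ q.-1 + 1)).
    by rewrite opprD addrACA subrr addr0; apply: congX.
  have u1 : vunit P (kp b ^+ q.-1 + 1).
    by rewrite -rmorphXn -(rmorph1 kp) -rmorphD; apply: vunit_kappa.
  apply: congM; [exact: vringX | by case/vunitV: u1 | exact: congX | exact: congV].
have [rs [urs szrs E]] := AS_split hq hK bq.
have := congr1 (fun p => (map_poly kp p).[y']) E.
rewrite /= rmorphB rmorphD /= map_polyXn map_polyX map_polyC /= !hornerE.
rewrite rmorph_prod horner_prod => Ey; rewrite Ey in mb.
have Py' : vring P y'.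
  apply: (AS_vring q1); rewrite -[_ + _](subrK (kp (beta q b))) Ey.
  by apply: vringD => //; apply: maxid_vring.
have [|r rrs mr] := maxid_prod _ mb.
  by move=> r _ /=; rewrite map_polyXsubC hornerXsubC; apply: vringB.
rewrite /= map_polyXsubC hornerXsubC in mr.
have rb : r ^+ q + r = beta q b by apply/eqP; rewrite -(AS_splitP E).
exists r; split=> //; rewrite rb betab mulf_neq0 ?invr_eq0 ?expf_neq0 //.
Qed.

Lemma residue_horner (p : {poly F}) y b : maxid P (y - kp b) ->
  (forall i, exists c, maxid P (p`_i - kp c)) -> exists c, maxid P (p.[y] - kp c).
Proof.
move=> my; elim/poly_ind: p => [|p c IH] H.
  by exists 0; rewrite horner0 rmorph0 subrr; apply: maxid0.
have [|d md] := IH; first by move=> i; have := H i.+1; rewrite coefD coefMX coefC /= addr0.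
have [d0 md0] := H 0%N; rewrite coefD coefMX coefC /= add0r in md0.
exists (d * b + d0); rewrite !hornerE rmorphD rmorphM opprD addrACA.
by apply: maxidD => //; apply: congM.
Qed.

Lemma horner_near (p : {poly K}) y z : vring P z -> maxid P (y - z) ->
  maxid P ((map_poly kp p).[y] - (map_poly kp p).[z]).
Proof.
move=> Pz myz; elim/poly_ind: p => [|p c IH].
  by rewrite rmorph0 !horner0 subrr; apply: maxid0.
rewrite rmorphD rmorphM /= map_polyX map_polyC !hornerE opprD addrACA subrr addr0.
by apply: congM => //; apply: vring_horner => // i; rewrite coef_map; apply: Pkp.
Qed.

Lemma cong_horner (p : {poly K}) y b : maxid P (y - kp b) ->
  maxid P ((map_poly kp p).[y] - kp p.[b]).
Proof. by move=> my; rewrite -horner_map; apply: horner_near. Qed.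

End RationalResidues.

(** * Substitutions for the variable *)

Section Substitution.
Variables (K : finFieldType) (C : closedFieldType) (kap : {rmorphism K -> C}).
Variables (q : nat) (LM : local_model C q).
Let L := big_field LM.
Let W := big_place LM.
Let t : L := unif LM.
Let kp : {rmorphism K -> L} := kappa LM kap.

Definition transcendental (z : L) := forall p : {poly K}, p != 0 -> (map_poly kp p).[z] != 0.

Definition is_subst (iota : {rmorphism rat_funs K -> L}) (z : L) :=
  forall p, iota (tofrac p) = (map_poly kp p).[z].

Lemma substitution_exists z : transcendental z ->
  exists iota, is_subst iota z.
Proof.
move=> tz; pose phi : {rmorphism {poly K} -> L} := (horner_eval z \o map_poly kp)%FUN.
have [|iota H] := @fraction_lift {poly K} L phi; last by exists iota.
apply: raddf_inj => p /eqP; apply: contraTeq => p0; exact: tz.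
Qed.

Lemma horner_cemb (p : {poly K}) c :
  (map_poly kp p).[cemb LM c] = cemb LM (map_poly kap p).[c].
Proof. by rewrite -horner_map /= -map_poly_comp. Qed.

Lemma horner_finite p c :
  maxid W ((map_poly kp p).[cemb LM c + t] - cemb LM (map_poly kap p).[c]).
Proof.
rewrite -horner_cemb; apply: horner_near; [exact: vring_kappa | exact: vring_const1 |].
by rewrite addrAC subrr add0r; apply: unif_max.
Qed.

Lemma transcendental_finite c : transcendental (cemb LM c + t).
Proof.
move=> p p0.
have -> : (map_poly kp p).[cemb LM c + t] =
   (map_poly (cemb LM) (map_poly kap p \Po ('X + c%:P))).[t].
  rewrite map_comp_poly rmorphD /= map_polyX map_polyC horner_comp !hornerE.
  by rewrite -map_poly_comp addrC.
apply: unif_tr; rewrite comp_poly2_eq0 ?map_poly_eq0 //.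
by rewrite size_XaddC.
Qed.

Lemma horner_infinite (p : {poly K}) : p != 0 ->
  vunit W ((map_poly kp p).[t^-1] * t ^+ (size p).-1).
Proof.
move=> p0; have t0 : t != 0 := t_neq0 LM.
have [n sp] : exists n, size p = n.+1.
  by exists (size p).-1; rewrite prednK // lt0n size_poly_eq0.
rewrite horner_coef size_map_poly sp /= mulr_suml big_ord_recr /= addrC.
apply: vunitDm.
  rewrite -mulrA -exprMn mulVf // expr1n mulr1 coef_map.
  by apply: kappa_unit; rewrite -[n]/(n.+1.-1) -sp -lead_coefE lead_coef_eq0.
apply: maxid_sum => i _; rewrite -mulrA coef_map; apply: maxidMl; first exact: vring_kappa.
have -> : t ^+ n = t ^+ i * t ^+ (n - i) by rewrite -exprD subnKC // ltnW.
rewrite mulrA -exprMn mulVf // expr1n mul1r.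
by apply: maxidX; [rewrite subn_gt0 | apply: unif_max].
Qed.

Lemma transcendental_infinite : transcendental t^-1.
Proof.
move=> p p0; apply: contraTneq (vunit_neq0 (horner_infinite p0)) => ->.
by rewrite mul0r eqxx.
Qed.

Lemma substitution_unram z (iota : {rmorphism rat_funs K -> L}) :
  is_subst iota z -> unram z -> forall f, unram (iota f).
Proof.
move=> iE Uz.
have Up p : unram (map_poly kp p).[z].
  elim/poly_ind: p => [|p c IH]; first by rewrite rmorph0 horner0; apply: U0.
  rewrite rmorphD rmorphM /= map_polyX map_polyC !hornerE.
  by apply: UD; [apply: UM | apply: Ukappa].
move=> f; have [A [B [_ ->]]] := fractionP f; rewrite fmorph_div !iE.
by apply: UM; [apply: Up | apply/UV/Up].
Qed.

End Substitution.

(** * Normalized valuations and coefficients of divisors *)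

Section Valuation.
Variables (K F : fieldType) (emb : K -> F) (P : place emb).

Lemma prime_elementP w : maxid P w -> w != 0 ->
  (forall z, maxid P z -> vring P (z / w)) -> prime_element P w.
Proof.
move=> mw w0 H; apply/seteqP; split=> z.
  by move=> mz; exists (z / w); [apply: H | rewrite mulrC divfK].
by move=> [y Py <-]; apply: maxidMr.
Qed.

Lemma prime_maxid w : prime_element P w -> maxid P w.
Proof. by move=> ->; exists 1; [apply: vring1 | rewrite mulr1]. Qed.

(** The value does not depend on the prime element, since two prime elements
    differ by a unit. *)
Lemma val_eq w z n : prime_element P w -> w != 0 -> vunit P (z / w ^ n) -> Defs.val P z = n.
Proof.
move=> pw w0 un; have mw := prime_maxid pw.
apply: xget_unique.
  by exists w, (z / w ^ n); split=> //; rewrite mulrC divfK ?expfz_neq0.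
move=> k [t [u [pt uu zE]]]; have mt := prime_maxid pt.
have : maxid P t by []; rewrite {1}pw => -[y Py tE].
have : maxid P w by []; rewrite {1}pt => -[y' Py' wE].
have y'0 : y' != 0 by apply: contraNneq w0 => y0; rewrite -wE y0 mulr0.
have y0 : y != 0 by apply: contraNneq w0 => y0; rewrite -wE -tE y0 mulr0 mul0r.
have uy : vunit P y.
  split=> //; have -> : y^-1 = y'; last by [].
  by apply: (mulfI y0); rewrite mulfV //; apply: (mulfI w0); rewrite mulr1 mulrA tE wE.
apply: (ord_uniq w0 mw (z := z)) => //.
have -> : z / w ^ k = y ^ k * u.
  by rewrite zE -tE expfzMl; field; rewrite expfz_neq0.
by apply: vunitM => //; apply: vunitXz.
Qed.

Lemma val_spec z : Defs.val P z != 0 -> exists t u,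
  [/\ prime_element P t, vunit P u & z = t ^ Defs.val P z * u].
Proof.
rewrite /Defs.val; case: xgetP => [n -> [t [u H]] _|_]; first by exists t, u.
by rewrite eqxx.
Qed.

Lemma is_zero_maxid z : is_zero P z -> maxid P z.
Proof.
move=> [z0 vz]; have [|t [u [pt uu zE]]] := @val_spec z; first by rewrite gt_eqF.
rewrite zE; case: (Defs.val P z) vz {zE} => // -[|n] // _.
by apply: maxidMr; [case: uu | apply: maxidX => //; apply: prime_maxid].
Qed.

Lemma is_pole_maxid z : is_pole P z -> maxid P z^-1.
Proof.
move=> [z0 vz]; have [|t [u [pt uu zE]]] := @val_spec z; first by rewrite lt_eqF.
rewrite zE invfM; case: (Defs.val P z) vz {zE} => // n _.
rewrite NegzE -exprnN invrK.
by apply: maxidMr; [case/vunitV: uu | apply: maxidX => //; apply: prime_maxid].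
Qed.

End Valuation.

Section FiniteSupportSums.
Variables (K F : fieldType) (emb : K -> F).
Local Notation divisor := {freeg (place emb)}.

Lemma coeff_sum_fset (X : {fset place emb}) (f : place emb -> int) Q :
  coeff Q (\sum_(P <- X) << f P *g P >> : divisor) = if Q \in X then f Q else 0.
Proof.
rewrite raddf_sum /=; under eq_bigr do rewrite coeffU; case: ifP => QX.
  rewrite (big_rem Q) //= eqxx mulr1 big_seq big1 ?addr0 // => R.
  by rewrite mem_rem_uniq ?fset_uniq // inE => /andP[/negbTE -> _]; rewrite mulr0.
rewrite big_seq big1 // => R RX.
by case: eqP => [E|_]; [rewrite -E RX in QX | rewrite mulr0].
Qed.

(** The default value 0 of sums with infinite support only makes the
    coefficients smaller in absolute value. *)
Lemma coeff_fsum (A : set (place emb)) (f : place emb -> int) Q :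
  coeff Q (\sum_(P \in A) << f P *g P >> : divisor) = 0 \/
  (A Q /\ coeff Q (\sum_(P \in A) << f P *g P >> : divisor) = f Q).
Proof.
case: finite_supportP => [_|X XA _ _]; first by left; rewrite big_nil coeff0.
by rewrite coeff_sum_fset; case: ifP => [/XA|_]; [right | left].
Qed.

Lemma coeff_fsum_finite (A : set (place emb)) (f : place emb -> int) Q :
  finite_set A -> A Q ->
  coeff Q (\sum_(P \in A) << f P *g P >> : divisor) = f Q.
Proof.
move=> finA AQ; case: finite_supportP => [infA|X XA Xout _].
  by exfalso; apply: infA; apply: sub_finite_set finA => ? [].
rewrite coeff_sum_fset; case: ifP => // /negbT QX.
by have := congr1 (coeff Q) (Xout Q AQ QX); rewrite coeffU eqxx mulr1 coeff0.
Qed.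

Lemma coeff_zero_divisor z Q : coeff Q (zero_divisor emb z) = 0 \/
  (is_zero Q z /\ coeff Q (zero_divisor emb z) = Defs.val Q z).
Proof. exact: (coeff_fsum [set P | is_zero P z] (fun P => Defs.val P z)). Qed.

Lemma coeff_sum_of_zeros z Q : coeff Q (sum_of_zeros emb z) = 0 \/
  (is_zero Q z /\ coeff Q (sum_of_zeros emb z) = 1).
Proof. exact: (coeff_fsum [set P | is_zero P z] (fun=> 1)). Qed.

End FiniteSupportSums.

Lemma sum_at_most_one (I : eqType) (r : seq I) (A : pred I) (f : I -> int) (b : int) :
  uniq r -> 0 <= b -> (forall i, A i -> f i <= b) ->
  (forall i j, A i -> A j -> f i != 0 -> f j != 0 -> i = j) ->
  \sum_(i <- r | A i) f i <= b.
Proof.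
move=> ur b0 fb funiq.
have [/hasP[i ir /andP[Ai fi]]|/hasPn none] := boolP (has (fun i => A i && (f i != 0)) r).
  rewrite (big_rem i) //= Ai big_seq_cond big1 ?addr0 ?fb // => j.
  rewrite mem_rem_uniq // inE => /andP[/andP[ji _] Aj].
  by apply: contraNeq ji => fj; apply/eqP; apply: funiq.
rewrite big_seq_cond big1 // => i /andP[/none + Ai].
by rewrite Ai negbK => /eqP.
Qed.

Section Pullback.
Variables (K F : fieldType) (emb : K -> F) (C L : fieldType) (k : C -> L) (W : place k).
Variable s : {rmorphism F -> L}.

(** P is the place induced on F by s and W. *)
Definition pulled (P : place emb) := forall z, vring P z <-> vring W (s z).

Lemma pullback_exists : emb 0 = 0 -> (forall c, emb c^-1 = (emb c)^-1) ->
  (forall c, vring W (s (emb c))) -> (exists a, ~ vring W (s a)) ->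
  exists P, pulled P.
Proof.
move=> e0 eV We [a nWa]; have [ma _] := pole_inv nWa.
pose V := [set z | vring W (s z)].
have h1 : V 1 by rewrite /V /= rmorph1; apply: vring1.
have h2 y z : V y -> V z -> V (y - z) by rewrite /V /= rmorphB; apply: vringB.
have h3 y z : V y -> V z -> V (y * z) by rewrite /V /= rmorphM; apply: vringM.
have h4 : range emb `<` V.
  split; first by move=> _ [c _ <-]; apply: We.
  have Va : V a^-1 by rewrite /V /= fmorphV; apply: maxid_vring.
  move=> /(_ _ Va)[c _ ca]; apply: nWa; rewrite -[a]invrK -ca -eV; exact: We.
have h5 : V `<` setT by split=> // /(_ a I).
have h6 z : V z \/ V z^-1 by rewrite /V /= fmorphV; apply: vringV.
by exists (Place h1 h2 h3 h4 h5 h6).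
Qed.

Variable P : place emb.
Hypothesis PW : pulled P.

Lemma pulled_maxid z : maxid P z <-> maxid W (s z).
Proof.
split=> /maxidP H; apply/maxidP; case: H => [z0|H].
- by left; rewrite z0 rmorph0.
- by right=> H2; apply: H; apply/PW; rewrite fmorphV.
- by left; apply/eqP; rewrite -(fmorph_eq0 s) z0.
- by right=> /PW; rewrite fmorphV.
Qed.

Lemma pulled_vunit z : vunit P z <-> vunit W (s z).
Proof. by rewrite !vunitE pulled_maxid PW. Qed.

Lemma pulled_val w : maxid W (s w) -> w != 0 ->
  (forall z, z != 0 -> exists n : int, vunit W (s z / s w ^ n)) ->
  prime_element P w /\ forall z (n : int), vunit W (s z / s w ^ n) -> Defs.val P z = n.
Proof.
move=> mw w0 ord; have sw0 : s w != 0 by rewrite fmorph_eq0.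
have pw : prime_element P w.
  apply: prime_elementP => //; first exact/pulled_maxid.
  move=> z /pulled_maxid mz; apply/PW; rewrite fmorph_div.
  have [->|z0] := eqVneq z 0; first by rewrite rmorph0 mul0r; apply: vring0.
  by have [n un] := ord z z0; apply: ord_divr un mz.
split=> // z n un; apply: (val_eq pw w0).
by apply/pulled_vunit; rewrite fmorph_div fmorphXz.
Qed.

Lemma pulled_bound w z (b : int) : maxid W (s w) -> w != 0 ->
  (forall z, z != 0 -> exists n : int, vunit W (s z / s w ^ n)) ->
  z = 0 \/ - b <= Defs.val P z -> vring W (s z * s w ^ b).
Proof.
move=> mw w0 ord; have [pw vE] := pulled_val mw w0 ord.
have sw0 : s w != 0 by rewrite fmorph_eq0.
have [->|z0] := eqVneq z 0; first by rewrite rmorph0 mul0r => _; apply: vring0.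
have [n un] := ord z z0; rewrite (vE _ _ un) => -[/eqP|nb]; first by rewrite (negbTE z0).
by apply/(ord_vring sw0 mw (ord_shift b sw0 un)); lia.
Qed.

End Pullback.

Section DiscretePullback.
Variables (K F : fieldType) (emb : K -> F).
Variables (C : closedFieldType) (q : nat) (LM : local_model C q).
Let W := big_place LM.
Let t := unif LM.
Let t0 : t != 0 := t_neq0 LM.
Let mt : maxid W t := maxid_t LM.
Variable s : {rmorphism F -> big_field LM}.
Hypothesis Us : forall z, unram (s z).

(** The values of s form a nonzero subgroup of the integers; a prime element
    is an element whose value is the least positive one. *)
Lemma pulled_discrete (P : place emb) : pulled W s P -> (exists a, ~ vring W (s a)) ->
  exists w, [/\ maxid W (s w), w != 0 &
    forall z, z != 0 -> exists n : int, vunit W (s z / s w ^ n)].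
Proof.
move=> PW [a nWa]; have ord z : z != 0 -> exists n : int, vunit W (s z / t ^ n).
  by move=> z0; apply: unram_ord; rewrite ?fmorph_eq0.
pose pos n := `[< (0 < n)%N /\ exists w, vunit W (s w / t ^+ n) >].
have expos : exists n, pos n.
  have [ma sa0] := pole_inv nWa.
  have a0 : a^-1 != 0 by rewrite invr_eq0 -(fmorph_eq0 s).
  have [n un] := ord _ a0; rewrite -fmorphV in ma.
  have := ord_maxid t0 mt un; move=> [/(_ ma) n0 _].
  by case: n n0 un => // n n0 un; exists n; apply/asboolP; split=> //; exists a^-1.
case: (ex_minnP expos) => d /asboolP[d0 [w uw]] dmin.
have sw0 : s w != 0 by apply: contraTneq (vunit_neq0 uw) => ->; rewrite mul0r eqxx.
exists w; split.
- by apply/(ord_maxid (n := d%:Z) t0 mt uw).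
- by rewrite -(fmorph_eq0 s).
move=> z z0; have [n un] := ord z z0.
exists (n %/ d)%Z.
have ur : vunit W (s (z / w ^ (n %/ d)%Z) / t ^ (n %% d)%Z).
  have tn : t ^ n = (t ^+ d) ^ (n %/ d)%Z * t ^ (n %% d)%Z.
    by rewrite exprnP exprz_exp -expfzDr // [(d : int) * _]mulrC -divz_eq.
  have -> : s (z / w ^ (n %/ d)%Z) / t ^ (n %% d)%Z =
     s z / t ^ n * ((s w / t ^+ d) ^ (n %/ d)%Z)^-1.
    rewrite fmorph_div fmorphXz expfzMl exprz_inv -invr_expz tn.
    by field; rewrite !expfz_neq0 ?expf_neq0.
  by apply: vunitM => //; apply/vunitV/vunitXz.
have rd : (n %% d)%Z = 0.
  have r0 : 0 <= (n %% d)%Z by apply: modz_ge0; rewrite gt_eqF.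
  have rlt : (n %% d)%Z < d%:Z by apply: ltz_pmod.
  case: (n %% d)%Z r0 rlt ur => // -[|r] // _ rlt ur; exfalso.
  have : pos r.+1 by apply/asboolP; split=> //; exists (z / w ^ (n %/ d)%Z).
  by move/dmin; rewrite leqNgt => /negP; apply; rewrite ltz_nat in rlt.
by move: ur; rewrite rd expr0z divr1 fmorph_div fmorphXz.
Qed.

End DiscretePullback.

(** * Rational functions and power sums *)

Lemma cancel_power (F : fieldType) (A B Y : F) i j : Y != 0 -> (j <= i)%N ->
  A * Y ^+ i / (B * Y ^+ j) = A * Y ^+ (i - j) / B.
Proof.
move=> Y0 ji; have -> : Y ^+ i = Y ^+ (i - j) * Y ^+ j by rewrite -exprD subnK.
by rewrite mulrA -mulf_div divff ?mulr1 // expf_neq0.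
Qed.

(** Up to a constant factor the sum is the coefficient of degree #|K| - 1 of the
    polynomial that interpolates p at all points of K, which is p itself. *)
Lemma sum_horner0 (K : finFieldType) (p : {poly K}) : (size p < #|K|)%N ->
  \sum_(a : K) p.[a] = 0.
Proof.
move=> sp; have := @lagrange_top K K idfun [set: K] _ p 0.
rewrite cardsT => /(_ (fun _ _ _ _ => finset.in_setT _) (ltnW sp)).
rewrite nth_default ?mulr0; last by rewrite -ltnS prednK // (leq_trans _ sp).
move=> E; rewrite [RHS]E; apply: eq_big => [a|a _]; rewrite ?finset.in_setT ?add0r //.
Qed.

Section PoleFree.
Variables (K : finFieldType) (C : closedFieldType) (kap : {rmorphism K -> C}).
Variables (q : nat) (LM : local_model C q).
Let L := big_field LM.
Let W := big_place LM.
Let t : L := unif LM.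
Let t0 : t != 0 := t_neq0 LM.
Let mt : maxid W t := maxid_t LM.
Let kp : {rmorphism K -> L} := kappa LM kap.

(** A nonconstant denominator in lowest terms vanishes at some c in the algebraic
    closure, where the numerator does not. *)
Lemma pole_free (h : rat_funs K) :
  (forall c (iota : {rmorphism rat_funs K -> L}),
     is_subst kap iota (cemb LM c + t) -> vring W (iota h)) ->
  exists N, h = tofrac N.
Proof.
move=> Wh; have [A [B [B0 hE]]] := fractionP h.
pose g := gcdp A B; have g0 : g != 0 by rewrite gcdp_eq0 negb_and B0 orbT.
pose A' := A %/ g; pose B' := B %/ g.
have AE : A = A' * g by rewrite divpK ?dvdp_gcdl.
have BE : B = B' * g by rewrite divpK ?dvdp_gcdr.
have B'0 : B' != 0 by apply: contraNneq B0 => B'0; rewrite BE B'0 mul0r.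
have cop : coprimep A' B' by apply: coprimep_div_gcd; rewrite B0 orbT.
have hE' : h * tofrac B' = tofrac A'.
  have gF : (tofrac g : rat_funs K) != 0 by rewrite tofrac_eq0.
  have BF : (tofrac B : rat_funs K) != 0 by rewrite tofrac_eq0.
  apply: (mulIf gF); rewrite -mulrA -!tofracM -AE -BE hE divfK //.
have [s1|s1] := eqVneq (size B') 1%N.
  move/eqP/size_poly1P: s1 => [b b0 BbE]; exists (b^-1 *: A').
  have bF : (tofrac b%:P : rat_funs K) != 0.
    by rewrite tofrac_eq0 polyC_eq0.
  apply: (mulIf bF); rewrite -{1}BbE hE' -tofracM; congr tofrac.
  by rewrite mulrC mul_polyC scalerA mulfV // scale1r.
have [c rc] : exists c, root (map_poly kap B') c.
  by apply/closed_rootP; rewrite size_map_poly.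
have [iota iz] := substitution_exists (@transcendental_finite K C kap q LM c).
have mB : maxid W (iota (tofrac B')).
  rewrite iz; have := horner_finite kap LM B' c.
  by rewrite (rootP rc) rmorph0 subr0.
have rA : ~~ root (map_poly kap A') c.
  by apply: (coprimep_root (p := map_poly kap B')) => //; rewrite coprimep_map coprimep_sym.
have uA : vunit W (iota (tofrac A')).
  apply: cong_unit (_ : maxid W (_ - cemb LM (map_poly kap A').[c])).
    split; rewrite ?fmorph_eq0 // -?fmorphV; exact: vring_const1.
  by rewrite iz; apply: horner_finite.
case: (maxid_vunit _ uA); rewrite -hE' rmorphM; apply: maxidMl => //.
exact: Wh iz.
Qed.

End PoleFree.

(** * The divisor on the tower *)

(** With e the ramification index above x_1, the right hand side is the order
    (q - 2) e of the factor by which the trace is multiplied plus the exponent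
    2 (e - 1) of the different; q e is q ^ m for the places that are totally
    ramified in the whole tower. *)
Lemma degree_bound_total (q e : nat) (a : int) : (1 < q)%N -> (0 < e)%N ->
  a *+ 2 <= (q * e)%N%:Z - 2 -> a *+ 2 <= ((q - 2) * e)%N%:Z + e.-1.*2%:Z.
Proof.
case: q => [|[|q]] // _; case: e => // e _ /le_trans; apply.
by rewrite -!addnn !subSS subn0 !PoszM /=; lia.
Qed.

(** At the ramified places above the zero of x_1 the divisor has the coefficient
    a + b e, with b the coefficient of the zero divisor of x_1. *)
Lemma degree_bound_pivot (q e : nat) (a b : int) : (1 < q)%N -> (0 < e)%N ->
  a <= e%:Z - 1 -> b *+ 2 <= q%:Z - 2 ->
  (a + b * e%:Z) *+ 2 <= ((q - 2) * e)%N%:Z + e.-1.*2%:Z.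
Proof.
case: q => [|[|q]] // _; case: e => // e _ ae bq.
have bq' : b *+ 2 <= q%:Z by lia.
rewrite mulrnDl addrC; apply: lerD; last by lia.
by rewrite -mulrnAl !subSS subn0 PoszM; apply: ler_wpM2r.
Qed.

(** This is [constT], with its structure of a ring homomorphism. *)
Definition cT (K : finFieldType) (T : fieldExtType (rat_funs K)) : {rmorphism K -> T} :=
  (in_alg T \o (@FracField.tofrac {poly K}) \o polyC)%FUN.

Section GSTower.
Variables (q m : nat) (K : finFieldType) (T : fieldExtType (rat_funs K)) (x : nat -> T).
Hypotheses (hq : prime_power q) (hK : #|K| = (q ^ 2)%N) (hm : (2 <= m)%N).
Hypothesis hT : GS_tower q m x.

Definition gen n := x n.+1.
Let M := m.-1.
Let q1 : (1 < q)%N := q_gt1 hq.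
Let OmB := @OmegaB q K hq hK.
Let cardOm := @card_Omega q K hq hK.
Let OmAS := @Omega_AS q K.

Lemma gen0 : gen 0 = (X1 K)%:A. Proof. by case: hT. Qed.

Lemma genS n : (n < M)%N -> gen n.+1 ^+ q + gen n.+1 = beta q (gen n).
Proof. by case: hT => _ H _ nM; apply: H; rewrite /M in nM; lia. Qed.

Lemma tower_seq n : tower gen n = <<1 & [seq x i | i <- seq.iota 2 n]>>%VS :> {vspace T}.
Proof.
elim: n => [|n IH]; first by rewrite /= Fadjoin_nil.
have -> : seq.iota 2 n.+1 = rcons (seq.iota 2 n) n.+2.
  by rewrite -cats1 -{1}[n.+1]addn1 iotaD.
by rewrite map_rcons adjoin_rcons -IH.
Qed.

Lemma tower_full : tower gen M = fullv :> {vspace T}.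
Proof. by case: hT => _ _ <-; apply: tower_seq. Qed.

Lemma mem_tower z : z \in tower gen M.
Proof. by rewrite tower_full memvf. Qed.

Lemma lam_scale n (c : rat_funs K) f : f \in tower gen n.+1 ->
  lam q gen n (c%:A * f) = c%:A * lam q gen n f.
Proof.
move=> Ef; rewrite /lam -coefZ; congr (_ : {poly T})`_ _.
apply: Fadjoin_poly_unique.
- by apply: polyOverZ; [rewrite rpredZ ?rpred1 | apply: Fadjoin_polyOver].
- by rewrite (leq_trans (size_scale_leq _ _)) // size_Fadjoin_poly.
- by rewrite hornerZ Fadjoin_poly_eq.
Qed.

Lemma itrace_scale i (c : rat_funs K) f : (i <= M)%N ->
  itrace q M gen i (c%:A * f) = c%:A * itrace q M gen i f.
Proof.
elim: i => [|i IH] // iM; rewrite /= -/(itrace _ _ _) IH ?(ltnW iM) // lam_scale //.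
have -> : (M - i.+1).+1 = (M - i)%N by lia.
by apply: itrace_tower; apply: mem_tower.
Qed.

Variables (C : closedFieldType) (kap : {rmorphism K -> C}) (LM : local_model C q).
Let L := big_field LM.
Let W := big_place LM.
Let t : L := unif LM.
Let t0 : t != 0 := t_neq0 LM.
Let mt : maxid W t := maxid_t LM.
Let kp : {rmorphism K -> L} := kappa LM kap.
Let frobL := frobenius hq hK kp.
Let Wkp : forall c, vring W (kp c) := vring_kappa LM kap.

Local Notation is_subst := (is_subst kap).

Section Subst.
Variables (iota : {rmorphism rat_funs K -> L}) (z : L).
Hypothesis iz : is_subst iota z.

Lemma subst_const c : iota (const1 c) = kp c.
Proof. by rewrite iz map_polyC hornerC. Qed.

Lemma subst_X : iota (X1 K) = z.
Proof. by rewrite iz map_polyX hornerX. Qed.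

Lemma lhom_const n s c : lhom gen iota n s -> s (constT T c) = kp c.
Proof. by case=> _ H; rewrite H subst_const. Qed.

Lemma lhom_gen0 n s : lhom gen iota n s -> s (gen 0) = z.
Proof. by case=> _ H; rewrite gen0 H subst_X. Qed.

Lemma lhom_full s : lhom gen iota M s -> exists r : {rmorphism T -> L}, s = r.
Proof.
case=> -[s1 sB sM] _.
have fB : zmod_morphism s by move=> u v; rewrite sB ?mem_tower.
have fM : monoid_morphism s by split=> // u v; rewrite sM ?mem_tower.
pose fz := GRing.isZmodMorphism.Build _ _ s fB.
pose fm := GRing.isMonoidMorphism.Build _ _ s fM.
by exists (HB.pack s fz fm : {rmorphism _ -> _}).
Qed.

End Subst.

(** At infinity [beta] has a simple pole from the beginning. *)
Lemma infinite_start : exists iota s, [/\ is_subst iota t^-1,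
  lhomU gen iota 0 s & vunit W (beta q (s (gen 0)) * t)].
Proof.
have [iota iz] := substitution_exists (@transcendental_infinite K C kap q LM).
have [s hs] := lhom0_exists gen iota.
exists iota, s; split=> //.
  apply: lhomU0 => //; apply: substitution_unram iz _.
  exact/unramV/unram_unif.
rewrite (lhom_gen0 iz hs) -[X in _ * X]invrK.
exact: (beta_pole q1 (inv_pole t0 mt)).
Qed.

(** Every step of the tower has degree q, because of the place at infinity. *)
Lemma deg_gen n : (n < M)%N -> adjoin_degree (tower gen n) (gen n.+1) = q.
Proof.
move=> nM; have [iota [s [iz hs us]]] := infinite_start.
have {hs us} rs := ramified_start hs us.
have : exists s, ramified gen iota n s; last first.
  by move=> [s' rs']; apply: (ramified_degree q1 gen0 genS nM rs').
elim: n nM => [|n IH] nM; first by exists s.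
have [s' rs'] := IH (ltnW nM); have hs' : lhom gen iota n s' by case: rs'.
have [y [_ yb]] := root_of_min gen0 genS (ltnW nM) hs'.
have [rs2 _ _ _] := ramified_step q1 gen0 genS (ltnW nM) rs' yb.
by eexists; apply: rs2.
Qed.

(** ** The coefficients of the divisor *)

Variables (Pinf : place (constT T)) (Pa : K -> place (constT T)).
Hypothesis hPinf : exists P : place (@const1 K), is_pole P (X1 K) /\ lies_above Pinf P.
Hypothesis hPa : forall a : K, a \in Omega_star q ->
  exists P : place (@const1 K), is_zero P (X1 K - const1 a) /\ lies_above (Pa a) P.
Variables (v : K -> int) (wt : nat -> K -> int) (v0 vinf : int).
Hypothesis hv : forall a : K, a \in Omega_star q ->
  0 <= v a /\ (v a)%:Q <= ((q ^ m)%N%:Q - 2) / 2.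
Hypothesis hw : forall (a : K) (k : nat), a \in Omega_star q -> (1 <= k <= (m - 2)./2)%N ->
  0 <= wt k a <= (q ^ (m - 2 * k - 1))%N%:Z - 1.
Hypothesis hv0 : 0 <= v0 /\ v0%:Q <= (q%:Q - 2) / 2.
Hypothesis hvinf : 0 <= vinf /\ vinf%:Q <= ((q ^ m)%N%:Q - 2) / 2.

Definition G : {freeg (place (constT T))} :=
    \sum_(a : K | a \in Omega_star q) << v a *g Pa a >>
    + \sum_(1 <= k < (m - 2)./2.+1) \sum_(a : K | a \in Omega_star q)
        A_div x k a *~ wt k a
    + zero_divisor (constT T) (x 1%N) *~ v0
    + << vinf *g Pinf >>.

Lemma maxid_Pa a : a \in Omega_star q -> maxid (Pa a) (gen 0 - constT T a).
Proof.
move=> /hPa[P [/is_zero_maxid zP /(_ _ zP)]].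
by rewrite scalerBl -gen0.
Qed.

Lemma pole_Pinf : ~ vring Pinf (gen 0).
Proof.
have [P [pP ab]] := hPinf; have /ab := is_pole_maxid pP.
have x0 : gen 0 != 0.
  by case: pP => X10 _; rewrite gen0 scaler_eq0 oner_eq0 orbF.
have -> : (X1 K)^-1%:A = (gen 0)^-1 by rewrite gen0 -(fmorphV (in_alg T)).
move/inv_pole; rewrite invrK; apply; first by rewrite invr_eq0.
Qed.

Lemma residue_uniq (P : place (constT T)) z a b :
  maxid P (z - constT T a) -> maxid P (z - constT T b) -> a = b.
Proof. by apply: (cong_kp_eq (kp := cT T)) => c; apply: vring_const1. Qed.

(** Only upper bounds on the coefficients of G are needed, and a place lies on at
    most one of the summands of each kind. *)
Lemma coefG_le (Q : place (constT T)) (bv bw b0 binf : int) :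
  0 <= bv -> 0 <= bw -> 0 <= b0 -> 0 <= binf ->
  (forall a, a \in Omega_star q -> maxid Q (gen 0 - constT T a) -> v a <= bv) ->
  (forall k a, (1 <= k <= (m - 2)./2)%N -> a \in Omega_star q ->
     maxid Q (gen k - constT T a) -> wt k a <= bw) ->
  (forall k a k' a', (1 <= k <= (m - 2)./2)%N -> (1 <= k' <= (m - 2)./2)%N ->
     a \in Omega_star q -> a' \in Omega_star q ->
     maxid Q (gen k - constT T a) -> maxid Q (gen k' - constT T a') -> k = k') ->
  (maxid Q (gen 0) -> v0 * Defs.val Q (gen 0) <= b0) ->
  (~ vring Q (gen 0) -> vinf <= binf) ->
  coeff Q G <= bv + bw + b0 + binf.
Proof.
move=> bv0 bw0 b00 binf0 Hv Hw Hk H0 Hinf.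
rewrite /G !coeffD; apply: lerD; last first.
  rewrite coeffU; case: eqP => [E|_]; last by rewrite mulr0.
  by rewrite mulr1; apply: Hinf; rewrite -E; apply: pole_Pinf.
apply: lerD; last first.
  rewrite raddfMz mulrzz mulrC /=.
  case: (coeff_zero_divisor (x 1%N) Q) => [->|[zQ ->]]; first by rewrite mulr0.
  by apply: H0; apply: is_zero_maxid.
apply: lerD.
  rewrite raddf_sum; apply: sum_at_most_one => //; first exact: index_enum_uniq.
    move=> a Sa /=; rewrite coeffU; case: eqP => [E|_]; last by rewrite mulr0.
    by rewrite mulr1; apply: Hv; rewrite // -E; apply: maxid_Pa.
  move=> a b Sa Sb /=; rewrite !coeffU.
  case: (Pa a =P Q) => [Ea _|_]; last by rewrite mulr0 eqxx.
  case: (Pa b =P Q) => [Eb _|_]; last by rewrite mulr0 eqxx.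
  apply: (@residue_uniq Q (gen 0)).
    by rewrite -Ea; apply: maxid_Pa.
  by rewrite -Eb; apply: maxid_Pa.
pose f k a := coeff Q (A_div x k a *~ wt k a).
have f1 k a : f k a = 0 \/ maxid Q (gen k - constT T a) /\ f k a = wt k a.
  rewrite /f raddfMz mulrzz /A_div /=.
  case: (coeff_sum_of_zeros (x k.+1 - constT T a) Q) => [->|[zQ ->]].
    by left; rewrite mul0r.
  by right; rewrite mul1r; split=> //; apply: is_zero_maxid.
pose A k := (1 <= k <= (m - 2)./2)%N.
have -> : coeff Q (\sum_(1 <= k < (m - 2)./2.+1) \sum_(a : K | a \in Omega_star q)
    A_div x k a *~ wt k a) = \sum_(1 <= k < (m - 2)./2.+1 | A k)
      \sum_(a : K | a \in Omega_star q) f k a.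
  rewrite raddf_sum /= big_nat_cond [in RHS]big_nat_cond; apply: eq_big => [k|k _].
    by rewrite /A andbT ltnS andbb.
  by rewrite raddf_sum.
have inner k : A k -> \sum_(a : K | a \in Omega_star q) f k a <= bw.
  move=> Ak; apply: sum_at_most_one => //; first exact: index_enum_uniq.
    by move=> a Sa; case: (f1 k a) => [->//|[ma ->]]; apply: Hw.
  move=> a b Sa Sb; case: (f1 k a) => [->|[ma _]]; first by rewrite eqxx.
  case: (f1 k b) => [->|[mb _] _ _]; first by rewrite eqxx.
  exact: residue_uniq ma mb.
apply: sum_at_most_one => //; first exact: iota_uniq.
have ex k : \sum_(a : K | a \in Omega_star q) f k a != 0 ->
    exists2 a, a \in Omega_star q & maxid Q (gen k - constT T a).
  move=> nz; apply: contrapT => nex; case/eqP: nz; apply: big1 => a Sa.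
  by case: (f1 k a) => // -[ma _]; case: nex; exists a.
move=> k k' Ak Ak' /ex[a Sa ma] /ex[a' Sa' ma'].
exact: (Hk k a k' a').
Qed.

Lemma RR_val P z b : RR_space G z -> coeff P G <= b -> z = 0 \/ - b <= Defs.val P z.
Proof.
case=> [->|H] cb; [by left | right].
by apply: le_trans (H P); rewrite lerN2.
Qed.

Lemma Omega_starP a : a \in Omega_star q <-> in_Sstar (Omega q K) a.
Proof. by rewrite Omega_starE; split=> [/andP|[-> ->]]. Qed.

Lemma Omega_star_far a y : a \in Omega_star q -> maxid W y -> ~ maxid W (y - kp a).
Proof.
move=> /Omega_starP[_ a0] my ma; case: (maxid_vunit _ (kappa_unit LM kap a0)).
by rewrite -[kappa _ _ a](subKr y); apply: maxidB.
Qed.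

Section Extension.
Variables (iota : {rmorphism rat_funs K -> L}) (z : L) (r : {rmorphism T -> L}).
Hypothesis iz : is_subst iota z.
Hypothesis hr : lhom gen iota M r.

Lemma ext_const c : r (constT T c) = kp c. Proof. exact: lhom_const hr. Qed.

Lemma ext_place : (exists a, ~ vring W (r a)) -> exists P : place (constT T), pulled W r P.
Proof.
apply: pullback_exists.
- exact: (rmorph0 (cT T)).
- exact: (fmorphV (cT T)).
- by move=> c; rewrite ext_const; apply: vring_kappa.
Qed.

Lemma ext_maxid (P : place (constT T)) k a : pulled W r P ->
  maxid P (gen k - constT T a) -> maxid W (r (gen k) - kp a).
Proof. by move=> PW /(pulled_maxid PW); rewrite rmorphB ext_const. Qed.

Lemma near_Omega (y : L) a : a \in Omega q K -> maxid W (y - kp a) ->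
  maxid W (y ^+ q + y).
Proof.
move=> Sa my.
have -> : y ^+ q + y = (y - kp a) ^+ q + (y - kp a).
  rewrite (frobeniusB hq hK kp); have : kp a ^+ q + kp a = 0.
    by rewrite -rmorphXn -rmorphD (Omega_AS Sa) rmorph0.
  move=> E; rewrite addrACA -opprD E subr0 //.
by apply: maxidD => //; apply: maxidX => //; apply: ltnW.
Qed.

(** No summand of G passes through a place of good reduction. *)
Lemma RR_good f : lhomU gen iota M r -> (exists a, ~ vring W (r a)) ->
  st_good gen M r -> RR_space G f -> vring W (r f).
Proof.
move=> [_ Ur] nW sr Gf; have [P PW] := ext_place nW.
have [w' [mw w0 ord]] := pulled_discrete (fun z => Ur z (mem_tower z)) PW nW.
have no k a : (k <= M)%N -> a \in Omega q K -> ~ maxid P (gen k - constT T a).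
  move=> kM Sa /(ext_maxid PW) mk; have [_ /maxid_vunit] := sr k kM.
  by move/(_ (near_Omega Sa mk)).
have Om a : a \in Omega_star q -> a \in Omega q K by rewrite Omega_starE => /andP[].
have z0 : 0 \in Omega q K by rewrite inE expr0n gtn_eqF ?addr0 // ltnW.
have := pulled_bound PW mw w0 ord (b := 0) (z := f); rewrite expr0z mulr1; apply.
apply: RR_val Gf _; have := @coefG_le P 0 0 0 0; rewrite !addr0; apply=> //.
- by move=> a /Om Sa /no; case.
- by move=> k a /andP[_ kM] /Om Sa /no; case=> //; rewrite /M; lia.
- by move=> k a k' a' /andP[_ kM] _ /Om Sa _ /no; case=> //; rewrite /M; lia.
- move=> m0; case: (no 0%N 0 _ z0) => //.
  by have -> : constT T 0 = 0; [exact: (rmorph0 (cT T)) | rewrite subr0].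
- by move=> nV; case: nV; apply/PW; have [] := sr 0%N (leq0n _).
Qed.

(** At an unramified place above the zero of x_1 only v_0 (x_1)_0 contributes. *)
Lemma RR_zero f : z = t -> lhomU gen iota M r ->
  (forall k a, (1 <= k <= (m - 2)./2)%N -> a \in Omega_star q ->
     ~ maxid W (r (gen k) - kp a)) ->
  RR_space G f -> vring W (r f * t ^ v0).
Proof.
move=> zt [_ Ur] now Gf; have r0 : r (gen 0) = t by rewrite (lhom_gen0 iz hr).
have g0 : gen 0 != 0 by rewrite -(fmorph_eq0 r) r0.
have [|P PW] := ext_place; first by exists (gen 0)^-1; rewrite fmorphV r0; apply: inv_pole.
have ord y : y != 0 -> exists n : int, vunit W (r y / r (gen 0) ^ n).
  by move=> y0; rewrite r0; apply: unram_ord; rewrite ?fmorph_eq0 //; apply/Ur/mem_tower.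
have mr0 : maxid W (r (gen 0)) by rewrite r0.
have [_ valE] := pulled_val PW mr0 g0 ord.
have v1 : Defs.val P (gen 0) = 1.
  by apply: valE; rewrite expr1z divff ?r0 //; apply: vunit1.
have := pulled_bound PW mr0 g0 ord (b := v0) (z := f); rewrite r0; apply.
apply: RR_val Gf _; have [v00 _] := hv0.
have := @coefG_le P 0 0 v0 0; rewrite !addr0 !add0r; apply=> //.
- by move=> a Sa /(ext_maxid PW); rewrite r0 => /(Omega_star_far Sa mt).
- by move=> k a kk Sa /(ext_maxid PW) /now; case.
- by move=> k a k' a' kk _ Sa _ /(ext_maxid PW) /now; case.
- by rewrite v1 mulr1.
- by case; apply/PW; rewrite r0; apply: maxid_vring.
Qed.

(** ** Totally ramified extensions *)

Section RamifiedExtension.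
Hypothesis rr : ramified gen iota M r.
Let B := beta q (r (gen M)).

Lemma ram_unif : maxid W B^-1 /\ B != 0.
Proof. by case: rr => _ nb _; apply: pole_inv. Qed.

Lemma RR_ramified f b : (forall P : place (constT T), pulled W r P ->
    (forall n : int, vunit W (r (gen 0) / B^-1 ^ n) -> Defs.val P (gen 0) = n) ->
    coeff P G <= b) ->
  RR_space G f -> vring W (r f * B^-1 ^ b).
Proof.
move=> cb Gf; have [mB B0] := ram_unif.
pose p := (beta q (gen M))^-1.
have rp : r p = B^-1.
  by rewrite /p fmorphV /B (hom_beta hr) // mem_tower.
have p0 : p != 0 by rewrite -(fmorph_eq0 r) rp invr_eq0.
have [|P PW] := ext_place.
  by exists p^-1; rewrite fmorphV rp; apply: inv_pole; rewrite ?invr_eq0.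
have ord y : y != 0 -> exists n : int, vunit W (r y / r p ^ n).
  move=> y0; case: rr => _ _ ordr; have [|e ue] := ordr y (mem_tower y).
    by rewrite fmorph_eq0.
  by exists (- e); rewrite rp exprz_inv opprK.
have mp : maxid W (r p) by rewrite rp.
have [_ valE] := pulled_val PW mp p0 ord.
rewrite -rp; apply: (pulled_bound PW mp p0 ord); apply: RR_val Gf _.
by apply: cb => // n un; apply: valE; rewrite rp.
Qed.

(** The product of two functions with poles of order at most b each: the factor u
    and the different leave room for 2 b. *)
Lemma ramified_product f1 f2 u (b : int) (e : nat) : (0 < e)%N ->
  vring W (r f1 * B^-1 ^ b) -> vring W (r f2 * B^-1 ^ b) ->
  vunit W (r u / B^-1 ^+ ((q - 2) * e)) ->
  b *+ 2 <= ((q - 2) * e)%N%:Z + e.-1.*2%:Z ->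
  vring W (r (f1 * f2 * u) / B ^+ e.-1.*2).
Proof.
move=> e0 W1 W2 Wu be; have [mB B0] := ram_unif.
have p0 : B^-1 != 0 by rewrite invr_eq0.
set p := B^-1 in W1 W2 Wu mB p0 *.
have -> : r (f1 * f2 * u) / B ^+ e.-1.*2 = (r f1 * p ^ b) * (r f2 * p ^ b) *
   (r u / p ^+ ((q - 2) * e)) * p ^ (((q - 2) * e)%N%:Z + e.-1.*2%:Z - b *+ 2).
  rewrite !rmorphM -[B ^- _]exprVn -/p; clearbody p.
  rewrite expfzDr // expfzDr // mulr2n opprD expfzDr // -!invr_expz -!exprnP.
  by field; rewrite expf_neq0 // expfz_neq0.
apply: vringM; first by apply: vringM; [apply: vringM | case: Wu].
move: be; rewrite -subr_ge0; case: (_ - _) => // n _.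
by apply: vringX; apply: maxid_vring.
Qed.

Lemma vunit_inv_pow (e : nat) : vunit W (t^-1 / B ^+ e) -> vunit W (t / B^-1 ^+ e).
Proof.
move/vunitV; have -> // : t / B^-1 ^+ e = (t^-1 / B ^+ e)^-1.
by rewrite exprVn invfM !invrK.
Qed.

End RamifiedExtension.

End Extension.

Lemma double_bound (a : int) (n : nat) : a%:Q <= (n%:Q - 2) / 2 -> a *+ 2 <= n%:Z - 2.
Proof.
rewrite ler_pdivlMr // -(ler_int rat) => H.
by rewrite rmorphB rmorphMn /= -mulr_natr.
Qed.

Lemma denominator_unit : vunit W ((t ^+ q + t) / t).
Proof.
have -> : (t ^+ q + t) / t = 1 + t ^+ q.-1.
  by rewrite mulrDl divff // -{1}(prednK (ltnW q1)) exprSr mulfK // addrC.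
by apply: vunitDm (vunit1 W) (maxidX _ mt); lia.
Qed.

Hypothesis kap_alg : integralRange kap.

(** ** Products of two functions of the Riemann-Roch space *)

Section TwoFunctions.
Variables (f1 f2 : T).
Hypotheses (Gf1 : RR_space G f1) (Gf2 : RR_space G f2).

(** The factors, which come from K(x_1), clear the poles that the trace of f1 f2 can
    have at Omega and at infinity. *)
Definition finite_part : T := f1 * f2 * (gen 0 ^+ q + gen 0) ^+ (q - 2).
Definition infinite_part : T := f1 * f2 * (gen 0)^-1 ^+ (q - 2).

(** The only summands of G that can pass through such a place are v_a P_a if k = 0,
    and w_(k,a) A_(k,a) and v_0 (x_1)_0 otherwise. *)
Lemma pivot_bound iota k a s : is_subst iota (if k is 0 then kp a + t else t) ->
  in_Sstar (Omega q K) a -> (k.*2 < M)%N -> lhomU gen iota k.*2 s ->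
  st_pivot gen kap k a k.*2 s ->
  ramified_bound M gen iota (M - k.*2) k.*2 s finite_part.
Proof.
move=> iz Sa kM [hs _] [_ s0 szero spiv spole] r0 rr r0E rpole ru.
have hr0 : lhom gen iota M r0 by case: rr.
have [r rE] := lhom_full hr0; subst r0.
have [mB B0] := ram_unif rr.
set B := beta q (r (gen M)) in ru mB B0 *; set e := (q ^ (M - k.*2))%N in ru *.
have e0 : (0 < e)%N by rewrite expn_gt0 ltnW.
have rgen j : (j <= k.*2)%N -> r (gen j) = s (gen j).
  by move=> jk; apply: r0E; apply: (gen_tower gen0).
have Sa2 := kp_AS LM kap (@Omega_AS q K) (proj1 Sa).
have uka : vunit W (kp a) by apply: kappa_unit; case: Sa.
have r0E0 := rgen 0%N (leq0n _); rewrite s0 in r0E0.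
have Wr0 : vring W (r (gen 0)).
  rewrite r0E0; case: (k) => [|_]; last exact: maxid_vring.
  by apply: vringD; [apply: vring_kappa | apply: maxid_vring].
have rAS : r (gen 0) ^+ q + r (gen 0) = t ^+ q + t.
  rewrite r0E0; case: (k) => [|_] //.
  by rewrite frobL Sa2 addrACA addNr add0r.
have ute : vunit W (t / B^-1 ^+ e) by apply: vunit_inv_pow.
have only k' a' : (1 <= k' <= (m - 2)./2)%N -> a' \in Omega_star q ->
    maxid W (r (gen k') - kp a') -> k' = k /\ a' = a.
  move=> /andP[k'0 k'm] Sa' ma'.
  have Wk' : vring W (r (gen k')).
    by rewrite -[r _](subrK (kp a')); apply: vringD; [apply: maxid_vring | apply: vring_kappa].
  have [k'k|k'k|k'k] := ltngtP k' k.
  - exfalso; rewrite rgen in ma'; last by lia.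
    by apply: (Omega_star_far Sa' _ ma'); case: (szero k' k'k).
  - exfalso; have [k'2|k'2] := leqP k' k.*2; last first.
      by apply: (rpole k') Wk'; rewrite k'2 /M; lia.
    have := spole (k' - k)%N; rewrite subnKC ?(ltnW k'k) // -rgen // => H.
    have [mx x0] := szero (k - (k' - k))%N ltac:(lia).
    have Wz := vringB (H ltac:(lia)) Wk'; rewrite addrAC subrr add0r in Wz.
    have u2 : vunit W (kp a ^+ 2) by apply: vunitX.
    apply: (inv_pole x0 mx).
    rewrite -[_^-1](mulKf (vunit_neq0 u2)); apply: vringM => //.
    by case/vunitV: u2.
  - split=> //; apply: (cong_kp_eq Wkp (u := r (gen k'))) => //.
    by rewrite k'k rgen //; lia.
pose bv := if k is 0 then v a else 0; pose bw := if k is 0 then 0 else wt k a.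
pose b0 := if k is 0 then 0 else v0 * e%:Z.
have aS : a \in Omega_star q by apply/Omega_starP.
have [va0 va] := hv aS; have [v00 v0b] := hv0.
have wk : k != 0%N -> 0 <= wt k a <= e%:Z - 1.
  move=> k0; have := hw (k := k) aS.
  have -> : (m - 2 * k - 1 = M - k.*2)%N by rewrite /M; lia.
  by apply; rewrite /M in kM; lia.
have bv0 : 0 <= bv by rewrite /bv; case: (k).
have bw0 : 0 <= bw.
  by move: wk; rewrite /bw; case: (k) => // k1 /(_ isT) /andP[].
have b00 : 0 <= b0 by rewrite /b0; case: (k) => // _; apply: mulr_ge0.
have bound : (bv + bw + b0) *+ 2 <= ((q - 2) * e)%N%:Z + e.-1.*2%:Z.
  have v02 := double_bound v0b; move: wk; rewrite /bv /bw /b0; case kE: (k) => [|k1].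
    move=> _; rewrite !addr0; apply: degree_bound_total => //.
    have -> : (q * e = q ^ m)%N.
      by rewrite /e kE subn0 -expnS /M prednK // (ltn_trans _ hm).
    exact: double_bound.
  move=> /(_ isT) /andP[_ we]; rewrite add0r -kE.
  by apply: degree_bound_pivot; rewrite // kE.
have coefP (P : place (constT T)) : pulled W r P ->
    (forall n : int, vunit W (r (gen 0) / B^-1 ^ n) -> Defs.val P (gen 0) = n) ->
    coeff P G <= bv + bw + b0.
  move=> PW valE; have := @coefG_le P bv bw b0 0; rewrite addr0; apply=> //.
  - move=> a' Sa' /(ext_maxid iz hr0 PW); rewrite r0E0 /bv; case: (k) => [|k1] ma'.
      have -> // : a' = a; apply: (cong_kp_eq Wkp ma').
      by rewrite addrAC subrr add0r.
    by case: (Omega_star_far Sa' mt ma').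
  - move=> k' a' kk Sa' /(ext_maxid iz hr0 PW) /(only _ _ kk Sa')[kE aE].
    by move: kk; rewrite kE aE /bw; case: (k).
  - move=> k' a' k2 a2 kk kk2 Sa' Sa2' /(ext_maxid iz hr0 PW) /(only _ _ kk Sa')[-> _].
    by move=> /(ext_maxid iz hr0 PW) /(only _ _ kk2 Sa2')[-> _].
  - move=> /(pulled_maxid PW); rewrite r0E0 /b0; case kE: (k) => [|k1] mr.
      by case: (maxid_vunit mr); apply: vunitDm.
    by rewrite (valE e%:Z) // r0E0 kE.
  - by move=> nV; case: nV; apply/PW.
apply: (ramified_product (e := e) rr e0 (RR_ramified iz hr0 rr coefP Gf1)
   (RR_ramified iz hr0 rr coefP Gf2)) => //.
rewrite rmorphXn rmorphD rmorphXn rAS mulnC exprM -expr_div_n; apply: vunitX.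
have -> : (t ^+ q + t) / B^-1 ^+ e = (t ^+ q + t) / t * (t / B^-1 ^+ e).
  by rewrite mulrA divfK.
by apply: vunitM => //; apply: denominator_unit.
Qed.

Lemma infinite_bound iota s : is_subst iota t^-1 -> lhomU gen iota 0 s ->
  ramified_bound M gen iota M 0 s infinite_part.
Proof.
move=> iz hs r0 rr r0E rpole ru.
have hr0 : lhom gen iota M r0 by case: rr.
have [r rE] := lhom_full hr0; subst r0.
have [mB B0] := ram_unif rr.
set B := beta q (r (gen M)) in ru mB B0 *; set e := (q ^ M)%N in ru *.
have e0 : (0 < e)%N by rewrite expn_gt0 ltnW.
have r0E0 : r (gen 0) = t^-1 by apply: (lhom_gen0 iz hr0).
have nW0 : ~ vring W (r (gen 0)) by rewrite r0E0; apply: inv_pole.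
have npole k a : (k <= M)%N -> ~ maxid W (r (gen k) - kp a).
  move=> kM mk; have Wk : vring W (r (gen k)).
    by rewrite -[r _](subrK (kp a)); apply: vringD; [apply: maxid_vring | apply: vring_kappa].
  by case: k kM {mk} Wk => [|k] kM // Wk; apply: (rpole k.+1) Wk.
have ute : vunit W (t / B^-1 ^+ e) by apply: vunit_inv_pow.
have [vinf0 vinfb] := hvinf.
have coefP (P : place (constT T)) : pulled W r P ->
    (forall n : int, vunit W (r (gen 0) / B^-1 ^ n) -> Defs.val P (gen 0) = n) ->
    coeff P G <= vinf.
  move=> PW valE; have := @coefG_le P 0 0 0 vinf; rewrite !addr0 !add0r; apply=> //.
  - by move=> a Sa /(ext_maxid iz hr0 PW) /npole; case.
  - by move=> k a /andP[_ kk] Sa /(ext_maxid iz hr0 PW) /npole; case; rewrite /M; lia.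
  - by move=> k a k' a' /andP[_ kk] _ Sa _ /(ext_maxid iz hr0 PW) /npole; case; rewrite /M; lia.
  - by move=> /maxid_vring /PW.
apply: (ramified_product (e := e) rr e0 (RR_ramified iz hr0 rr coefP Gf1)
   (RR_ramified iz hr0 rr coefP Gf2)).
  by rewrite rmorphXn fmorphV r0E0 invrK mulnC exprM -expr_div_n; apply: vunitX.
apply: degree_bound_total => //.
have -> : (q * e = q ^ m)%N by rewrite /e -expnS /M prednK // (ltn_trans _ hm).
exact: double_bound.
Qed.

Lemma zero_product (y1 y2 : L) : vring W (y1 * t ^ v0) -> vring W (y2 * t ^ v0) ->
  vring W (y1 * y2 * (t ^+ q + t) ^+ (q - 2)).
Proof.
move=> W1 W2; have [v00 v0b] := hv0; have v02 := double_bound v0b.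
have -> : y1 * y2 * (t ^+ q + t) ^+ (q - 2) = (y1 * t ^ v0) * (y2 * t ^ v0) *
    ((t ^+ q + t) / t) ^+ (q - 2) * t ^ ((q - 2)%N%:Z - v0 *+ 2).
  rewrite expr_div_n mulr2n opprD expfzDr // expfzDr // -!invr_expz -exprnP.
  by move: ((t ^+ q + t) ^+ _) => y; field; rewrite expf_neq0 // expfz_neq0.
apply: vringM.
  apply: vringM; first exact: vringM.
  by apply: vringX; case: denominator_unit.
have : 0 <= (q - 2)%N%:Z - v0 *+ 2.
  by rewrite -subzn // subr_ge0.
case: (_ - _) => // n _; exact/vringX/maxid_vring.
Qed.

(** An equation for c over K gives a function that vanishes at c. *)
Lemma good_pole iota c r : is_subst iota (cemb LM c + t) -> lhom gen iota M r ->
  exists a, ~ vring W (r a).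
Proof.
move=> iz [hr rc]; have [p mp rp] := kap_alg c.
have h := horner_finite kap LM p c.
rewrite (rootP rp) rmorph0 subr0 -iz -rc in h.
exists ((tofrac p)%:A)^-1; rewrite (homV hr) ?mem_tower //.
apply: inv_pole h; rewrite (hom_eq0 hr) ?mem_tower //.
by rewrite scaler_eq0 oner_eq0 orbF tofrac_eq0 monic_neq0.
Qed.

Lemma finite_unram iota c s : is_subst iota (cemb LM c + t) -> lhom gen iota 0 s ->
  lhomU gen iota 0 s.
Proof.
move=> iz hs; apply: lhomU0 => //; apply: substitution_unram iz _.
by apply: UD; [apply: unram_cst | apply: unram_unif].
Qed.

Lemma good_start iota c s : is_subst iota (cemb LM c + t) -> lhom gen iota 0 s ->
  c ^+ q + c != 0 -> st_good gen 0 s.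
Proof.
move=> iz hs c0 j; rewrite leqn0 => /eqP ->; rewrite (lhom_gen0 iz hs).
split; first by apply: vringD; [apply: vring_const1 | apply: maxid_vring].
rewrite frobL addrACA -rmorphXn -rmorphD; apply: vunitDm.
  split; rewrite ?fmorph_eq0 // -?fmorphV; exact: vring_const1.
by apply: maxidD => //; apply: maxidX => //; apply: ltnW.
Qed.

(** Outside Omega the reduction is good; at c = 0 the zero state starts, and at the
    other elements of Omega a pivot at once. *)
Lemma finite_integral iota c s : is_subst iota (cemb LM c + t) -> lhom gen iota 0 s ->
  vring W (s (itrace q M gen M finite_part)).
Proof.
move=> iz hs; have hsU := finite_unram iz hs.
have M0 : (0 < M)%N by rewrite /M; case: m hm => [|[]].
have nE : 0%N = (M - M)%N by rewrite subnn.
have [c0|c0] := eqVneq (c ^+ q + c) 0; last first.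
  have good := integral_good q1 gen0 genS kap deg_gen OmB cardOm OmAS frobL (mem_tower finite_part) nE (leqnn M) hsU.
  apply: good; first exact: good_start iz hs c0.
  move=> r0 [hr Ur] gr _; have [r rE] := lhom_full hr; subst r0.
  rewrite /finite_part !rmorphM rmorphXn rmorphD rmorphXn.
  have nW := good_pole iz hr.
  have [Wr0 [_ Wr1 _]] := gr 0%N (leq0n _).
  apply: vringM; last exact: vringX.
  by apply: vringM; apply: (RR_good iz hr).
have [a Sa cE] := Omega_lift hq hK kap c0.
have [a0|a0] := eqVneq a 0.
  have izt : is_subst iota t.
    by move=> p; rewrite iz cE a0 !rmorph0 add0r.
  have zero := integral_zero q1 gen0 genS deg_gen OmB cardOm OmAS frobL (@Omega_sqr q K) (mem_tower finite_part)
    nE (leqnn M) hsU.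
  have fin r : lhomU gen iota M r ->
    (forall k a, (1 <= k <= (m - 2)./2)%N -> a \in Omega_star q ->
      ~ maxid W (r (gen k) - kp a)) -> vring W (r finite_part).
    move=> hrU no; have [hr _] := hrU; have [r' rE] := lhom_full hr; subst r.
    have r0 : r' (gen 0) = t by apply: (lhom_gen0 izt hr).
    rewrite /finite_part !rmorphM rmorphXn rmorphD rmorphXn r0.
    by apply: zero_product; apply: (RR_zero izt hr).
  apply: (zero kap).
  - split; first exact: (lhom_gen0 izt hs).
    by move=> j; rewrite leqn0 => /eqP ->; rewrite (lhom_gen0 izt hs).
  - move=> r hr [_ zr]; apply: fin => // k a' /andP[_ kk] Sa'.
    by apply: Omega_star_far => //; case: (zr k); rewrite // /M; lia.
  - move=> k a' k0 Sa' /andP[_ Mk] r hr [_ _ zr _ _]; apply: fin => // k' a2 /andP[_ kk] Sa2.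
    by apply: Omega_star_far => //; case: (zr k'); rewrite // /M in Mk *; lia.
  - move=> k a' k0 Sa' kM r hr sr; apply: (pivot_bound (a := a')) => //.
    by case: (k) k0.
have izt : is_subst iota (kp a + t) by move=> p; rewrite iz cE.
have Sa' : in_Sstar (Omega q K) a by split.
have pivot := integral_pivot q1 gen0 genS deg_gen OmB cardOm OmAS frobL (@Omega_sqr q K) (mem_tower finite_part)
    Sa' nE (leqnn M) hsU.
apply: (pivot kap 0%N).
- split=> //; first exact: (lhom_gen0 izt hs).
    by rewrite (lhom_gen0 izt hs) addrAC subrr add0r.
  by case.
- by rewrite leqn0 => /eqP E; rewrite E in M0.
- by move=> _ r hr sr; apply: (pivot_bound (k := 0) (a := a)).
Qed.

Lemma infinite_integral iota s : is_subst iota t^-1 -> lhomU gen iota 0 s ->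
  vring W (s (itrace q M gen M infinite_part)).
Proof.
move=> iz hs; have hb := infinite_bound iz hs.
have [hs' _] := hs.
have nE : 0%N = (M - M)%N by rewrite subnn.
apply: (integral_at_ramified q1 gen0 genS (mem_tower infinite_part) nE (leqnn M) hs _ hb).
rewrite (lhom_gen0 iz hs') -[X in _ * X]invrK.
exact: (beta_pole q1 (inv_pole t0 mt)).
Qed.

End TwoFunctions.

(** * The places above x_1 = a *)

Section Points.
Local Notation cT := (cT T).

Definition words := fix words n : seq (seq K) :=
  if n is n'.+1 then [seq o :: w | w <- words n', o <- enum (Omega q K)] else [:: [::]].

Lemma mem_words_cons n o w : (o :: w \in words n.+1) = (o \in Omega q K) && (w \in words n).
Proof.
apply/allpairsP/andP => [[[w' o'] [/= ww oo [-> ->]]]|[oO ww]].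
  by rewrite mem_enum in oo.
by exists (w, o); split=> //; rewrite mem_enum.
Qed.

Lemma size_word n w : w \in words n -> size w = n.
Proof.
elim: n w => [|n IH] w; first by rewrite inE => /eqP ->.
by move=> /allpairsP[[w' o] [/= /IH <- _ ->]].
Qed.

Lemma words_uniq n : uniq (words n).
Proof.
elim: n => [|n IH] //=; apply: allpairs_uniq => //; first exact: enum_uniq.
by move=> [w o] [w' o'] _ _ /= [-> ->].
Qed.

Variable a : K.
Hypothesis aOm : a ^+ q + a != 0.

Variable iota : {rmorphism rat_funs K -> L}.
Hypothesis iz : is_subst iota (cemb LM (kap a) + t).
Variable s0 : T -> L.
Hypothesis hs0 : lhom gen iota 0 s0.

(** A fixed choice of an unramified root; the others differ from it by elements of
    Omega. *)
Definition AS_root (b : L) : L :=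
  xget 0 [set y | [/\ unram y, vring W y & y ^+ q + y = b]].

Lemma AS_rootP b : unram b -> vring W b ->
  [/\ unram (AS_root b), vring W (AS_root b) & AS_root b ^+ q + AS_root b = b].
Proof.
move=> Ub Wb; have [y Hy] := AS_solve q1 frobL Ub Wb.
by apply: (@xgetPex _ 0 [set y | [/\ unram y, vring W y & y ^+ q + y = b]]); exists y.
Qed.

(** The homomorphism attached to a word over Omega: the letters are the
    successive choices among the q roots. *)
Fixpoint word_hom (w : seq K) : T -> L :=
  if w is o :: w' then
    ext (tower gen (size w')) (word_hom w') (gen (size w').+1)
      (AS_root (beta q (word_hom w' (gen (size w')))) + kp o)
  else s0.

Lemma word_homP n w : (n <= M)%N -> w \in words n ->
  lhomU gen iota n (word_hom w) /\ st_good gen n (word_hom w).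
Proof.
elim: n w => [|n IH] w nM.
  rewrite inE => /eqP ->; split; first exact: (finite_unram iz hs0).
  apply: (good_start iz hs0).
  by rewrite -rmorphXn -rmorphD fmorph_eq0.
case: w => [|o w]; first by move/size_word.
rewrite mem_words_cons => /andP[oO ww]; have [[hs Us] gs] := IH w (ltnW nM) ww.
rewrite /= (size_word ww).
have [Wn un] := gs n (leqnn n); have [uy ub] := beta_unit q1 Wn un.
have Un := Us _ (tower_gen gen0 n).
have [Ur Wr rE] := AS_rootP (Ubeta Un) (vunit_vring ub).
set y0 := AS_root _ in Ur Wr rE *.
have yb' := AS_shift kap OmAS frobL oO rE.
have Uyw : unram (y0 + kp o) by apply: UD => //; apply: Ukappa.
have [hs' s'E s'y] := lhomU_ext q1 gen0 genS deg_gen nM (conj hs Us) Uyw yb'.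
split=> // j; rewrite leq_eqVlt => /predU1P[->|jn].
  rewrite s'y yb'; split=> //; apply: vringD => //; exact: vring_kappa.
rewrite s'E; first exact: gs.
exact: (gen_tower gen0).
Qed.

Lemma word_hom_gen0 n w : (n <= M)%N -> w \in words n -> word_hom w (gen 0) = kp a + t.
Proof. by move=> nM ww; have [[hs _] _] := word_homP nM ww; rewrite (lhom_gen0 iz hs). Qed.

Lemma word_AS n w : (n <= M)%N -> w \in words n ->
  let b := beta q (word_hom w (gen n)) in
  [/\ unram (AS_root b), vring W (AS_root b) & AS_root b ^+ q + AS_root b = b].
Proof.
move=> nM ww; have [[_ Us] gs] := word_homP nM ww.
have [Wn un] := gs n (leqnn n); have [_ ub] := beta_unit q1 Wn un.
exact: AS_rootP (Ubeta (Us _ (tower_gen gen0 n))) (vunit_vring ub).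
Qed.

Lemma word_hom_cons n o w : (n < M)%N -> o \in Omega q K -> w \in words n ->
  {in tower gen n, word_hom (o :: w) =1 word_hom w} /\
  word_hom (o :: w) (gen n.+1) = AS_root (beta q (word_hom w (gen n))) + kp o.
Proof.
move=> nM oO ww; have [[hs _] _] := word_homP (ltnW nM) ww; rewrite /= (size_word ww).
have [Ur Wr rE] := word_AS (ltnW nM) ww.
have yb' := AS_shift kap OmAS frobL oO rE.
by have [_ ? ?] := tower_ext q1 gen0 genS nM (deg_gen nM) hs yb'.
Qed.

(** Iteration of the trace formula for a single step. *)
Lemma sum_words n f : (n <= M)%N ->
  \sum_(w <- words n) word_hom w (itrace q M gen (M - n) f) =
  node_prod kp (Omega q K) ^+ n * s0 (itrace q M gen M f).
Proof.
elim: n => [|n IH] nM; first by rewrite big_seq1 subn0 mul1r.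
rewrite /= big_allpairs_dep /= exprS -mulrA -IH ?(ltnW nM) // mulr_sumr.
rewrite big_seq [in RHS]big_seq; apply: eq_bigr => w ww.
have [[hs _] _] := word_homP (ltnW nM) ww.
have -> : itrace q M gen (M - n) f = lam q gen n (itrace q M gen (M - n.+1) f).
  have -> : (M - n = (M - n.+1).+1)%N by lia.
  by rewrite /= -/(itrace _ _ _); congr lam; lia.
rewrite (sum_ext kap deg_gen OmB cardOm (AS_root (beta q (word_hom w (gen n)))) _ nM hs).
by rewrite big_enum /= (size_word ww).
Qed.

(** An element whose images under all the homomorphisms of words are integral is
    a polynomial in the generators with coefficients integral at a. *)
Lemma good_induction (Q : nat -> T -> Prop) :
  (forall h, vring W (iota h) -> Q 0%N h%:A) ->
  (forall n f, (n < M)%N -> f \in tower gen n.+1 ->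
    (forall i, Q n (Fadjoin_poly (tower gen n) (gen n.+1) f)`_i) -> Q n.+1 f) ->
  forall n f, (n <= M)%N -> f \in tower gen n ->
    (forall w, w \in words n -> vring W (word_hom w f)) -> Q n f.
Proof.
move=> Q0 QS; elim=> [|n IH] f nM Ef Wf.
  case/vlineP: Ef Wf => h -> /(_ [::]) H; apply: Q0.
  by case: hs0 => _ <-; apply: H; rewrite inE.
apply: QS => // i; apply: IH; first exact: ltnW.
  exact/polyOverP/Fadjoin_polyOver.
move=> w ww; have [[hs Us] gs] := word_homP (ltnW nM) ww.
rewrite -(coef_hom (lhom_hom hs)).
apply: (lagrange_integral Wkp OmB (y := AS_root (beta q (word_hom w (gen n))))).
- rewrite cardOm (leq_trans (size_poly _ _)) // (leq_trans (size_Fadjoin_poly _ _ _)) //.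
  by rewrite deg_gen.
- by case: (word_AS (ltnW nM) ww).
- move=> o oO; have := Wf (o :: w); rewrite mem_words_cons oO ww /= (size_word ww).
  by apply.
Qed.

Lemma integral_fraction h : vring W (iota h) -> exists A B : {poly K},
  B.[a] != 0 /\ h = tofrac A / tofrac B.
Proof.
move=> Wh; have [A [B [B0 hE]]] := fractionP h.
have [->|h0] := eqVneq h 0.
  by exists 0, 1; rewrite hornerC oner_eq0 tofrac0 mul0r.
have A0 : A != 0 by apply: contraNneq h0 => A0; rewrite hE A0 tofrac0 mul0r.
have [i [A' + AE]] := multiplicity_XsubC A a; rewrite A0 implyTb => rA.
have [j [B' + BE]] := multiplicity_XsubC B a; rewrite B0 implyTb => rB.
have XA p c : iota (tofrac p) = (map_poly kp p).[cemb LM (kap c) + t] ->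
   maxid W (iota (tofrac p) - kp p.[c]).
  by move=> ->; have := horner_finite kap LM p (kap c); rewrite horner_map.
have uA : vunit W (iota (tofrac A')).
  by apply: cong_unit (XA A' a (iz _)); apply: kappa_unit.
have uB : vunit W (iota (tofrac B')).
  by apply: cong_unit (XA B' a (iz _)); apply: kappa_unit.
have Xt : iota (tofrac ('X - a%:P)) = t.
  by rewrite iz map_polyXsubC hornerXsubC addrAC subrr add0r.
have ihE : iota h = iota (tofrac A') / iota (tofrac B') *
    t ^ (i%:Z - j%:Z).
  rewrite hE AE BE fmorph_div !tofracM !tofracXn !rmorphM !rmorphXn Xt.
  rewrite expfzDr // -exprnN -exprnP; have := vunit_neq0 uB => B'0.
  by field; rewrite B'0 expf_neq0.
have un : vunit W (iota h / t ^ (i%:Z - j%:Z)).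
  by rewrite ihE mulfK ?expfz_neq0 //; apply: vunit_div.
have ij := proj1 (ord_vring t0 mt un) Wh.
exists (A' * ('X - a%:P) ^+ (i - j)), B'; split=> //.
rewrite hE AE BE !tofracM !tofracXn; set Y := tofrac ('X - _).
have Y0 : Y != 0 by rewrite tofrac_eq0 polyXsubC_eq0.
by apply: cancel_power => //; rewrite -lez_nat -subr_ge0.
Qed.

(** ** Residues along a word *)

Lemma word_residues n w j : (n <= M)%N -> w \in words n -> (j <= n)%N ->
  exists b, maxid W (word_hom w (gen j) - kp b) /\ b ^+ q + b != 0.
Proof.
move=> nM ww; have [[hs _] _] := word_homP nM ww.
elim: j => [|j IH] jn.
  exists a; split=> //; rewrite (word_hom_gen0 nM ww) addrAC subrr add0r.
  exact: maxid_t.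
have [b [mb b0]] := IH (ltnW jn).
have yb := lhom_AS gen0 genS (leq_trans jn nM) (lhom_sub jn hs).
by have [b' [? _ ?]] := residue_next hq hK Wkp mb b0 yb; exists b'.
Qed.

(** The residues determine the word: the next letter is the difference between the
    prescribed residue and that of the chosen root. *)
Lemma word_of_residues (bs : nat -> K) n : (n <= M)%N -> bs 0%N = a ->
  (forall j, (j < n)%N -> bs j.+1 ^+ q + bs j.+1 = beta q (bs j)) ->
  (forall j, (j <= n)%N -> bs j ^+ q + bs j != 0) ->
  exists2 w, w \in words n & forall j, (j <= n)%N ->
    maxid W (word_hom w (gen j) - kp (bs j)).
Proof.
move=> nM b0; elim: n nM => [|n IH] nM bS bn.
  exists [::]; first by rewrite inE.
  move=> j; rewrite leqn0 => /eqP ->; rewrite b0 (@word_hom_gen0 0) ?inE //.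
  by rewrite addrAC subrr add0r; apply: maxid_t.
have [j jn|j jn|w ww Hw] := IH (ltnW nM); [exact/bS/ltnW | exact/bn/leqW |].
have [Ur Wr rE] := word_AS (ltnW nM) ww.
have [b' [mb' b'E _]] := residue_next hq hK Wkp (Hw n (leqnn n))
  (bn n (leqnSn n)) rE.
pose o := bs n.+1 - b'.
have oO : o \in Omega q K.
  rewrite inE /o (frobeniusB hq hK idfun) addrACA -opprD b'E bS ?ltnSn //.
  by rewrite subrr.
have [oE olast] := word_hom_cons nM oO ww.
exists (o :: w); first by rewrite mem_words_cons oO.
move=> j; rewrite leq_eqVlt => /predU1P[->|jn].
  have -> : word_hom (o :: w) (gen n.+1) - kp (bs n.+1) =
    AS_root (beta q (word_hom w (gen n))) - kp b'.
    by rewrite olast /o rmorphB; ring.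
  exact: mb'.
by rewrite oE; [apply: Hw | apply: (gen_tower gen0)].
Qed.

Lemma word_inj n w w' : (n <= M)%N -> w \in words n -> w' \in words n ->
  (forall j, (j <= n)%N -> maxid W (word_hom w (gen j) - word_hom w' (gen j))) -> w = w'.
Proof.
elim: n w w' => [|n IH] w w' nM.
  by move=> /size_word/eqP; rewrite size_eq0 => /eqP -> /size_word/eqP; rewrite size_eq0 => /eqP ->.
case: w => [|o w]; first by move/size_word.
case: w' => [|o' w']; first by move=> _ /size_word.
rewrite !mem_words_cons => /andP[oO ww] /andP[oO' ww'] H.
have [E1 l1] := word_hom_cons nM oO ww; have [E2 l2] := word_hom_cons nM oO' ww'.
have wE : w = w'.
  apply: IH => //; first exact: ltnW.
  move=> j jn; have := H j (leqW jn).
  by rewrite E1 ?E2 //; apply: (gen_tower gen0).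
have := H n.+1 (leqnn _); rewrite l1 l2 -wE opprD addrACA subrr add0r => mo.
congr (_ :: _) => //; apply: (cong_kp_eq Wkp (u := kp o)) mo.
by rewrite subrr; apply: maxid0.
Qed.

(** ** The place of a word *)

Definition above w (P : place (constT T)) := forall z, vring P z <-> vring W (word_hom w z).

Lemma word_rmorph w : w \in words M -> exists r : {rmorphism T -> L}, word_hom w = r.
Proof. by move=> ww; have [[hs _] _] := word_homP (leqnn M) ww; apply: (lhom_full hs). Qed.

Lemma word_const w c : w \in words M -> word_hom w (constT T c) = kp c.
Proof. by move=> ww; have [[hs _] _] := word_homP (leqnn M) ww; exact: (lhom_const iz c hs). Qed.

Lemma word_subC w z c : w \in words M ->
  word_hom w (z - constT T c) = word_hom w z - kp c.
Proof. by move=> ww; rewrite -(word_const c ww); have [r ->] := word_rmorph ww; apply: rmorphB. Qed.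

Lemma word_prime w : w \in words M -> word_hom w (gen 0 - constT T a) = t.
Proof. by move=> ww; rewrite word_subC // (word_hom_gen0 (leqnn M) ww) addrAC subrr add0r. Qed.

Lemma place_of_word w : w \in words M -> exists P, above w P.
Proof.
move=> ww; have [[hs _] _] := word_homP (leqnn M) ww.
have [r rE] := word_rmorph ww; rewrite /above rE; rewrite rE in hs.
apply: (ext_place iz hs); exists (gen 0 - constT T a)^-1.
by rewrite fmorphV -rE word_prime //; apply: inv_pole.
Qed.

Lemma above_maxid w P z : w \in words M -> above w P ->
  maxid P z <-> maxid W (word_hom w z).
Proof.
by move=> ww; have [r rE] := word_rmorph ww; rewrite /above rE => H; apply: pulled_maxid.
Qed.

(** The value is a polynomial in the residues of the generators, which are in K,
    with coefficients that are the values at a of rational functions over K. *)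
Lemma rational_value f : (forall w, w \in words M -> vring W (word_hom w f)) ->
  forall w, w \in words M -> exists c, maxid W (word_hom w f - kp c).
Proof.
apply: (good_induction (Q := fun n f => forall w, w \in words n ->
   exists c, maxid W (word_hom w f - kp c)) _ _ (leqnn M) (mem_tower f)).
- move=> h /integral_fraction[A [B [Ba hE]]] w; rewrite inE => /eqP ->.
  have mA p : maxid W (iota (tofrac p) - kp p.[a]).
    rewrite iz; apply: cong_horner => //.
    by rewrite addrAC subrr add0r; apply: maxid_t.
  exists (A.[a] / B.[a]); rewrite /=; case: hs0 => _ ->.
  rewrite hE !fmorph_div; have uB := vunit_kappa Wkp Ba.
  have uB' := cong_unit uB (mA B).
  apply: congM; [exact: Wkp | by case/vunitV: uB | exact: mA | exact: congV].
- move=> n g nM Eg IH w; case: w => [|o w]; first by move/size_word.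
  move=> oww; have := oww; rewrite mem_words_cons => /andP[oO ww].
  have [[hs _] _] := word_homP (ltnW nM) ww.
  have [_ last] := word_hom_cons nM oO ww.
  have [b [mb _]] := word_residues nM oww (leqnn _).
  rewrite last in mb; rewrite /= (size_word ww) /ext.
  apply: (residue_horner (kp := kp) Wkp mb) => i.
  by rewrite (coef_hom (lhom_hom hs)); apply: IH.
Qed.

Lemma cT_horner p : (tofrac p : rat_funs K)%:A = (map_poly cT p).[gen 0].
Proof.
rewrite gen0; elim/poly_ind: p => [|p c IH]; first by rewrite map_poly0 horner0 tofrac0 scale0r.
rewrite (rmorphD (map_poly cT)) (rmorphM (map_poly cT)) /= map_polyX map_polyC !hornerE -IH tofracD tofracM /=.
by rewrite scalerDl -scalerAl mul1r scalerA.
Qed.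

Lemma integral_at_place (P : place (constT T)) f :
  maxid P (gen 0 - constT T a) -> (forall j, (j <= M)%N -> vring P (gen j)) ->
  (forall w, w \in words M -> vring W (word_hom w f)) -> vring P f.
Proof.
move=> mP Pg; have PcT c : vring P (cT c) by apply: vring_const1.
apply: (good_induction (Q := fun n f => vring P f) _ _ (leqnn M) (mem_tower f)).
- move=> h /integral_fraction[A [B [Ba ->]]].
  have -> : (tofrac A / tofrac B : rat_funs K)%:A =
    (map_poly cT A).[gen 0] / (map_poly cT B).[gen 0] :> T.
    by rewrite -!cT_horner; apply: (fmorph_div (in_alg T)).
  have uB := cong_unit (vunit_kappa PcT Ba) (cong_horner PcT B mP).
  apply: vringM; last by case/vunitV: uB.
  exact: cong_vring (PcT _) (cong_horner PcT A mP).
- move=> n g nM Eg IH; rewrite -(Fadjoin_poly_eq Eg).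
  by apply: vring_horner => //; apply: Pg.
Qed.

Lemma place_residues (P : place (constT T)) n : (n <= M)%N ->
  maxid P (gen 0 - constT T a) -> exists bs : nat -> K, [/\ bs 0%N = a,
    forall j, (j < n)%N -> bs j.+1 ^+ q + bs j.+1 = beta q (bs j),
    forall j, (j <= n)%N -> bs j ^+ q + bs j != 0 &
    forall j, (j <= n)%N -> maxid P (gen j - cT (bs j))].
Proof.
move=> + mP; have PcT c : vring P (cT c) by apply: vring_const1.
elim: n => [|n IH] nM.
  by exists (fun=> a); split=> // j; rewrite leqn0 => /eqP ->.
have [bs [b0 bS bn mb]] := IH (ltnW nM).
have [b' [mb' b'E b'0]] := residue_next hq hK PcT (mb n (leqnn n)) (bn n (leqnn n)) (genS nM).
exists (fun j => if (j <= n)%N then bs j else b'); split=> //.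
- move=> j jn; have [->|jn'] := eqVneq j n; first by rewrite ltnn leqnn.
  have jn2 : (j < n)%N by rewrite ltn_neqAle jn' -ltnS.
  by rewrite jn2 (ltnW jn2); apply: bS.
- by move=> j jn1; case: (leqP j n) => [jn|_] //; apply: bn.
- move=> j jn; case: (leqP j n) => [jn'|nj]; first exact: mb.
  by have -> : j = n.+1 by apply/eqP; rewrite eqn_leq jn.
Qed.

Lemma unram_power_bound (u h : L) : unram u -> maxid W u -> unram h ->
  exists N0, forall N, (N0 <= N)%N -> vring W (u ^+ N * h).
Proof.
move=> Uu mu Uh; have Wut : vring W (u / t).
  have [->|u0] := eqVneq u 0; first by rewrite mul0r; apply: vring0.
  by have [n un] := unram_ord Uu u0; apply: ord_divr un mu.
have [->|h0] := eqVneq h 0; first by exists 0%N => N _; rewrite mulr0; apply: vring0.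
have [n un] := unram_ord Uh h0; exists `|n|%N => N nN.
have -> : u ^+ N * h = (u / t) ^+ N * (t ^+ N * h).
  by rewrite mulrA -exprMn divfK.
apply: vringM; first exact: vringX.
by rewrite mulrC exprnP; apply/(ord_vring t0 mt (ord_shift N t0 un)); lia.
Qed.

Lemma uniform_exponent (I : eqType) (l : seq I) (Q : I -> nat -> Prop) :
  (forall i, i \in l -> exists N0, forall N, (N0 <= N)%N -> Q i N) ->
  exists N0, forall N, (N0 <= N)%N -> forall i, i \in l -> Q i N.
Proof.
elim: l => [|i l IH] Hl; first by exists 0%N.
have [|N1 H1] := IH; first by move=> j jl; apply: Hl; rewrite inE jl orbT.
have [N2 H2] := Hl i (mem_head _ _); exists (maxn N1 N2) => N.
rewrite geq_max => /andP[N1N N2N] j; rewrite inE => /predU1P[->|]; first exact: H2.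
exact: H1.
Qed.

(** Every place at which x_1 takes the value a comes from a word: with an element
    e that is a unit at that place and vanishes at all the words with other
    residues, any h integral at the word becomes everywhere integral after
    multiplication by a power of e. *)
Lemma place_is_word (P : place (constT T)) : maxid P (gen 0 - constT T a) ->
  exists2 w, w \in words M & above w P.
Proof.
move=> mP; have [bs [b0 bS bn mb]] := place_residues (leqnn M) mP.
have PcT c : vring P (cT c) by apply: vring_const1.
have Pg j : (j <= M)%N -> vring P (gen j) by move=> jM; apply: cong_vring (PcT _) (mb j jM).
have [w ww Hw] := word_of_residues (leqnn M) b0 bS bn.
exists w => //; have [[hs Us] gs] := word_homP (leqnn M) ww.
pose e := \prod_(j < M.+1) \prod_(r | r != bs j) (gen j - cT r).
have ue : vunit P e.
  apply: vunit_prod => j _; apply: vunit_prod => r rb.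
  apply: (@cong_unit _ _ _ P _ (cT (bs j - r))).
    by apply: vunit_kappa => //; rewrite subr_eq0 eq_sym.
  by rewrite rmorphB opprB addrA subrK; apply: mb; rewrite -ltnS.
have sub h : vring W (word_hom w h) -> vring P h.
  move=> Wh.
  have [|N /(_ N (leqnn N)) HN] := @uniform_exponent _ (words M)
      (fun w' N => vring W (word_hom w' (e ^+ N * h))).
    move=> w' ww'.
    have [[hs' Us'] gs'] := word_homP (leqnn M) ww'.
    have [r rE] := word_rmorph ww'.
    have rcT c : r (cT c) = kp c by rewrite -rE; apply: word_const.
    have [/eqP ->|nw] := boolP (w' == w).
      exists 0%N => N _; have [r' r'E] := word_rmorph ww; rewrite r'E rmorphM rmorphXn -r'E.
      apply: vringM => //; apply: vringX; rewrite r'E rmorph_prod; apply: vring_prod => j _.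
      rewrite rmorph_prod; apply: vring_prod => b _; rewrite rmorphB -r'E.
      apply: vringB; last by rewrite word_const.
      by have [] := gs j (ltn_ord j).
    have me : maxid W (word_hom w' e).
      have [j [jM [b [bb mjb]]]] : exists j, (j <= M)%N /\ exists b, b != bs j /\
          maxid W (word_hom w' (gen j) - kp b).
        apply: contrapT => nex; case/eqP: nw; apply: (word_inj (leqnn M)) => // j jM.
        have [b [mjb _]] := word_residues (leqnn M) ww' jM.
        have bE : b = bs j.
          by apply/eqP; apply: contrapT => /negP bb; apply: nex; exists j; split=> //; exists b.
        rewrite bE in mjb; have := maxidB mjb (Hw j jM).
        by rewrite opprB addrA subrK.
      have We (j' : 'I_M.+1) c : vring W (r (gen j' - cT c)).
        rewrite rmorphB rcT; apply: vringB => //; rewrite -rE.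
        by have [] := gs' j' (ltn_ord j').
      rewrite rE rmorph_prod (bigD1 (Ordinal (jM : (j < M.+1)%N))) //=.
      apply: maxidMr; last first.
        rewrite rmorph_prod (bigD1 b) //=; apply: maxidMr; last first.
          by rewrite rmorphB rcT -rE.
        by apply: vring_prod => c _; apply: (We (Ordinal (jM : (j < M.+1)%N))).
      apply: vring_prod => j' _; rewrite rmorph_prod; apply: vring_prod => c _; exact: We.
    have Ue := Us' e (mem_tower e); have Uh := Us' h (mem_tower h).
    have [N0 HN0] := unram_power_bound Ue me Uh.
    by exists N0 => N /HN0; rewrite rE rmorphM rmorphXn.
  have PeN := integral_at_place mP Pg HN.
  have ueN := vunitX N ue.
  rewrite -[h](mulKf (vunit_neq0 ueN)); apply: vringM => //.
  by case/vunitV: ueN.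
move=> z; split; last exact: sub.
move=> Pz; apply: contrapT => nWz.
have [r rE] := word_rmorph ww.
have [mz rz0] := pole_inv nWz.
have [n un] := unram_ord (Us z (mem_tower z)) rz0.
case: n un => n un.
  by apply: nWz; apply/(ord_vring t0 mt un).
pose y := gen 0 - constT T a.
have ry : r y = t by rewrite -rE word_prime.
have y0 : y != 0 by rewrite -(fmorph_eq0 r) ry.
have z0 : z != 0 by rewrite -(fmorph_eq0 r) -rE.
apply: (@inv_pole _ _ _ P (y ^+ n.+1)); rewrite ?expf_neq0 //.
  by apply: maxidX => //; apply: mP.
have -> : (y ^+ n.+1)^-1 = z * (z * y ^+ n.+1)^-1 by field; rewrite z0 expf_neq0.
apply: vringM => //; apply: sub.
rewrite rE fmorphV rmorphM rmorphXn ry -rE.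
by case/vunitV: un => _ + _; rewrite NegzE -exprnN invrK.
Qed.

End Points.

(** * The trace polynomial and self-orthogonality *)

Local Notation frac := (@FracField.tofrac {poly K}).

Definition trace_poly : {poly K} := 'X^q + 'X.

Lemma size_trace_poly : size trace_poly = q.+1.
Proof. by rewrite -[trace_poly]subr0 -polyC0 size_AS_poly. Qed.

Lemma trace_poly_neq0 : trace_poly != 0.
Proof. by rewrite -size_poly_eq0 size_trace_poly. Qed.

Lemma trace_gen : gen 0 ^+ q + gen 0 = (frac trace_poly : rat_funs K)%:A.
Proof.
rewrite gen0 exprZn expr1n -scalerDl; congr (_ *: _).
by rewrite /trace_poly tofracD tofracXn.
Qed.

Section TwoFunctions.
Variables (f1 f2 : T).
Hypotheses (Gf1 : RR_space G f1) (Gf2 : RR_space G f2).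

(** The trace has poles of order at most q - 2 at the elements of Omega, at most q - 2
    at infinity, and no others. *)
Lemma trace_polynomial : exists (h : rat_funs K) (N : {poly K}),
  [/\ itrace q M gen M (f1 * f2) = h%:A, h * frac trace_poly ^+ (q - 2) = frac N &
      (size N <= (q.+1 * (q - 2)).+1)%N].
Proof.
have /vlineP[h hE] : itrace q M gen M (f1 * f2) \in 1%VS.
  have : itrace q M gen M (f1 * f2) \in tower gen (M - M).
    by apply: itrace_tower; apply: mem_tower.
  by rewrite subnn.
have finE : itrace q M gen M (finite_part f1 f2) = (h * frac trace_poly ^+ (q - 2))%:A.
  rewrite /finite_part trace_gen exprZn expr1n mulrC itrace_scale // hE.
  by rewrite -scalerAl mul1r scalerA mulrC.
have infE : itrace q M gen M (infinite_part f1 f2) = (h * (X1 K)^-1 ^+ (q - 2))%:A.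
  have -> : infinite_part f1 f2 = ((X1 K)^-1 ^+ (q - 2))%:A * (f1 * f2).
    rewrite /infinite_part mulrC gen0; congr (_ * _).
    by rewrite -(fmorphV (in_alg T)) /= exprZn expr1n.
  rewrite itrace_scale // hE -scalerAl mul1r scalerA mulrC //.
have [N NE] : exists N, h * frac trace_poly ^+ (q - 2) = frac N.
  apply: (@pole_free K C kap q LM) => c iota iz.
  have [s hs] := lhom0_exists gen iota.
  have := finite_integral Gf1 Gf2 iz hs.
  by rewrite finE; case: hs => _ ->.
exists h, N; split=> //.
have [N0|N0] := eqVneq N 0; first by rewrite N0 size_poly0.
have [iota [s [iz hsU _]]] := infinite_start.
have := infinite_integral Gf1 Gf2 iz hsU.
rewrite infE; have [[_ sc] _] := hsU; rewrite sc rmorphM rmorphXn fmorphV.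
rewrite (subst_X iz) invrK.
have ihN : iota h * iota (frac trace_poly) ^+ (q - 2) = iota (frac N).
  by rewrite -NE rmorphM rmorphXn.
have uN := horner_infinite kap LM N0.
have uT := horner_infinite kap LM trace_poly_neq0.
rewrite size_trace_poly /= in uT; rewrite !iz in ihN.
set n := (map_poly _ N).[_] in uN ihN; set y := (map_poly _ trace_poly).[_] in uT ihN.
have y0 : y != 0 by apply: contraTneq (vunit_neq0 uT) => ->; rewrite mul0r eqxx.
have ih : iota h = n / y ^+ (q - 2) by rewrite -ihN mulfK ?expf_neq0.
pose d := ((q.+1 * (q - 2))%N%:Z - (size N).-1%:Z).
have uh : vunit W (iota h * t ^+ (q - 2) / t ^ d).
  have -> : iota h * t ^+ (q - 2) / t ^ d =
     (n * t ^+ (size N).-1) / (y * t ^+ q) ^+ (q - 2).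
    rewrite ih /d expfzDr // -exprnN -exprnP mulSn exprD mulnC exprMn.
    rewrite [t ^+ (_ * q)]exprM -[(t ^+ _) ^+ q]exprM mulnC exprM.
    by field; rewrite ?y0 ?t0 ?expf_neq0.
  by apply: vunit_div => //; apply: vunitX.
move=> Wh; have := proj1 (ord_vring t0 mt uh) Wh.
rewrite /d subr_ge0 lez_nat => H.
by rewrite -(prednK (n := size N)) ?ltnS // lt0n size_poly_eq0.
Qed.

(** The element a ^ q + a is in the field of q elements, so its power of exponent
    q - 2 is its inverse. *)
Lemma value_trace (h : rat_funs K) (N : {poly K}) a (iota : {rmorphism rat_funs K -> L}) :
  h * frac trace_poly ^+ (q - 2) = frac N -> a ^+ q + a != 0 ->
  is_subst iota (cemb LM (kap a) + t) ->
  maxid W (iota h - kp (N.[a] * (a ^+ q + a))).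
Proof.
move=> hN aOm iz; have mA p : maxid W (iota (frac p) - kp p.[a]).
  by rewrite iz; apply: cong_horner => //; rewrite addrAC subrr add0r; apply: maxid_t.
have Ta : trace_poly.[a] = a ^+ q + a by rewrite !hornerE.
have uT : vunit W (kp (a ^+ q + a)) by apply: vunit_kappa.
have mT := mA trace_poly; rewrite Ta in mT.
have uT' := cong_unit uT mT.
have -> : iota h = iota (frac N) / iota (frac trace_poly) ^+ (q - 2).
  by rewrite -hN rmorphM rmorphXn mulfK // expf_neq0 // (vunit_neq0 uT').
have -> : N.[a] * (a ^+ q + a) = N.[a] / (a ^+ q + a) ^+ (q - 2).
  congr (_ * _); apply: (mulIf (expf_neq0 (q - 2) aOm)); rewrite mulVf ?expf_neq0 //.
  rewrite -exprS; apply: (mulfI aOm); rewrite mulr1 -exprS.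
  have -> : (q - 2).+2 = q by rewrite subn2; case: q q1 => [|[]].
  by rewrite (frobenius hq hK idfun) (expq2 hK) addrC.
rewrite fmorph_div rmorphXn; apply: congM => //.
- by case/vunitV: (vunitX (q - 2) uT).
- by apply: congV; [apply: vunitX | apply: congX => //; case: uT].
Qed.

End TwoFunctions.

Definition divisor_fun := (x 1%N ^+ (q ^ 2) - x 1%N) / (x 1%N ^+ q + x 1%N).

Lemma trace_gen_neq0 : gen 0 ^+ q + gen 0 != 0.
Proof.
by rewrite trace_gen scaler_eq0 oner_eq0 orbF tofrac_eq0 trace_poly_neq0.
Qed.

Lemma divisor_funM : divisor_fun * (gen 0 ^+ q + gen 0) = \prod_(a : K) (gen 0 - constT T a).
Proof.
rewrite /divisor_fun divfK ?trace_gen_neq0 // -hK.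
have := congr1 (fun p => (map_poly (cT T) p).[gen 0]) (finField_genPoly K).
rewrite /= rmorphB /= map_polyXn map_polyX !hornerE => ->.
rewrite rmorph_prod horner_prod; apply: eq_bigr => a _.
by rewrite /= map_polyXsubC hornerXsubC.
Qed.

Lemma divisor_funE : divisor_fun = (gen 0 ^+ q + gen 0) ^+ q.-1 - 1.
Proof.
have u0 := trace_gen_neq0; apply: (mulIf u0).
rewrite mulrBl mul1r -exprSr prednK ?(ltnW q1) // (frobenius hq hK (cT T)) -exprM mulnn.
by rewrite /divisor_fun divfK //; rewrite /gen; ring.
Qed.

(** Since t = (x_1 ^ q + x_1) ^ (q - 1) - 1, the element x_1 ^ q + x_1 is a unit at a
    zero of t; its product with t is the product of all x_1 - a. *)
Lemma zero_point (P : place (constT T)) : is_zero P divisor_fun ->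
  exists a, a ^+ q + a != 0 /\ maxid P (gen 0 - constT T a).
Proof.
move=> /is_zero_maxid mt0.
have uq : vunit P ((gen 0 ^+ q + gen 0) ^+ q.-1).
  have -> : (gen 0 ^+ q + gen 0) ^+ q.-1 = 1 + divisor_fun.
    by rewrite divisor_funE addrCA subrr addr0.
  by apply: vunitDm => //; apply: vunit1.
have q10 : (0 < q.-1)%N by have := q1; case: (q) => [|[]].
have Pu : vring P (gen 0 ^+ q + gen 0) by apply: vring_root q10 (vunit_vring uq).
have uu : vunit P (gen 0 ^+ q + gen 0).
  apply/vunitE; split=> // mu; apply: (maxid_vunit _ uq); exact: maxidX.
have Pg : vring P (gen 0) by apply: AS_vring Pu.
have := maxidMr (vunit_vring uu) mt0; rewrite divisor_funM => mprod.
have [|a _ ma] := maxid_prod _ mprod.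
  by move=> a _; apply: vringB => //; apply: vring_const1.
exists a; split=> //; apply/eqP => aq; apply: (maxid_vunit _ uu).
have PcT c : vring P (cT T c) by apply: vring_const1.
have := cong_horner PcT trace_poly ma.
by rewrite !hornerE aq rmorph0 subr0 rmorphD /= map_polyXn map_polyX !hornerE.
Qed.

(** The function x_1 - a is a prime element at such a place, and t is the product of
    all x_1 - b divided by the unit x_1 ^ q + x_1. *)
Lemma point_zero (P : place (constT T)) a (iota : {rmorphism rat_funs K -> L}) (s0 : T -> L) u :
  a ^+ q + a != 0 -> is_subst iota (cemb LM (kap a) + t) ->
  lhom gen iota 0 s0 -> u \in words M -> above s0 u P ->
  is_zero P divisor_fun.
Proof.
move=> aOm iz hs0 uu ab; have [r rE] := word_rmorph aOm iz hs0 uu.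
have [[_ Us] _] := word_homP aOm iz hs0 (leqnn M) uu.
have r0 := word_hom_gen0 aOm iz hs0 (leqnn M) uu.
have rc c := word_const aOm iz hs0 c uu.
rewrite rE in Us r0 rc; rewrite /above rE in ab.
pose y := gen 0 - constT T a; have ry : r y = t by rewrite rmorphB r0 rc addrAC subrr add0r.
have y0 : y != 0 by rewrite -(fmorph_eq0 r) ry.
have ord z : z != 0 -> exists n : int, vunit W (r z / r y ^ n).
  by move=> z0; rewrite ry; apply: unram_ord; rewrite ?fmorph_eq0 //; apply/Us/mem_tower.
have my : maxid W (r y) by rewrite ry.
have [_ valE] := pulled_val ab my y0 ord.
have u1 : vunit W (r divisor_fun / r y ^ 1).
  have uq : vunit W (r (gen 0 ^+ q + gen 0)).
    apply: (@cong_unit _ _ _ W _ (kp (a ^+ q + a))); first exact: vunit_kappa.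
    rewrite rmorphD rmorphXn r0; have := @cong_horner _ _ _ _ W kp Wkp trace_poly (kp a + t) a.
    rewrite !hornerE rmorphD /= map_polyXn map_polyX !hornerE; apply.
    by rewrite addrAC subrr add0r.
  have -> : r divisor_fun / r y ^ 1 =
     (\prod_(b | b != a) r (gen 0 - constT T b)) / r (gen 0 ^+ q + gen 0).
    have u0 := vunit_neq0 uq; rewrite expr1z.
    apply: (canRL (mulfK u0)); rewrite mulrAC -rmorphM divisor_funM.
    by rewrite rmorph_prod (bigD1 a) //= -/y ry mulrAC mulfV ?mul1r.
  apply: vunit_div => //; apply: vunit_prod => b ba.
  apply: (@cong_unit _ _ _ W _ (kp (a - b))); first by apply: vunit_kappa; rewrite // subr_eq0 eq_sym.
  have -> : r (gen 0 - constT T b) - kp (a - b) = t; last by [].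
  have -> : kp (a - b) = kp a - kp b by rewrite rmorphB.
  rewrite rmorphB r0 rc; have e (A B s : L) : A + s - B - (A - B) = s by ring.
  exact: e.
have d0 : divisor_fun != 0.
  apply: contraTneq (vunit_neq0 u1) => ->; by rewrite rmorph0 mul0r eqxx.
by split=> //; rewrite (valE _ _ u1).
Qed.

Lemma eval_at_eq (P : place (constT T)) z c : maxid P (z - constT T c) -> eval_at P z = c.
Proof. by move=> mc; apply: xget_unique => // d md; apply: residue_uniq md mc. Qed.

(** The points of D are matched with the pairs of an a and a word over a. The sum
    over the words gives the value of the trace at a; the sum over a is a sum of
    values of a polynomial of degree less than #|K| - 1. *)
Theorem self_orthogonal_code :
  self_orthogonal (AG_code (zero_divisor (constT T) divisor_fun) G).
Proof.
move=> _ [f2 Gf2 <-] _ [f1 Gf1 <-].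
set D := zero_divisor _ _.
have -> : \sum_i (\row_i eval_at (tnth (in_tuple (dom D)) i) f1) 0 i *
     (\row_i eval_at (tnth (in_tuple (dom D)) i) f2) 0 i =
   \sum_(P <- dom D) eval_at P f1 * eval_at P f2.
  by rewrite [RHS]big_tnth; apply: eq_bigr => i _; rewrite !mxE.
(* I a substitutes a + t for x_1; Pl (a, u) is the place of the word u above a *)
have [I HI] : {I : K -> {rmorphism rat_funs K -> L} * (T -> L) &
    forall a, is_subst (I a).1 (cemb LM (kap a) + t) /\ lhom gen (I a).1 0 (I a).2}.
  apply: (@boolp.choice _ _ (fun a p =>
    is_subst p.1 (cemb LM (kap a) + t) /\ lhom gen p.1 0 p.2)) => a.
  have [iota iz] := substitution_exists (@transcendental_finite K C kap q LM (kap a)).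
  by have [s hs] := lhom0_exists gen iota; exists (iota, s).
have [Pl HPl] : {Pl : K * seq K -> place (constT T) & forall p,
    p.1 ^+ q + p.1 != 0 -> p.2 \in words M -> above (I p.1).2 p.2 (Pl p)}.
  apply: (@boolp.choice _ _ (fun p P =>
    p.1 ^+ q + p.1 != 0 -> p.2 \in words M -> above (I p.1).2 p.2 P)).
  move=> -[a u] /=; have [iz hs] := HI a.
  have [aOm|aOm] := boolP (a ^+ q + a != 0); last by exists Pinf.
  have [uw|uw] := boolP (u \in words M); last by exists Pinf.
  by have [P HP] := place_of_word aOm iz hs uw; exists P.
pose pts := [seq a <- enum K | a ^+ q + a != 0].
have ptsP a : (a \in pts) = (a ^+ q + a != 0) by rewrite mem_filter mem_enum andbT.
pose idx := [seq (a, u) | a <- pts, u <- words M].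
have idxP p : p \in idx -> p.1 ^+ q + p.1 != 0 /\ p.2 \in words M.
  by move=> /allpairsP[[a u] [/= ap uw ->]]; rewrite -ptsP.
have idxI a u : a ^+ q + a != 0 -> u \in words M -> (a, u) \in idx.
  by move=> aOm uw; apply/allpairsP; exists (a, u); rewrite /= ptsP.
have Plmax p z : p \in idx -> maxid (Pl p) z <-> maxid W (word_hom (I p.1).2 p.2 z).
  move=> /idxP[aOm uw]; have [iz hs] := HI p.1.
  exact: (above_maxid aOm iz hs z uw (HPl p aOm uw)).
have zeroP P : is_zero P divisor_fun <-> P \in [seq Pl p | p <- idx].
  split=> [zP|/mapP[p pi ->]].
    have [a [aOm ma]] := zero_point zP; have [iz hs] := HI a.
    have [u uw ab] := place_is_word aOm iz hs ma.
    apply/mapP; exists (a, u); first exact: idxI.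
    apply: place_eq => z; rewrite ab; symmetry; exact: HPl.
  have [aOm uw] := idxP p pi; have [iz hs] := HI p.1.
  exact: (point_zero aOm iz hs uw (HPl p aOm uw)).
have Pl_inj : {in idx &, injective Pl}.
  move=> [a u] [b u'] pi pi' E.
  have [/= aOm uw] := idxP _ pi; have [/= bOm uw'] := idxP _ pi'.
  have [iz hs] := HI a; have [iz' hs'] := HI b.
  have m1 : maxid (Pl (a, u)) (gen 0 - constT T a).
    by apply/(Plmax _ _ pi); rewrite (word_prime aOm iz hs uw).
  have m2 : maxid (Pl (b, u')) (gen 0 - constT T b).
    by apply/(Plmax _ _ pi'); rewrite (word_prime bOm iz' hs' uw').
  have ab : a = b by rewrite -E in m2; apply: residue_uniq m1 m2.
  subst b; congr (_, _).
  apply: (word_inj aOm iz hs (leqnn M)) => // j jM.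
  have [c [mc _]] := word_residues aOm iz hs (leqnn M) uw jM.
  have mc' : maxid (Pl (a, u)) (gen j - constT T c).
    by apply/(Plmax _ _ pi); rewrite (word_subC aOm iz hs _ _ uw).
  rewrite E in mc'; move/(Plmax _ _ pi'): mc'; rewrite (word_subC aOm iz hs _ _ uw') => mc'.
  by have := maxidB mc mc'; rewrite opprB addrA subrK.
have idx_uniq : uniq idx.
  apply: allpairs_uniq; first by rewrite filter_uniq ?enum_uniq.
    exact: words_uniq.
  by move=> [? ?] [? ?] _ _ /= [-> ->].
have finZ : finite_set [set P : place (constT T) | is_zero P divisor_fun].
  by apply: (sub_finite_set _ (finite_seq [seq Pl p | p <- idx])) => P /zeroP.
have domE : perm_eq (dom D) [seq Pl p | p <- idx].
  apply: uniq_perm; first exact: uniq_dom.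
    by rewrite map_inj_in_uniq.
  move=> P; rewrite mem_dom; apply/idP/idP => [|/zeroP zP].
    by case: (coeff_zero_divisor divisor_fun P) => [->|[/zeroP]]; rewrite ?eqxx.
  rewrite /D /zero_divisor coeff_fsum_finite //.
  by case: zP => _ /lt0r_neq0.
rewrite (perm_big _ domE) big_map big_allpairs_dep /=.
have [h [N [hE hN sN]]] := trace_polynomial Gf1 Gf2.
pose d := \prod_(c in Omega q K | c != 0) c.
have local a : a \in pts ->
    \sum_(u <- words M) eval_at (Pl (a, u)) f1 * eval_at (Pl (a, u)) f2 =
    d ^+ M * (N.[a] * (a ^+ q + a)).
  rewrite ptsP => aOm; have [iz hs] := HI a.
  have good f : RR_space G f -> forall u, u \in words M ->
      vring W (word_hom (I a).2 u f).
    move=> Gf u uw; have [hu gu] := word_homP aOm iz hs (leqnn M) uw.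
    have [r rE] := word_rmorph aOm iz hs uw; rewrite rE in hu gu *.
    have [hr _] := hu.
    exact: (RR_good iz hr hu
       (good_pole iz hr) gu Gf).
  have evalP f u : RR_space G f -> u \in words M ->
      maxid W (word_hom (I a).2 u f - kp (eval_at (Pl (a, u)) f)).
    move=> Gf uw.
    have [c mc] := rational_value aOm iz hs (good f Gf) uw.
    suff -> : eval_at (Pl (a, u)) f = c by [].
    by apply/eval_at_eq/(Plmax _ _ (idxI _ _ aOm uw)); rewrite (word_subC aOm iz hs _ _ uw).
  apply: (cong_kp_eq Wkp (P := W) (u := (I a).1 h * kp d ^+ M)); last first.
    have mv := value_trace hN aOm iz.
    by rewrite mulrC rmorphM rmorphXn -mulrBr; apply: maxidMl => //; apply: vringX.
  have := sum_words aOm iz hs (f1 * f2) (leqnn M).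
  rewrite subnn hE; case: hs => _ ->; rewrite /node_prod.
  have -> : \prod_(c in Omega q K | c != 0) kp c = kp d by rewrite rmorph_prod.
  rewrite [_ ^+ M * _]mulrC => <-; rewrite rmorph_sum -sumrB big_seq; apply: maxid_sum => u uw.
  have [iz' hs] := HI a.
  have [r rE] := word_rmorph aOm iz hs uw.
  rewrite [itrace _ _ _ _ _]/= rmorphM rE rmorphM -rE; apply: congM => //; exact: evalP.
rewrite big_seq (eq_bigr _ local) -big_seq -mulr_sumr.
suff -> : \sum_(a <- pts) N.[a] * (a ^+ q + a) = 0 by rewrite mulr0.
have sz : (size (N * trace_poly)%R < #|K|)%N.
  apply: (leq_ltn_trans (size_polyMleq _ _)); rewrite size_trace_poly addnS /= hK.
  apply: (@leq_ltn_trans ((q.+1 * (q - 2)).+1 + q)); first by rewrite leq_add2r.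
  have := q1; rewrite /= ; clear; case: (q) => [|[|n]] // _.
  by rewrite subn2 /=; rewrite expnS expn1; nia.
rewrite -[RHS](sum_horner0 sz) big_filter [RHS](bigID (fun a => a ^+ q + a != 0)) /=.
rewrite [X in _ = _ + X]big1 ?addr0 => [|a]; last first.
  by rewrite negbK => /eqP aq; rewrite hornerM !hornerE aq mulr0.
rewrite big_enum_cond /=; apply: eq_big => // a _.
by rewrite hornerM !hornerE.
Qed.

End GSTower.

Theorem theorem6p2 (q m : nat) (K : finFieldType)
    (T : fieldExtType (rat_funs K)) (x : nat -> T)
    (hq : prime_power q) (hK : #|K| = (q ^ 2)%N) (hm : (2 <= m)%N)
    (hT : GS_tower q m x)
    (Pinf : place (constT T))
    (hPinf : exists P : place (@const1 K), is_pole P (X1 K) /\ lies_above Pinf P)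
    (Pa : K -> place (constT T))
    (hPa : forall a : K, a \in Omega_star q ->
       exists P : place (@const1 K),
         is_zero P (X1 K - const1 a) /\ lies_above (Pa a) P)
    (v : K -> int) (w : nat -> K -> int) (v0 vinf : int)
    (hv : forall a : K, a \in Omega_star q ->
       0 <= v a /\ (v a)%:Q <= ((q ^ m)%N%:Q - 2) / 2)
    (hw : forall (a : K) (k : nat), a \in Omega_star q -> (1 <= k <= (m - 2)./2)%N ->
       0 <= w k a <= (q ^ (m - 2 * k - 1))%N%:Z - 1)
    (hv0 : 0 <= v0 /\ v0%:Q <= (q%:Q - 2) / 2)
    (hvinf : 0 <= vinf /\ vinf%:Q <= ((q ^ m)%N%:Q - 2) / 2) :
  let t := (x 1%N ^+ (q ^ 2) - x 1%N) / (x 1%N ^+ q + x 1%N) in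
  let D : {freeg (place (constT T))} := zero_divisor (constT T) t in
  let G : {freeg (place (constT T))} :=
    \sum_(a : K | a \in Omega_star q) << v a *g Pa a >>
    + \sum_(1 <= k < (m - 2)./2.+1) \sum_(a : K | a \in Omega_star q)
        A_div x k a *~ w k a
    + zero_divisor (constT T) (x 1%N) *~ v0
    + << vinf *g Pinf >> in
  self_orthogonal (AG_code D G).
Proof.
have [C [kap kap_alg]] := countable_algebraic_closure K.
have frobL (L : fieldType) (s : {rmorphism C -> L}) (y z : L) :
  (y - z) ^+ q = y ^+ q - z ^+ q.
  exact: (frobeniusB hq hK (s \o kap)%FUN).
have [LM] := local_model_exists (q_gt1 hq) frobL.
exact: (self_orthogonal_code hq hK hm hT LM hPinf hPa hv hw hv0 hvinf kap_alg).
Qed.
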